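(* Let $n \ge 1$, let $B \subset \mathbb{C}^n$, and let $f \in L^1(\mathbb{H}^n)$ be supported on the set $B \times \mathbb{R} \subset \mathbb{C}^n\times\mathbb{R} = \mathbb{H}^n$. For $\lambda \in \mathbb{R}\setminus\{0\}$ let $\hat f(\lambda)$ denote the group Fourier transform of $f$, a bounded operator on $L^2(\mathbb{R}^n)$. (I) If $B$ is a compact set and $\hat f(\lambda)$ is a finite rank operator for all $\lambda \in \mathbb{R}\setminus\{0\}$, then $f \equiv 0$ (i.e. $f = 0$ almost everywhere). (II) If $B$ has finite Lebesgue measure and $\hat f(\lambda)$ is a rank one operator for all $\lambda \in \mathbb{R}\setminus\{0\}$, then $f \equiv 0$ (i.e. $f=0$ almost everywhere).
   Context: The Heisenberg group $\mathbb{H}^n$ is $\mathbb{C}^n \times \mathbb{R}$ with the group law $$(z,t)\cdot(w,s) = \left(z+w,\; t+s+\tfrac12 \operatorname{Im}(z\cdot\bar w)\right),\qquad z\cdot \bar w = \sum_{j=1}^n z_j\overline{w_j}.$$ Its Haar measure is Lebesgue measure $dz\,dt$ on $\mathbb{C}^n\times\mathbb{R}$, and $L^1(\mathbb{H}^n)$ is taken with respect to it. For $\lambda\in\mathbb{R}\setminus\{0\}$, the irreducible unitary representation $\pi_\lambda$ of $\mathbb{H}^n$ on $L^2(\mathbb{R}^n)$ is $$\pi_\lambda(z,t)\varphi(\xi) = e^{i\lambda t}\, e^{i\lambda(x\cdot\xi + \frac12 x\cdot y)}\,\varphi(\xi+y),\qquad z = x+iy,\ x,y\in\mathbb{R}^n,\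 \varphi\in L^2(\mathbb{R}^n).$$ For $f\in L^1(\mathbb{H}^n)$ the group Fourier transform is the bounded operator on $L^2(\mathbb{R}^n)$ $$\hat f(\lambda) = \int_{\mathbb{H}^n} f(z,t)\,\pi_\lambda(z,t)\,dz\,dt$$ (integral understood in the weak sense). ''Supported on $B\times\mathbb{R}$'' means that $f$ vanishes almost everywhere outside $B\times\mathbb{R}$. A ''rank one operator'' means an operator of the form $\varphi\mapsto\langle\varphi,\psi_1\rangle\psi_2$ with $\psi_1,\psi_2\in L^2(\mathbb{R}^n)$ (so the zero operator is allowed, i.e. rank at most one). *)

(* Defs.v *)
From HB Require Import structures.
From mathcomp Require Import all_boot all_order all_algebra.
From mathcomp Require Import complex.
From mathcomp Require Import all_classical all_reals all_analysis.
From mathcomp Require Import ring.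
Set Implicit Arguments.
Unset Strict Implicit.
Unset Printing Implicit Defensive.
Import Order.TTheory GRing.Theory Num.Theory.
Import numFieldNormedType.Exports.
Local Open Scope classical_set_scope.
Local Open Scope ring_scope.
Local Open Scope complex_scope.

Definition measure_rV_display : measure_display -> measure_display.
Proof. exact. Qed.

(* Product sigma-algebra on row vectors, generated by the coordinates as for
   n.-tuple T; on 'rV[R]_n these are the Borel sets. *)
Section measurable_rV.
Context {d} {T : measurableType d}.
Variable n : nat.

Let coord : 'I_n -> 'rV[T]_n -> T := fun i x => x ord0 i.

Let rV_set0 : g_sigma_preimage coord set0.
Proof. exact: sigma_algebra0. Qed.

Let rV_setC A : g_sigma_preimage coord A -> g_sigma_preimage coord (~` A).
Proof. exact: sigma_algebraC. Qed.

Let rV_bigcup (F : _^nat) : (forall i, g_sigma_preimage coord (F i)) ->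
  g_sigma_preimage coord (\bigcup_i (F i)).
Proof. exact: sigma_algebra_bigcup. Qed.

HB.instance Definition _ := @isMeasurable.Build (measure_rV_display d)
  'rV[T]_n (g_sigma_preimage coord) rV_set0 rV_setC rV_bigcup.

End measurable_rV.

Lemma measurable_coord d (T : measurableType d) n (i : 'I_n) :
  measurable_fun [set: 'rV[T]_n] (fun x : 'rV[T]_n => x ord0 i).
Proof.
move=> _ Y mY; rewrite setTI; apply: sub_sigma_algebra => /=.
rewrite -bigcup_seq/=; exists i => /=; first by rewrite mem_index_enum.
by exists Y => //; rewrite setTI.
Qed.

Lemma measurable_fun_rV d1 d2 (T1 : measurableType d1) (T2 : measurableType d2)
    n (f : T1 -> 'rV[T2]_n) :
  (forall i, measurable_fun [set: T1] (fun x => f x ord0 i)) ->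
  measurable_fun [set: T1] f.
Proof.
move=> mf.
suff : g_sigma_preimage (fun i x => f x ord0 i) `<=` measurable.
  move=> sub _ A mA; apply: sub.
  rewrite (@g_sigma_preimage_comp _ _ _ 'rV[T2]_n (fun i x => x ord0 i) _ f).
  by exists A.
apply: smallest_sub; first exact: sigma_algebra_measurable.
case: n f mf => [|n] f mf; first by rewrite big_ord0.
rewrite -bigcup_mkord_ord; apply: bigcup_sub => i Ii.
by move=> A [B mB <-]; exact: mf.
Qed.

(* In the library, m1 \x m2 is canonically sigma-finite only when m1 and m2 are
   sub-probabilities. *)
Lemma sigma_finite_product d1 d2 (T1 : measurableType d1)
    (T2 : measurableType d2) (R : realType)
    (m1 : {sigma_finite_measure set T1 -> \bar R})
    (m2 : {sigma_finite_measure set T2 -> \bar R}) :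
  sigma_finite setT (m1 \x m2)%E.
Proof.
have /sigma_finiteP[F [TF ndF Foo]] := sigma_finiteT m1.
have /sigma_finiteP[G [TG ndG Goo]] := sigma_finiteT m2.
exists (fun n => F n `*` G n).
  rewrite -setXTT TF TG predeqE => -[x y]; split.
    move=> [/= [n _ Fnx] [k _ Gky]]; exists (maxn n k) => //; split.
    - by move: x Fnx; exact/subsetPset/ndF/leq_maxl.
    - by move: y Gky; exact/subsetPset/ndG/leq_maxr.
  by move=> [n _ []/= ? ?]; split; exists n.
move=> k; have [? ?] := Foo k; have [? ?] := Goo k.
split; first exact: measurableX.
by rewrite product_measure1E// lte_mul_pinfty// ge0_fin_numE.
Qed.

Section lebesgue_rV.
Context {R : realType}.

Definition rV_cons n (p : R * 'rV[R]_n) : 'rV[R]_n.+1 :=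
  \row_j oapp (fun k => p.2 ord0 k) p.1 (unlift ord0 j).

Definition rV_uncons n (x : 'rV[R]_n.+1) : R * 'rV[R]_n :=
  (x ord0 ord0, \row_j x ord0 (lift ord0 j)).

Lemma rV_consK n : cancel (@rV_cons n) (@rV_uncons n).
Proof.
move=> [a x]; congr pair; first by rewrite mxE unlift_none.
by apply/rowP => j; rewrite !mxE liftK.
Qed.

Lemma rV_unconsK n : cancel (@rV_uncons n) (@rV_cons n).
Proof.
move=> x; apply/rowP => j; rewrite mxE.
by case: unliftP => [k|] -> /=; rewrite ?mxE.
Qed.

Lemma measurable_rV_cons n : measurable_fun setT (@rV_cons n).
Proof.
apply: measurable_fun_rV => i; under eq_fun do rewrite mxE.
case: (unliftP ord0 i) => [k|] _ /=; last exact: measurable_fst.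
exact: (measurableT_comp (measurable_coord k) measurable_snd).
Qed.

Lemma measurable_rV_uncons n : measurable_fun setT (@rV_uncons n).
Proof.
apply: measurable_fun_pair; first exact: measurable_coord.
apply: measurable_fun_rV => i; under eq_fun do rewrite mxE.
exact: measurable_coord.
Qed.

Section cons_measure.
Local Open Scope ereal_scope.
Variables (n : nat) (mu : {sigma_finite_measure set 'rV[R]_n -> \bar R}).

Definition cons_measure : set 'rV[R]_n.+1 -> \bar R :=
  pushforward (lebesgue_measure \x mu) (@rV_cons n).

Let cons_measure0 : cons_measure set0 = 0.
Proof. by rewrite /cons_measure /pushforward preimage_set0 measure0. Qed.

Let cons_measure_ge0 A : 0 <= cons_measure A.
Proof. by rewrite /cons_measure /pushforward; exact: measure_ge0. Qed.

Let cons_measure_sigma_additive : semi_sigma_additive cons_measure.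
Proof.
exact: (@measure_semi_sigma_additive _ _ _
  (measure_function_pushforward__canonical__measure_function_Measure
     (lebesgue_measure \x mu) (@measurable_rV_cons n))).
Qed.

HB.instance Definition _ := isMeasure.Build _ _ _ cons_measure
  cons_measure0 cons_measure_ge0 cons_measure_sigma_additive.

Let cons_measure_sigma_finite : sigma_finite setT cons_measure.
Proof.
have [F FT Ffin] : sigma_finite setT (lebesgue_measure \x mu).
  exact: sigma_finite_product.
exists (fun k => @rV_uncons n @^-1` F k).
  by rewrite -preimage_bigcup -FT preimage_setT.
move=> k; have [mFk Fkoo] := Ffin k; split.
  by rewrite -[X in measurable X]setTI; exact: measurable_rV_uncons.
rewrite /cons_measure /pushforward -comp_preimage.
by rewrite (_ : _ \o _ = id) // funeqE => p /=; rewrite rV_consK.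
Qed.

HB.instance Definition _ := Measure_isSigmaFinite.Build _ _ _ cons_measure
  cons_measure_sigma_finite.

End cons_measure.

Fixpoint lebesgue_rV n : {sigma_finite_measure set 'rV[R]_n -> \bar R} :=
  match n with
  | 0 => \d_(0 : 'rV[R]_0)
  | m.+1 => cons_measure (lebesgue_rV m)
  end.

Lemma lebesgue_rV_box n (A : 'I_n -> set R) :
  (forall i, measurable (A i)) ->
  lebesgue_rV n [set x | forall i, A i (x ord0 i)] =
  (\prod_(i < n) lebesgue_measure (A i))%E.
Proof.
elim: n A => [|n IH] A mA /=.
  rewrite big_ord0 diracE mem_set//= => -[]//.
have mbox : measurable [set x : 'rV[R]_n | forall i, A (lift ord0 i) (x ord0 i)].
  rewrite (_ : mkset _ = \bigcap_(i in [set: 'I_n])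
      ((fun x : 'rV[R]_n => x ord0 i) @^-1` A (lift ord0 i))); last first.
    by apply/seteqP; split => [x Ax i _|x Ax i]; [exact: Ax|exact: (Ax i)].
  apply: fin_bigcap_measurable => // i _.
  by rewrite -[X in measurable X]setTI; exact: measurable_coord.
rewrite big_ord_recl -IH // -product_measure1E //.
rewrite /cons_measure /pushforward; congr product_measure1.
apply/seteqP; split => [[a x] Ap|[a x] [Aa Ax] i] /=.
  split; first by have := Ap ord0; rewrite mxE unlift_none.
  by move=> i; have := Ap (lift ord0 i); rewrite mxE liftK.
by rewrite mxE; case: unliftP => [k|] -> /=; [exact: Ax|exact: Aa].
exact: (mA ord0).
Qed.

End lebesgue_rV.
Arguments lebesgue_rV R n : clear implicits.

(* C^n is R^n x R^n, the pair (x, y) standing for z = x + iy; a point (z, t) of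
   H^n is ((x, y), t). *)
Notation Cn R n := ('rV[R]_n * 'rV[R]_n)%type.
Notation heisenberg R n := (Cn R n * R)%type.

Section haar.
Context {R : realType}.
Variable n : nat.
Local Open Scope ereal_scope.

Definition lebesgue_Cn : set (Cn R n) -> \bar R :=
  lebesgue_rV R n \x lebesgue_rV R n.

HB.instance Definition _ := Measure.on lebesgue_Cn.
HB.instance Definition _ := Measure_isSigmaFinite.Build _ _ _ lebesgue_Cn
  (sigma_finite_product (lebesgue_rV R n) (lebesgue_rV R n)).

Definition haar : set (heisenberg R n) -> \bar R :=
  lebesgue_Cn \x lebesgue_measure.

Let haar0 : haar set0 = 0.
Proof. exact: (measure0 (lebesgue_Cn \x lebesgue_measure)). Qed.

Let haar_ge0 A : 0 <= haar A.
Proof. exact: (measure_ge0 (lebesgue_Cn \x lebesgue_measure)). Qed.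

Let haar_sigma_additive : semi_sigma_additive haar.
Proof.
exact: (@measure_semi_sigma_additive _ _ _ (lebesgue_Cn \x lebesgue_measure)).
Qed.

HB.instance Definition _ := isMeasure.Build _ _ _ haar
  haar0 haar_ge0 haar_sigma_additive.
HB.instance Definition _ := Measure_isSigmaFinite.Build _ _ _ haar
  (sigma_finite_product lebesgue_Cn lebesgue_measure).

End haar.
Arguments lebesgue_Cn R n : clear implicits.
Arguments haar R n : clear implicits.

Section complex_valued.
Context d (T : measurableType d) {R : realType}.

Definition measurableC (f : T -> R[i]) :=
  measurable_fun setT (fun x => complex.Re (f x)) /\
  measurable_fun setT (fun x => complex.Im (f x)).

Definition integrableC (mu : {measure set T -> \bar R}) (f : T -> R[i]) :=
  mu.-integrable setT (fun x => (complex.Re (f x))%:E) /\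
  mu.-integrable setT (fun x => (complex.Im (f x))%:E).

Definition integralC (mu : {measure set T -> \bar R}) (f : T -> R[i]) : R[i] :=
  (\int[mu]_x complex.Re (f x)) +i* (\int[mu]_x complex.Im (f x)).

(* B is Lebesgue measurable (measurable for the completion of mu) and of
   finite measure. *)
Definition finite_lebesgue_measure (mu : {measure set T -> \bar R}) (B : set T) :=
  exists A N, [/\ measurable A, mu.-negligible N, B = A `|` N &
                  (mu A < +oo)%E].

End complex_valued.

Section heisenberg_fourier.
Context {R : realType} {n : nat}.
Implicit Types (p q : heisenberg R n) (lam : R) (phi psi : 'rV[R]_n -> R[i]).

Definition dotR (u v : 'rV[R]_n) : R := \sum_j u ord0 j * v ord0 j.

Definition dotC (z w : Cn R n) : R[i] :=
  \sum_j (z.1 ord0 j +i* z.2 ord0 j) * (w.1 ord0 j +i* w.2 ord0 j)^*.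

Definition heis_mul p q : heisenberg R n :=
  ((p.1.1 + q.1.1, p.1.2 + q.1.2),
   p.2 + q.2 + 2^-1 * complex.Im (dotC p.1 q.1)).

Definition expi (theta : R) : R[i] := cos theta +i* sin theta.

Definition schrodinger lam p phi : 'rV[R]_n -> R[i] :=
  let: ((x, y), t) := p in
  fun xi => expi (lam * t) * expi (lam * (dotR x xi + 2^-1 * dotR x y))
            * phi (xi + y).

Lemma expiD a b : expi (a + b) = expi a * expi b.
Proof.
apply/eqP; rewrite eq_complex /= cosD sinD.
by apply/andP; split; apply/eqP; ring.
Qed.

Lemma schrodingerM lam p q phi :
  schrodinger lam (heis_mul p q) phi =
  schrodinger lam p (schrodinger lam q phi).
Proof.
have dotDl u v w : dotR (u + v) w = dotR u w + dotR v w.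
  by rewrite /dotR -big_split; apply: eq_bigr => j _; rewrite mxE mulrDl.
have dotDr u v w : dotR w (u + v) = dotR w u + dotR w v.
  by rewrite /dotR -big_split; apply: eq_bigr => j _; rewrite mxE mulrDr.
have dotCE (z w : Cn R n) : complex.Im (dotC z w) = dotR w.1 z.2 - dotR z.1 w.2.
  rewrite /dotC /dotR -sumrB (raddf_sum (@complex.Im R)).
  by apply: eq_bigr => j _ /=; ring.
case: p q => [[x y] t] [[u v] s]; apply/funext => xi.
rewrite /schrodinger /heis_mul /= dotCE /= !mulrA -!expiD addrA.
congr (expi _ * _); rewrite !dotDl !dotDr; first by field.
Qed.

(* L^2 functions are handled through representatives; equality in L^2 is
   equality almost everywhere. *)
Definition L2 phi :=
  measurableC phi /\
  (\int[lebesgue_rV R n]_x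
     ((complex.Re (phi x)) ^+ 2 + (complex.Im (phi x)) ^+ 2)%:E < +oo)%E.

Definition inner phi psi : R[i] :=
  integralC (lebesgue_rV R n) (fun x => phi x * (psi x)^*).

(* g is the weak integral of f(z,t) pi_lam(z,t) phi over H^n. *)
Definition is_fourier (f : heisenberg R n -> R[i]) lam phi g :=
  L2 g /\ forall psi, L2 psi ->
    inner g psi =
    integralC (haar R n) (fun p => f p * inner (schrodinger lam p phi) psi).

(* The group Fourier transform of f at lam, applied to phi. For f in L^1 and
   phi in L^2 a g as above exists (Riesz) and is unique almost everywhere; xget
   picks a representative. *)
Definition fourier (f : heisenberg R n -> R[i]) lam phi : 'rV[R]_n -> R[i] :=
  xget (fun=> 0) [set g | is_fourier f lam phi g].

Definition finite_rank (T : ('rV[R]_n -> R[i]) -> 'rV[R]_n -> R[i]) :=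
  exists (N : nat) (b : 'I_N -> 'rV[R]_n -> R[i]),
    (forall k, L2 (b k)) /\
    forall phi, L2 phi -> exists c : 'I_N -> R[i],
      {ae lebesgue_rV R n, forall xi, T phi xi = \sum_k c k * b k xi}.

Definition rank_one (T : ('rV[R]_n -> R[i]) -> 'rV[R]_n -> R[i]) :=
  exists psi1 psi2, [/\ L2 psi1, L2 psi2 &
    forall phi, L2 phi ->
      {ae lebesgue_rV R n, forall xi, T phi xi = inner phi psi1 * psi2 xi}].

Definition supported_on (f : heisenberg R n -> R[i]) (E : set (heisenberg R n)) :=
  {ae haar R n, forall p, ~ E p -> f p = 0}.

End heisenberg_fourier.

(* Main.v *)
From mathcomp Require Import all_boot all_order all_algebra.
From mathcomp Require Import complex.
From mathcomp Require Import all_classical all_reals all_analysis.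
From mathcomp Require Import ring lra.
From mathcomp Require Import measurable_realfun.
Require Import Defs.
Set Implicit Arguments.
Unset Strict Implicit.
Unset Printing Implicit Defensive.
Import Order.TTheory GRing.Theory Num.Theory.
Import numFieldNormedType.Exports.
Local Open Scope classical_set_scope.
Local Open Scope ring_scope.
Local Open Scope complex_scope.

(** The representation acts on [f] through [F = central_ft f lam], its Fourier
    transform in the central variable: [fourier f lam] is the operator [weyl] with
    symbol [F] (lemma [fourier_indC]). It is an integral operator whose kernel
    [kern] is, after the change of variables [wigner_map], the Fourier transform
    [pft] of [F] in the first half of the variables (lemma [weyl_kern]). In both
    parts [F] is shown to vanish almost everywhere for each [lam <> 0]; the Fourier
    transform in the central variable being injective, this gives [f = 0] (lemma
    [central_ft_injective]). The analytic tool is [fourier_inversion], proved with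
    Poisson kernels.

    Part I (theorem [finite_rank_central_ft]). As [F] is supported in a bounded
    set, the operator moves supports by a bounded amount. Take [N + 1] slabs that
    are far apart, [N] bounding the rank. If the operator did not annihilate all
    functions carried by one of the slabs, there would be [N + 1] nonzero functions
    with disjoint supports in its range, of dimension at most [N] (lemma
    [disjoint_supports_dependent]). So the kernel vanishes over a slab, and [pft]
    vanishes on a strip. But for fixed second variable [pft] is the transform of a
    function of bounded support, which is analytic, so that it vanishes identically
    (lemma [newton_zero], by Newton interpolation), and [F = 0] by inversion.

    Part II (theorem [rank_one_central_ft]). A rank one kernel is a tensor product,
    and inversion shows that [F] is the ambiguity function [A] of two square
    integrable functions. For every [z0] the function
    [U z = A (z0 + z) * A (z0 - z)] is a multiple of its own symplectic Fourier
    transform (theorem [sym_ambig_self_dual]), and its support has finite measure.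
    An uncertainty principle (theorem [benedicks]) gives [U = 0], and
    [U 0 = A z0 ^+ 2], whence [A = 0].

    The uncertainty principle: suppose [U <> 0] has support [S] of finite measure
    and is its own transform up to a constant. For a polynomial [p] and a small
    step [eps], multiply [U] by [p] evaluated at the character [exp (i eps x)], [x]
    a fixed coordinate; on the dual side this forms a combination of the translates
    of [U] by at most [size p] multiples of [eps]. Polynomials of degrees
    [0 .. N - 1] that are orthogonal with respect to the weight [|U|^2] yield [N]
    orthogonal functions supported in [S], whose transforms all live on the union
    of [N] translates of [S]. If [eps] is small this union is hardly larger than
    [S], because [U] is continuous; and at each point the transforms are, up to
    normalization, the coefficients of a character on [S], so that Bessel's
    inequality bounds the sum of their squares by a constant independent of [N].
    Integrating over the union bounds [N] (lemma [energy_bound]), while [N] was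
    arbitrary. *)

(** * Complex-valued integrals *)

Section ell1_norm.
Context {R : realType}.
Implicit Types z w : R[i].

(** The ell^1 norm of R^2. It is additive in the two components, as complex
    integrals are, so that the triangle inequality for integrals holds for it
    componentwise; it is equivalent to the modulus, and submultiplicative. *)
Definition n1 z : R := `|complex.Re z| + `|complex.Im z|.

Lemma n1_ge0 z : 0 <= n1 z.
Proof. by rewrite /n1 addr_ge0. Qed.

Lemma n1_0 : n1 0 = 0.
Proof. by rewrite /n1 /= normr0 addr0. Qed.

Lemma n1_eq0 z : n1 z = 0 -> z = 0.
Proof.
move/eqP; rewrite /n1 paddr_eq0 // !normr_eq0 => /andP[/eqP a /eqP b].
by apply/eqP; rewrite eq_complex /= a b !eqxx.
Qed.

Lemma n1D z w : n1 (z + w) <= n1 z + n1 w.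
Proof.
case: z => a b; case: w => c d; rewrite /n1 /=.
have := ler_normD a c; have := ler_normD b d; lra.
Qed.

Lemma n1M z w : n1 (z * w) <= n1 z * n1 w.
Proof.
case: z => a b; case: w => c d; rewrite /n1 /=.
have := ler_normB (a * c) (b * d); have := ler_normD (a * d) (b * c).
rewrite !normrM; lra.
Qed.

Lemma n1_conj z : n1 z^*%R = n1 z.
Proof. by case: z => a b; rewrite /n1 /= normrN. Qed.

Lemma n1_expi t : n1 (expi t) <= 2.
Proof.
rewrite /n1 /= -[2%:R]/(1 + 1); apply: lerD; rewrite ler_norml.
  by rewrite cos_geN1 cos_le1.
by rewrite sin_geN1 sin_le1.
Qed.

Lemma n1_sum I (s : seq I) (F : I -> R[i]) :
  n1 (\sum_(i <- s) F i) <= \sum_(i <- s) n1 (F i).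
Proof.
elim: s => [|i s IH]; first by rewrite !big_nil n1_0.
by rewrite !big_cons (le_trans (n1D _ _)) // lerD2l.
Qed.

Definition sqn z : R := (complex.Re z) ^+ 2 + (complex.Im z) ^+ 2.

Lemma sqn_ge0 z : 0 <= sqn z.
Proof. by rewrite addr_ge0 // sqr_ge0. Qed.

Lemma sqnM z w : sqn (z * w) = sqn z * sqn w.
Proof. by case: z => a b; case: w => c d; rewrite /sqn /=; ring. Qed.

Lemma sqn_n1 z : sqn z <= (n1 z) ^+ 2.
Proof.
case: z => a b; rewrite /sqn /n1 /= sqrrD !real_normK ?num_real //.
have : 0 <= `|a| * `|b| by rewrite mulr_ge0.
lra.
Qed.

Lemma n1_sqn z : (n1 z) ^+ 2 <= 2 * sqn z.
Proof.
case: z => a b; rewrite /sqn /n1 /=.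
rewrite -(real_normK (num_real a)) -(real_normK (num_real b)).
have := sqr_ge0 (`|a| - `|b|); rewrite sqrrB sqrrD; lra.
Qed.

Lemma n1_young z w : n1 (z * w) <= sqn z + sqn w.
Proof.
apply: le_trans (n1M z w) _.
have := n1_sqn z; have := n1_sqn w.
have := sqr_ge0 (n1 z - n1 w); rewrite sqrrB; lra.
Qed.

Lemma mul_conj z : z * z^*%R = (sqn z)%:C.
Proof.
by case: z => a b; apply/eqP; rewrite eq_complex /sqn /=; apply/andP; split;
  apply/eqP; ring.
Qed.

Lemma sqn_eq0 z : sqn z = 0 -> z = 0.
Proof.
move/eqP; rewrite /sqn paddr_eq0 ?sqr_ge0 // !sqrf_eq0 => /andP[/eqP a /eqP b].
by apply/eqP; rewrite eq_complex /= a b !eqxx.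
Qed.

Lemma sqn_conj z : sqn z^*%R = sqn z.
Proof. by case: z => a b; rewrite /sqn /= sqrrN. Qed.

Lemma conjM z w : (z * w)^*%R = z^*%R * w^*%R.
Proof. exact: (rmorphM Num.conj). Qed.

Lemma conj_realC (a : R) : (a%:C)^*%R = a%:C.
Proof. by apply/eqP; rewrite eq_complex /= oppr0 !eqxx. Qed.

Lemma conjKC z : (z^*%R)^*%R = z.
Proof. by apply/eqP; case: z => a b; rewrite eq_complex /= opprK !eqxx. Qed.

Lemma expi0 : expi (0 : R) = 1.
Proof. by rewrite /expi cos0 sin0. Qed.

Lemma expiN (t : R) : expi (- t) = (expi t)^*%R.
Proof. by rewrite /expi cosN sinN. Qed.

End ell1_norm.

Section measurable_complex.
Context d (T : measurableType d) {R : realType}.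
Implicit Types f g : T -> R[i].

Lemma mC_eq f g : f =1 g -> measurableC f -> measurableC g.
Proof. by move=> /funext ->. Qed.

Lemma mC_cst c : measurableC (fun _ : T => c : R[i]).
Proof. by split; exact: measurable_cst. Qed.

Lemma mCD f g : measurableC f -> measurableC g -> measurableC (fun x => f x + g x).
Proof.
move=> [f1 f2] [g1 g2]; split.
  by under eq_fun do rewrite raddfD; exact: measurable_funD.
by under eq_fun do rewrite raddfD; exact: measurable_funD.
Qed.

Lemma mCN f : measurableC f -> measurableC (fun x => - f x).
Proof.
move=> [f1 f2]; split.
  under eq_fun do rewrite raddfN; exact: measurableT_comp.
under eq_fun do rewrite raddfN; exact: measurableT_comp.
Qed.

Lemma mCB f g : measurableC f -> measurableC g -> measurableC (fun x => f x - g x).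
Proof. by move=> ? ?; apply: mCD => //; exact: mCN. Qed.

Lemma mCM f g : measurableC f -> measurableC g -> measurableC (fun x => f x * g x).
Proof.
move=> [f1 f2] [g1 g2]; split.
  rewrite (_ : (fun x => _) = fun x => complex.Re (f x) * complex.Re (g x)
     - complex.Im (f x) * complex.Im (g x)); last first.
    by apply/funext => x; case: (f x) => a b; case: (g x).
  by apply: measurable_funB; exact: measurable_funM.
rewrite (_ : (fun x => _) = fun x => complex.Re (f x) * complex.Im (g x)
   + complex.Im (f x) * complex.Re (g x)); last first.
  by apply/funext => x; case: (f x) => a b; case: (g x).
by apply: measurable_funD; exact: measurable_funM.
Qed.

Lemma mC_conj f : measurableC f -> measurableC (fun x => (f x)^*%R).
Proof.
move=> [f1 f2]; split.
  by rewrite (_ : (fun x => _) = fun x => complex.Re (f x)) //;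
     apply/funext => x; case: (f x).
rewrite (_ : (fun x => _) = fun x => - complex.Im (f x)); last first.
  by apply/funext => x; case: (f x).
exact: measurableT_comp.
Qed.

Lemma mC_sum I (s : seq I) (F : I -> T -> R[i]) :
  (forall i, measurableC (F i)) -> measurableC (fun x => \sum_(i <- s) F i x).
Proof.
move=> mF; elim: s => [|i s IH].
  by under [X in measurableC X]eq_fun do rewrite big_nil; exact: mC_cst.
by under [X in measurableC X]eq_fun do rewrite big_cons; exact: mCD.
Qed.

Lemma mC_real (h : T -> R) : measurable_fun setT h -> measurableC (fun x => (h x)%:C).
Proof. by move=> mh; split => //=; exact: measurable_cst. Qed.

Lemma mC_expi (h : T -> R) : measurable_fun setT h -> measurableC (fun x => expi (h x)).
Proof.
move=> mh; split => /=.
  apply: (@measurableT_comp _ _ _ _ _ _ (@cos R)) => //.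
  by apply: continuous_measurable_fun; exact: continuous_cos.
apply: (@measurableT_comp _ _ _ _ _ _ (@sin R)) => //.
by apply: continuous_measurable_fun; exact: continuous_sin.
Qed.

Lemma measurable_n1 f : measurableC f -> measurable_fun setT (fun x => n1 (f x)).
Proof.
by move=> [f1 f2]; apply: measurable_funD; exact: measurableT_comp.
Qed.

Lemma measurable_sqn f : measurableC f -> measurable_fun setT (fun x => sqn (f x)).
Proof.
by move=> [f1 f2]; apply: measurable_funD; exact: measurable_funX.
Qed.

Lemma measurable_neq0 f : measurableC f -> measurable [set x | f x <> 0].
Proof.
move=> mf; rewrite (_ : [set x | _] = (fun x => n1 (f x)) @^-1` (~` [set 0])).
  rewrite -[X in measurable X]setTI; apply: measurable_n1 => //.
  apply: measurable_structure.measurableC. exact: measurable_set1.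
apply/seteqP; split => x /= h; first by move=> /n1_eq0.
by move=> fx; apply: h; rewrite fx n1_0.
Qed.

End measurable_complex.

Lemma mC_comp d d' (S : measurableType d') (T : measurableType d) {R : realType}
  (f : T -> R[i]) (h : S -> T) : measurableC f -> measurable_fun setT h ->
  measurableC (fun x => f (h x)).
Proof.
move=> [f1 f2] mh; split.
  exact: (measurableT_comp f1 mh).
exact: (measurableT_comp f2 mh).
Qed.

Section integrable_complex.
Context d (T : measurableType d) {R : realType}.
Variable mu : {measure set T -> \bar R}.
Implicit Types f g : T -> R[i].

Lemma iC_mC f : integrableC mu f -> measurableC f.
Proof.
move=> [f1 f2]; split.
  by apply/measurable_EFinP; exact: measurable_int f1.
by apply/measurable_EFinP; exact: measurable_int f2.
Qed.

Lemma iC_le f (g : T -> R) : measurableC f ->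
  mu.-integrable setT (fun x => (g x)%:E) -> (forall x, n1 (f x) <= g x) ->
  integrableC mu f.
Proof.
move=> [f1 f2] ig fg; split.
  apply: le_integrable ig => //; first exact/measurable_EFinP.
  move=> x _ /=; rewrite lee_fin; apply: le_trans (le_trans (fg x) (ler_norm _)).
  by rewrite /n1 lerDl.
apply: le_integrable ig => //; first exact/measurable_EFinP.
move=> x _ /=; rewrite lee_fin; apply: le_trans (le_trans (fg x) (ler_norm _)).
by rewrite /n1 lerDr.
Qed.

Lemma iC_n1 f : integrableC mu f -> mu.-integrable setT (fun x => (n1 (f x))%:E).
Proof.
move=> [f1 f2]; rewrite /n1; under eq_fun do rewrite EFinD.
by apply: integrableD => //; exact: integrable_norm.
Qed.

Lemma iCP f : measurableC f ->
  integrableC mu f <-> (\int[mu]_x (n1 (f x))%:E < +oo)%E.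
Proof.
move=> mf; split=> [/iC_n1/integrableP[_]|foo].
  by under eq_integral do rewrite gee0_abs ?lee_fin ?n1_ge0 //.
apply: (@iC_le f (n1 \o f)) => //; apply/integrableP; split.
  by apply/measurable_EFinP; exact: measurable_n1.
by under eq_integral do rewrite gee0_abs ?lee_fin ?n1_ge0 //.
Qed.

Lemma iC_eq f g : f =1 g -> integrableC mu f -> integrableC mu g.
Proof. by move=> /funext ->. Qed.

Lemma iC0 : integrableC mu (fun _ => 0).
Proof. by split; exact: integrable0. Qed.

Lemma iC_real (h : T -> R) : mu.-integrable setT (fun x => (h x)%:E) ->
  integrableC mu (fun x => (h x)%:C).
Proof. by move=> ih; split => //=; exact: integrable0. Qed.

Lemma integrable_indic_fin (A : set T) : measurable A -> (mu A < +oo)%E ->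
  mu.-integrable setT (fun x => (\1_A x : R)%:E).
Proof.
move=> mA Aoo; apply/integrableP; split; first exact/measurable_EFinP/measurable_indic.
rewrite (eq_integral (fun x => (\1_A x)%:E)) ?integral_indic ?setIT // => t _.
by rewrite gee0_abs // lee_fin.
Qed.

Lemma iC_indic (A : set T) : measurable A -> (mu A < +oo)%E ->
  integrableC mu (fun x => (\1_A x : R)%:C).
Proof. by move=> ? ?; apply: iC_real; exact: integrable_indic_fin. Qed.

Lemma iCM f g M : integrableC mu f -> measurableC g -> (forall x, n1 (g x) <= M) ->
  integrableC mu (fun x => f x * g x).
Proof.
move=> If mg gM; apply: (@iC_le _ (fun x => M * n1 (f x))).
- exact: mCM (iC_mC If) mg.
- under eq_fun do rewrite EFinM; apply: integrableZl => //; exact: iC_n1.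
- move=> x; rewrite (le_trans (n1M _ _)) // mulrC; apply: ler_wpM2r => //.
  exact: n1_ge0.
Qed.

Lemma iCMl f g M : integrableC mu f -> measurableC g -> (forall x, n1 (g x) <= M) ->
  integrableC mu (fun x => g x * f x).
Proof.
by move=> ? ? gM; under eq_fun do rewrite mulrC; exact: (iCM _ _ gM).
Qed.

Lemma iCD f g : integrableC mu f -> integrableC mu g ->
  integrableC mu (fun x => f x + g x).
Proof.
move=> If Ig; apply: (@iC_le _ (fun x => n1 (f x) + n1 (g x))).
- exact: mCD (iC_mC If) (iC_mC Ig).
- by under eq_fun do rewrite EFinD; apply: integrableD => //; exact: iC_n1.
- by move=> x; exact: n1D.
Qed.

Lemma iCZ c f : integrableC mu f -> integrableC mu (fun x => c * f x).
Proof. by move=> If; apply: (@iCMl _ _ (n1 c)) => //; exact: mC_cst. Qed.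

Lemma iCN f : integrableC mu f -> integrableC mu (fun x => - f x).
Proof. by move=> /(iCZ (-1)); apply: iC_eq => x; rewrite mulN1r. Qed.

Lemma iCB f g : integrableC mu f -> integrableC mu g ->
  integrableC mu (fun x => f x - g x).
Proof. by move=> ? ?; apply: iCD => //; exact: iCN. Qed.

Lemma iC_conj f : integrableC mu f -> integrableC mu (fun x => (f x)^*%R).
Proof.
move=> If; apply: (@iC_le _ (fun x => n1 (f x))).
- exact: mC_conj (iC_mC If).
- exact: iC_n1.
- by move=> x; rewrite n1_conj.
Qed.

Lemma iC_sum I (s : seq I) (F : I -> T -> R[i]) :
  (forall i, integrableC mu (F i)) -> integrableC mu (fun x => \sum_(i <- s) F i x).
Proof.
move=> mF; elim: s => [|i s IH].
  by under [X in integrableC _ X]eq_fun do rewrite big_nil; exact: iC0.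
by under [X in integrableC _ X]eq_fun do rewrite big_cons; exact: iCD.
Qed.

Lemma iC_ae f g : measurableC g -> {ae mu, forall x, f x = g x} ->
  integrableC mu f -> integrableC mu g.
Proof.
move=> mg fg If; apply/(iCP mg).
have := (iCP (iC_mC If)).1 If; apply: le_lt_trans.
rewrite le_eqVlt; apply/orP; left; apply/eqP; apply: ge0_ae_eq_integral => //.
- by apply/measurable_EFinP; exact: measurable_n1.
- by apply/measurable_EFinP; apply: measurable_n1; exact: iC_mC If.
- by move=> x _; rewrite lee_fin n1_ge0.
- by move=> x _; rewrite lee_fin n1_ge0.
- by apply: filterS fg => x /= ->.
Qed.

Lemma int_eq f g : f =1 g -> integralC mu f = integralC mu g.
Proof. by move=> /funext ->. Qed.

Lemma int0 : integralC mu (fun _ => 0) = 0.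
Proof.
rewrite /integralC /=.
have -> : \int[mu]_x (0 : R) = 0 by rewrite /Rintegral integral0.
by [].
Qed.

Lemma intD f g : integrableC mu f -> integrableC mu g ->
  integralC mu (fun x => f x + g x) = integralC mu f + integralC mu g.
Proof.
move=> [f1 f2] [g1 g2]; rewrite /integralC.
apply/eqP; rewrite eq_complex /=; apply/andP; split; apply/eqP.
  by under eq_Rintegral do rewrite raddfD; rewrite RintegralD.
by under eq_Rintegral do rewrite raddfD; rewrite RintegralD.
Qed.

Lemma intZ c f : integrableC mu f -> integralC mu (fun x => c * f x) = c * integralC mu f.
Proof.
case: c => a b [f1 f2]; rewrite /integralC.
have Z (r : R) (h : T -> R) : mu.-integrable setT (fun x => (h x)%:E) ->
   mu.-integrable setT (fun x => (r * h x)%:E).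
  by move=> ih; under eq_fun do rewrite EFinM; exact: integrableZl.
apply/eqP; rewrite eq_complex /=; apply/andP; split; apply/eqP.
  under eq_Rintegral => x _.
    rewrite (_ : complex.Re _ = a * complex.Re (f x) - b * complex.Im (f x)); last by case: (f x).
    over.
  by rewrite RintegralB ?RintegralZl //; exact: Z.
under eq_Rintegral => x _.
  rewrite (_ : complex.Im _ = a * complex.Im (f x) + b * complex.Re (f x)); last by case: (f x).
  over.
by rewrite RintegralD ?RintegralZl //; exact: Z.
Qed.

Lemma intZr c f : integrableC mu f -> integralC mu (fun x => f x * c) = integralC mu f * c.
Proof. by move=> If; rewrite mulrC -intZ //; apply: int_eq => x; rewrite mulrC. Qed.

Lemma intN f : integrableC mu f -> integralC mu (fun x => - f x) = - integralC mu f.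
Proof.
by move=> If; rewrite -mulN1r -intZ //; apply: int_eq => x; rewrite mulN1r.
Qed.

Lemma intB f g : integrableC mu f -> integrableC mu g ->
  integralC mu (fun x => f x - g x) = integralC mu f - integralC mu g.
Proof. by move=> If Ig; rewrite intD ?intN //; exact: iCN. Qed.

Lemma int_sum I (s : seq I) (F : I -> T -> R[i]) :
  (forall i, integrableC mu (F i)) ->
  integralC mu (fun x => \sum_(i <- s) F i x) = \sum_(i <- s) integralC mu (F i).
Proof.
move=> IF; elim: s => [|i s IH].
  by rewrite big_nil -[RHS]int0; apply: int_eq => x; rewrite big_nil.
rewrite big_cons -IH -intD //; last exact: iC_sum.
by apply: int_eq => x; rewrite big_cons.
Qed.

Lemma int_conj f : integrableC mu f -> integralC mu (fun x => (f x)^*%R) = (integralC mu f)^*%R.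
Proof.
move=> [f1 f2]; rewrite /integralC; apply/eqP; rewrite eq_complex /=.
apply/andP; split; apply/eqP; first by apply: eq_Rintegral => x _; case: (f x).
rewrite -mulN1r -RintegralZl //; apply: eq_Rintegral => x _.
by rewrite mulN1r; case: (f x).
Qed.

Lemma int_real (h : T -> R) : integralC mu (fun x => (h x)%:C) = (\int[mu]_x h x)%:C.
Proof.
by rewrite /integralC /=; congr (_ +i* _); rewrite /Rintegral integral0.
Qed.

Lemma int_ae f g : measurableC f -> measurableC g ->
  {ae mu, forall x, f x = g x} -> integralC mu f = integralC mu g.
Proof.
move=> [f1 f2] [g1 g2] fg; rewrite /integralC /Rintegral.
congr ((fine _) +i* (fine _)); apply: ae_eq_integral => //.
- exact/measurable_EFinP.
- exact/measurable_EFinP.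
- by apply: filterS fg => x /= ->.
- exact/measurable_EFinP.
- exact/measurable_EFinP.
- by apply: filterS fg => x /= ->.
Qed.

Lemma n1_int f : integrableC mu f -> n1 (integralC mu f) <= \int[mu]_x n1 (f x).
Proof.
move=> [f1 f2]; rewrite /n1 /integralC /= RintegralD //; [|exact: integrable_norm..].
by apply: lerD; exact: le_normr_Rintegral.
Qed.

End integrable_complex.

Lemma Rint_sum d (T : measurableType d) {R : realType} (m : {measure set T -> \bar R})
    (I : Type) (s : seq I) (h : I -> T -> R) :
  (forall k, m.-integrable setT (fun x => (h k x)%:E)) ->
  m.-integrable setT (fun x => (\sum_(k <- s) h k x)%:E) /\
  \int[m]_x (\sum_(k <- s) h k x) = \sum_(k <- s) \int[m]_x h k x.
Proof.
move=> ih; elim: s => [|k s [IH1 IH2]].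
  rewrite !big_nil; split.
    by under [X in integrable _ _ X]eq_fun do rewrite big_nil; exact: integrable0.
  by rewrite (@eq_Rintegral _ _ _ _ _ (cst 0)) ?Rintegral_cst ?mul0r // => x _; rewrite big_nil.
have e : (fun x => \sum_(j <- k :: s) h j x) = (fun x => h k x + \sum_(j <- s) h j x).
  by apply/funext => x; rewrite big_cons.
rewrite big_cons -IH2; split.
  rewrite (_ : (fun x => _) = fun x => ((h k x)%:E + (\sum_(j <- s) h j x)%:E)%E).
    exact: (integrableD measurableT (ih k) IH1).
  by apply/funext => x; rewrite big_cons.
rewrite -RintegralD //; last exact: ih.
by congr (Rintegral _ _ _).
Qed.

Lemma Rint_eq0 d (T : measurableType d) {R : realType} (m : {measure set T -> \bar R})
    (h : T -> R) : (forall x, 0 <= h x) -> m.-integrable setT (fun x => (h x)%:E) ->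
  \int[m]_x h x = 0 -> {ae m, forall x, h x = 0}.
Proof.
move=> h0 ih h00; have mh := measurable_int _ ih.
have /(ae_eq_integral_abs m measurableT mh).1 : (\int[m]_x `|(h x)%:E| = 0)%E.
  under eq_integral do rewrite abse_EFin ger0_norm //.
  by rewrite -(fineK (integrable_fin_num measurableT ih)); congr (_%:E).
by apply: filterS => x /(_ Logic.I) /= [].
Qed.

(** * Product measures and measure-preserving maps *)

Section parametric.
Context d1 d2 (T1 : measurableType d1) (T2 : measurableType d2) {R : realType}.
Variable m1 : {sigma_finite_measure set T1 -> \bar R}.
Variable m2 : {sigma_finite_measure set T2 -> \bar R}.

(** The sections of the positive and negative parts have measurable integrals by
    Tonelli, also where these are infinite. *)
Lemma measurable_Rint1 (h : T1 * T2 -> R) : measurable_fun setT h ->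
  measurable_fun setT (fun x => \int[m2]_y h (x, y)).
Proof.
move=> mh; have mh' : measurable_fun setT (EFin \o h) by exact/measurable_EFinP.
rewrite /Rintegral; apply: measurableT_comp => //.
rewrite (_ : (fun x => _) = fubini_F m2 (EFin \o h)^\+%E \- fubini_F m2 (EFin \o h)^\-%E)%E.
  apply: emeasurable_funB; apply: measurable_fun_fubini_tonelli_F => //.
    exact: measurable_funepos.
  exact: measurable_funeneg.
apply/funext => x; rewrite integralE /fubini_F; congr (_ - _)%E.
  by apply: eq_integral => y _; rewrite !funeposE.
by apply: eq_integral => y _; rewrite !funenegE.
Qed.

Lemma measurable_Rint2 (h : T1 * T2 -> R) : measurable_fun setT h ->
  measurable_fun setT (fun y => \int[m1]_x h (x, y)).
Proof.
move=> mh; have mh' : measurable_fun setT (EFin \o h) by exact/measurable_EFinP.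
rewrite /Rintegral; apply: measurableT_comp => //.
rewrite (_ : (fun x => _) = fubini_G m1 (EFin \o h)^\+%E \- fubini_G m1 (EFin \o h)^\-%E)%E.
  apply: emeasurable_funB; apply: measurable_fun_fubini_tonelli_G => //.
    exact: measurable_funepos.
  exact: measurable_funeneg.
apply/funext => x; rewrite integralE /fubini_G; congr (_ - _)%E.
  by apply: eq_integral => y _; rewrite !funeposE.
by apply: eq_integral => y _; rewrite !funenegE.
Qed.

Lemma mC_int1 (f : T1 * T2 -> R[i]) : measurableC f ->
  measurableC (fun x => integralC m2 (fun y => f (x, y))).
Proof.
move=> [f1 f2]; split; rewrite /integralC /=.
  exact: (measurable_Rint1 f1).
exact: (measurable_Rint1 f2).
Qed.

Lemma mC_pair1 (f : T1 * T2 -> R[i]) x : measurableC f -> measurableC (fun y => f (x, y)).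
Proof. by move=> mf; apply: mC_comp => //; exact: measurable_pair1. Qed.

Lemma mC_pair2 (f : T1 * T2 -> R[i]) y : measurableC f -> measurableC (fun x => f (x, y)).
Proof. by move=> mf; apply: mC_comp => //; exact: measurable_pair2. Qed.

End parametric.

Section fubini_complex.
Context d1 d2 (T1 : measurableType d1) (T2 : measurableType d2) {R : realType}.
Variable m1 : {sigma_finite_measure set T1 -> \bar R}.
Variable m2 : {sigma_finite_measure set T2 -> \bar R}.
Local Notation mm := (m1 \x m2)%E.

Lemma ae_sections1 (P : T1 * T2 -> Prop) : {ae mm, forall z, P z} ->
  {ae m1, forall x, {ae m2, forall y, P (x, y)}}.
Proof.
move=> [N [mN N0 PN]].
have : (\int[m1]_x `|m2 (xsection N x)| = 0)%E.
  under eq_integral do rewrite gee0_abs //.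
  exact: N0.
move/(ae_eq_integral_abs _ measurableT (measurable_fun_xsection m2 mN)).1.
apply: filterS => x /(_ I) /= Nx0; exists (xsection N x); split => //.
  exact: measurable_xsection.
by move=> y /= Pxy; rewrite /xsection /= inE; apply: PN.
Qed.

(** A product measure is by definition the integral of the measures of the
    sections at fixed first coordinate; Tonelli exchanges the coordinates. *)
Lemma product_measure_ysection A : measurable A -> mm A = (\int[m2]_y m1 (ysection A y))%E.
Proof.
move=> mA; rewrite -[LHS]mul1e -integral_cst //=.
rewrite [LHS](_ : _ = \int[mm]_(z in A) (cst 1 z))%E; last by rewrite !integral_cst ?mul1e.
rewrite integral_mkcond.
have mI : measurable_fun setT (cst 1 \_ A : T1 * T2 -> \bar R)%E.
  by apply/(measurable_restrictT _ mA); exact: measurable_cst.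
rewrite fubini_tonelli2 //; last first.
  by move=> z; rewrite /restrict; case: ifP.
apply: eq_integral => y _.
rewrite -[RHS]mul1e -integral_cst; last exact: measurable_ysection.
rewrite [RHS]integral_mkcond; apply: eq_integral => x _.
by rewrite !patchE mem_ysection.
Qed.

Lemma ae_sections2 (P : T1 * T2 -> Prop) : {ae mm, forall z, P z} ->
  {ae m2, forall y, {ae m1, forall x, P (x, y)}}.
Proof.
move=> [N [mN N0 PN]].
have : (\int[m2]_y `|m1 (ysection N y)| = 0)%E.
  under eq_integral do rewrite gee0_abs //.
  by rewrite -product_measure_ysection.
move/(ae_eq_integral_abs _ measurableT (measurable_fun_ysection m1 mN)).1.
apply: filterS => y /(_ I) /= Nx0; exists (ysection N y); split => //.
  exact: measurable_ysection.
by move=> x /= Pxy; rewrite /ysection /= inE; apply: PN.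
Qed.

Lemma ae_prod1 (P : T1 * T2 -> Prop) : measurable [set z | ~ P z] ->
  {ae m1, forall x, {ae m2, forall y, P (x, y)}} -> {ae mm, forall z, P z}.
Proof.
move=> mN aeP; exists [set z | ~ P z]; split => //.
have : (\int[m1]_x `|m2 (xsection [set z | ~ P z] x)| = 0)%E.
  apply/(ae_eq_integral_abs m1 measurableT (measurable_fun_xsection m2 mN)).
  apply: filterS aeP => x Px _ /=; apply/negligibleP; first exact: measurable_xsection.
  by apply: negligibleS Px => y; rewrite /xsection /= inE.
by under eq_integral do rewrite gee0_abs //.
Qed.

Lemma ae_prod2 (P : T1 * T2 -> Prop) : measurable [set z | ~ P z] ->
  {ae m2, forall y, {ae m1, forall x, P (x, y)}} -> {ae mm, forall z, P z}.
Proof.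
move=> mN aeP; exists [set z | ~ P z]; split => //.
rewrite product_measure_ysection //.
have : (\int[m2]_y `|m1 (ysection [set z | ~ P z] y)| = 0)%E.
  apply/(ae_eq_integral_abs m2 measurableT (measurable_fun_ysection m1 mN)).
  apply: filterS aeP => x Px _ /=; apply/negligibleP; first exact: measurable_ysection.
  by apply: negligibleS Px => y; rewrite /ysection /= inE.
by under eq_integral do rewrite gee0_abs //.
Qed.

Lemma iC_tonelli1 (f : T1 * T2 -> R[i]) : measurableC f ->
  integrableC mm f <-> (\int[m1]_x \int[m2]_y (n1 (f (x, y)))%:E < +oo)%E.
Proof.
move=> mf; rewrite (iCP _ mf) fubini_tonelli1 //.
- by apply/measurable_EFinP; exact: measurable_n1.
- by move=> z; rewrite lee_fin n1_ge0.
Qed.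

Lemma ae_iC1 (f : T1 * T2 -> R[i]) : integrableC mm f ->
  {ae m1, forall x, integrableC m2 (fun y => f (x, y))}.
Proof.
by move=> [/ae_integrable1 h1 /ae_integrable1 h2]; apply: filterS2 h1 h2 => x; split.
Qed.

Lemma ae_iC2 (f : T1 * T2 -> R[i]) : integrableC mm f ->
  {ae m2, forall y, integrableC m1 (fun x => f (x, y))}.
Proof.
by move=> [/ae_integrable2 h1 /ae_integrable2 h2]; apply: filterS2 h1 h2 => x; split.
Qed.

(** The iterated integrals of an integrable function agree with the integral on
    the product although the inner integrals, real-valued here, take a default
    value on the null set of sections that are not integrable. *)
Let Rfub1 (h : T1 * T2 -> R) : mm.-integrable setT (EFin \o h) ->
  m1.-integrable setT (fun x => (\int[m2]_y h (x, y))%:E) /\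
  \int[m1]_x (\int[m2]_y h (x, y)) = \int[mm]_z h z.
Proof.
move=> ih; have i1 := integrable_fubini_F ih.
have ae : ae_eq m1 setT (fubini_F m2 (EFin \o h)) (fun x => (\int[m2]_y h (x, y))%:E).
  apply: filterS (integrable_ae measurableT i1) => x /(_ I) fin _.
  by rewrite /Rintegral fineK.
have mR : measurable_fun setT (fun x => (\int[m2]_y h (x, y))%:E).
  apply/measurable_EFinP; apply: measurable_Rint1.
  by apply/measurable_EFinP; exact: measurable_int ih.
have e : (\int[m1]_x (\int[m2]_y h (x, y))%:E = \int[mm]_z (h z)%:E)%E.
  rewrite -(integral12_prod_meas1 ih); apply/esym; apply: ae_eq_integral => //.
  exact: measurable_int i1.
split; last by rewrite {1}/Rintegral e.
apply/integrableP; split => //.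
have /integrableP[_] := i1; apply: le_lt_trans; rewrite le_eqVlt.
apply/orP; left; apply/eqP; apply: ge0_ae_eq_integral => //.
- exact: measurableT_comp.
- by apply: measurableT_comp => //; exact: measurable_int i1.
- by apply: filterS ae => x /(_ I) -> .
Qed.

Let Rfub2 (h : T1 * T2 -> R) : mm.-integrable setT (EFin \o h) ->
  m2.-integrable setT (fun y => (\int[m1]_x h (x, y))%:E) /\
  \int[m2]_y (\int[m1]_x h (x, y)) = \int[mm]_z h z.
Proof.
move=> ih.
have i2 : m2.-integrable setT (fubini_G m1 (EFin \o h)).
  apply/integrableP; split; first exact: measurable_fubini_G ih.
  apply: le_lt_trans ((integrable21ltyP m1 m2 (measurable_int _ ih)).1 ih).
  apply: ge0_le_integral => //.
  - apply: measurableT_comp => //; exact: measurable_fubini_G ih.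
  - apply: (@measurable_fun_fubini_tonelli_G _ _ _ _ _ m1 (abse \o (EFin \o h))%E) => //.
      by apply: measurableT_comp => //; exact: measurable_int ih.
    by move=> z; exact: abse_ge0.
  - move=> y _; apply: le_abse_integral => //.
    apply: (measurableT_comp (measurable_int _ ih)); exact: measurable_pair2.
have ae : ae_eq m2 setT (fubini_G m1 (EFin \o h)) (fun y => (\int[m1]_x h (x, y))%:E).
  apply: filterS (integrable_ae measurableT i2) => x /(_ I) fin _.
  by rewrite /Rintegral fineK.
have mR : measurable_fun setT (fun y => (\int[m1]_x h (x, y))%:E).
  apply/measurable_EFinP; apply: measurable_Rint2.
  by apply/measurable_EFinP; exact: measurable_int ih.
have e : (\int[m2]_y (\int[m1]_x h (x, y))%:E = \int[mm]_z (h z)%:E)%E.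
  rewrite -(integral21_prod_meas1 ih); apply/esym; apply: ae_eq_integral => //.
  exact: measurable_int i2.
split; last by rewrite {1}/Rintegral e.
apply/integrableP; split => //.
have /integrableP[_] := i2; apply: le_lt_trans; rewrite le_eqVlt.
apply/orP; left; apply/eqP; apply: ge0_ae_eq_integral => //.
- exact: measurableT_comp.
- by apply: measurableT_comp => //; exact: measurable_int i2.
- by apply: filterS ae => x /(_ I) -> .
Qed.

Lemma iC_int1 (f : T1 * T2 -> R[i]) : integrableC mm f ->
  integrableC m1 (fun x => integralC m2 (fun y => f (x, y))).
Proof. by move=> [/Rfub1[h1 _] /Rfub1[h2 _]]; split. Qed.

Lemma iC_int2 (f : T1 * T2 -> R[i]) : integrableC mm f ->
  integrableC m2 (fun y => integralC m1 (fun x => f (x, y))).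
Proof. by move=> [/Rfub2[h1 _] /Rfub2[h2 _]]; split. Qed.

Lemma fubiniC1 (f : T1 * T2 -> R[i]) : integrableC mm f ->
  integralC mm f = integralC m1 (fun x => integralC m2 (fun y => f (x, y))).
Proof. by move=> [/Rfub1[_ h1] /Rfub1[_ h2]]; rewrite /integralC /= -h1 -h2. Qed.

Lemma fubiniC2 (f : T1 * T2 -> R[i]) : integrableC mm f ->
  integralC mm f = integralC m2 (fun y => integralC m1 (fun x => f (x, y))).
Proof. by move=> [/Rfub2[_ h1] /Rfub2[_ h2]]; rewrite /integralC /= -h1 -h2. Qed.

Lemma fubiniC (f : T1 * T2 -> R[i]) : integrableC mm f ->
  integralC m1 (fun x => integralC m2 (fun y => f (x, y))) =
  integralC m2 (fun y => integralC m1 (fun x => f (x, y))).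
Proof. by move=> h; rewrite -fubiniC1 // -fubiniC2. Qed.

Lemma iC_tensor (f : T1 -> R[i]) (g : T2 -> R[i]) : integrableC m1 f -> integrableC m2 g ->
  integrableC mm (fun z => f z.1 * g z.2).
Proof.
move=> If Ig.
have mfg : measurableC (fun z : T1 * T2 => f z.1 * g z.2).
  by apply: mCM; [apply: mC_comp (iC_mC If) _|apply: mC_comp (iC_mC Ig) _].
apply/(iC_tonelli1 mfg) => /=.
have f1 := (iCP m1 (iC_mC If)).1 If; have g1 := (iCP m2 (iC_mC Ig)).1 Ig.
have mg : measurable_fun setT (fun y => (n1 (g y))%:E).
  by apply/measurable_EFinP; apply: measurable_n1; exact: iC_mC Ig.
have mf : measurable_fun setT (fun y => (n1 (f y))%:E).
  by apply/measurable_EFinP; apply: measurable_n1; exact: iC_mC If.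
apply: (@le_lt_trans _ _ (\int[m1]_x ((n1 (f x))%:E * \int[m2]_y (n1 (g y))%:E)))%E; last first.
  rewrite ge0_integralZr //; last 2 first.
  - by move=> x _; rewrite lee_fin n1_ge0.
  - by apply: integral_ge0 => y _; rewrite lee_fin n1_ge0.
  apply: lte_mul_pinfty.
  - by apply: integral_ge0 => y _; rewrite lee_fin n1_ge0.
  - by rewrite ge0_fin_numE //; apply: integral_ge0 => y _; rewrite lee_fin n1_ge0.
  - by [].
apply: ge0_le_integral => //.
- by move=> x _; apply: integral_ge0 => y _; rewrite lee_fin n1_ge0.
- apply: (@measurable_fun_fubini_tonelli_F _ _ _ _ _ m2 (fun z => (n1 (f z.1 * g z.2))%:E)) => //.
    by apply/measurable_EFinP; exact: measurable_n1.
  by move=> z; rewrite lee_fin n1_ge0.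
- by apply: emeasurable_funM => //; exact: measurable_cst.
- move=> x _; rewrite -ge0_integralZl //; last 2 first.
  - by move=> y _; rewrite lee_fin n1_ge0.
  - by rewrite lee_fin n1_ge0.
  apply: ge0_le_integral => //.
  - by move=> y _; rewrite lee_fin n1_ge0.
  - apply/measurable_EFinP; apply: measurable_n1.
    exact: (mC_pair1 x mfg).
  - by apply: emeasurable_funM => //; exact: measurable_cst.
  - by move=> y _; rewrite lee_fin n1M.
Qed.

Lemma int_tensor (f : T1 -> R[i]) (g : T2 -> R[i]) : integrableC m1 f -> integrableC m2 g ->
  integralC mm (fun z => f z.1 * g z.2) = integralC m1 f * integralC m2 g.
Proof.
move=> If Ig; rewrite fubiniC1 /=; last exact: iC_tensor.
rewrite -intZr //; apply: int_eq => x; exact: intZ.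
Qed.

End fubini_complex.

Section measure_preserving.
Context d1 d2 (T1 : measurableType d1) (T2 : measurableType d2) {R : realType}.
Variable m1 : {measure set T1 -> \bar R}.
Variable m2 : {measure set T2 -> \bar R}.

Definition mpres (phi : T1 -> T2) := measurable_fun setT phi /\
  forall A, measurable A -> m1 (phi @^-1` A) = m2 A.

Variable phi : T1 -> T2.
Hypothesis mp : mpres phi.
Let mphi := mp.1.

Lemma mp_ge0 (h : T2 -> \bar R) : measurable_fun setT h -> (forall x, 0 <= h x)%E ->
  (\int[m2]_x h x = \int[m1]_x h (phi x))%E.
Proof.
move=> mh h0; rewrite (eq_measure_integral (pushforward m1 phi)); last first.
  by move=> A mA _; rewrite -(mp.2 _ mA).
by rewrite ge0_integral_pushforward //.
Qed.

Lemma mp_integral (h : T2 -> \bar R) : measurable_fun setT h ->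
  (\int[m2]_x h x = \int[m1]_x h (phi x))%E.
Proof.
move=> mh; rewrite integralE [RHS]integralE; congr (_ - _)%E.
  rewrite (mp_ge0 (measurable_funepos mh)) //.
  by apply: eq_integral => x _; rewrite !funeposE.
rewrite (mp_ge0 (measurable_funeneg mh)) //.
by apply: eq_integral => x _; rewrite !funenegE.
Qed.

Lemma mp_int (f : T2 -> R[i]) : measurableC f ->
  integralC m2 f = integralC m1 (fun x => f (phi x)).
Proof.
by move=> [f1 f2]; rewrite /integralC /Rintegral;
  congr (fine _ +i* fine _); rewrite mp_integral //; exact/measurable_EFinP.
Qed.

Lemma mp_iC (f : T2 -> R[i]) : integrableC m2 f -> integrableC m1 (fun x => f (phi x)).
Proof.
move=> If; have mf := iC_mC If; apply/(iCP _ (mC_comp mf mphi)).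
rewrite -(mp_integral (h := fun x => (n1 (f x))%:E)); first exact/iCP.
by apply/measurable_EFinP; exact: measurable_n1.
Qed.

Lemma mp_ae (P : T2 -> Prop) : {ae m2, forall x, P x} -> {ae m1, forall x, P (phi x)}.
Proof.
move=> [N [mN N0 PN]]; exists (phi @^-1` N); split.
- by rewrite -[X in measurable X]setTI; exact: mphi.
- by rewrite mp.2.
- by move=> x /= h; exact: PN.
Qed.

End measure_preserving.

Definition cvgC {R : realType} (u : nat -> R[i]) (l : R[i]) :=
  ((fun n => complex.Re (u n)) @ \oo --> complex.Re l) /\
  ((fun n => complex.Im (u n)) @ \oo --> complex.Im l).

Section cvg_complex.
Context {R : realType}.
Implicit Types (u v : nat -> R[i]) (l m : R[i]).

Lemma cvgC_unique u l m : cvgC u l -> cvgC u m -> l = m.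
Proof.
move=> [u1 u2] [v1 v2]; apply/eqP; rewrite eq_complex; apply/andP; split; apply/eqP.
  exact: cvg_unique u1 v1.
exact: cvg_unique u2 v2.
Qed.

Lemma cvgC_cst l : cvgC (fun _ => l) l.
Proof. by split; exact: cvg_cst. Qed.

Lemma cvgC_mul u v l m : cvgC u l -> cvgC v m -> cvgC (fun n => u n * v n) (l * m).
Proof.
move=> [u1 u2] [v1 v2]; split.
  rewrite (_ : (fun n => _) = (fun n => complex.Re (u n) * complex.Re (v n)
     - complex.Im (u n) * complex.Im (v n))); last first.
    by apply/funext => n; case: (u n); case: (v n).
  rewrite (_ : complex.Re (l * m) = complex.Re l * complex.Re m - complex.Im l * complex.Im m);
    last by case: l {u1 u2}; case: m {v1 v2}.
  by apply: cvgB; apply: cvgM.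
rewrite (_ : (fun n => _) = (fun n => complex.Re (u n) * complex.Im (v n)
   + complex.Im (u n) * complex.Re (v n))); last first.
  by apply/funext => n; case: (u n); case: (v n).
rewrite (_ : complex.Im (l * m) = complex.Re l * complex.Im m + complex.Im l * complex.Re m);
  last by case: l {u1 u2}; case: m {v1 v2}.
by apply: cvgD; apply: cvgM.
Qed.

Lemma cvgC_real (u : nat -> R) (l : R) : u @ \oo --> l -> cvgC (fun n => (u n)%:C) l%:C.
Proof. by move=> ul; split => //=; exact: cvg_cst. Qed.

Lemma cvgC_expi (u : nat -> R) (l : R) : u @ \oo --> l -> cvgC (fun n => expi (u n)) (expi l).
Proof.
move=> ul; split => /=.
  by apply: (@cvg_comp _ _ _ u (@cos R) _ _ _ ul); exact: continuous_cos.
by apply: (@cvg_comp _ _ _ u (@sin R) _ _ _ ul); exact: continuous_sin.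
Qed.

Lemma dctC d (T : measurableType d) (mu : {measure set T -> \bar R})
  (f_ : nat -> T -> R[i]) (f : T -> R[i]) (g : T -> R) :
  (forall n, measurableC (f_ n)) -> measurableC f ->
  {ae mu, forall x, cvgC (f_ ^~ x) (f x)} ->
  mu.-integrable setT (EFin \o g) -> (forall n x, n1 (f_ n x) <= g x) ->
  cvgC (fun n => integralC mu (f_ n)) (integralC mu f).
Proof.
move=> mf_ mf cvf ig fg.
have main (h_ : nat -> T -> R) (h : T -> R) : (forall n, measurable_fun setT (h_ n)) ->
  measurable_fun setT h -> {ae mu, forall x, h_ ^~ x @ \oo --> h x} ->
  (forall n x, `|h_ n x| <= g x) ->
  (fun n => \int[mu]_x h_ n x) @ \oo --> \int[mu]_x h x.
  move=> mh_ mh hh hg.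
  have [|||||ih _ cvi] := @dominated_convergence _ _ _ mu setT measurableT
     (fun n x => (h_ n x)%:E) (EFin \o h) (EFin \o g).
  - by move=> n; exact/measurable_EFinP.
  - exact/measurable_EFinP.
  - by apply: filterS hh => x hx _; apply: cvg_EFin => //; exact: nearW.
  - by [].
  - by apply: aeW => x n _; rewrite lee_fin.
  apply: fine_cvg; rewrite fineK //.
  exact: integrable_fin_num.
split; rewrite /integralC /=; apply: main.
- by move=> n; case: (mf_ n).
- by case: mf.
- by apply: filterS cvf => x [].
- by move=> n x; apply: le_trans (fg n x); rewrite /n1 lerDl.
- by move=> n; case: (mf_ n).
- by case: mf.
- by apply: filterS cvf => x [].
- by move=> n x; apply: le_trans (fg n x); rewrite /n1 lerDr.
Qed.

End cvg_complex.

(** * Lebesgue measure on row vectors *)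

Section mpres_theory.
Context d1 d2 d3 (T1 : measurableType d1) (T2 : measurableType d2)
  (T3 : measurableType d3) {R : realType}.

Lemma mpres_comp (m1 : {measure set T1 -> \bar R}) (m2 : {measure set T2 -> \bar R})
  (m3 : {measure set T3 -> \bar R}) (phi : T1 -> T2) (psi : T2 -> T3) :
  mpres m1 m2 phi -> mpres m2 m3 psi -> mpres m1 m3 (psi \o phi).
Proof.
move=> [mphi ephi] [mpsi epsi]; split; first exact: measurableT_comp.
move=> A mA; rewrite comp_preimage ephi ?epsi //.
by rewrite -[X in measurable X]setTI; exact: mpsi.
Qed.

End mpres_theory.

Section mpres_product.
Context d1 d2 (T1 : measurableType d1) (T2 : measurableType d2) {R : realType}.
Variable m1 : {sigma_finite_measure set T1 -> \bar R}.
Variable m2 : {sigma_finite_measure set T2 -> \bar R}.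
Local Notation mm := (m1 \x m2)%E.

Lemma mpres_fiber2 (phi : T1 -> T2 -> T2) :
  measurable_fun setT (fun z : T1 * T2 => phi z.1 z.2) ->
  (forall x, mpres m2 m2 (phi x)) -> mpres mm mm (fun z => (z.1, phi z.1 z.2)).
Proof.
move=> mphi mp.
have mpsi : measurable_fun setT (fun z : T1 * T2 => (z.1, phi z.1 z.2)).
  exact: measurable_fun_pair.
split => // A mA; apply: eq_integral => x _ /=.
rewrite -((mp x).2 (xsection A x)); last exact: measurable_xsection.
congr (m2 _); apply/seteqP; split => y; rewrite /xsection /= !inE //.
Qed.

Lemma mpres_fiber1 (phi : T2 -> T1 -> T1) :
  measurable_fun setT (fun z : T1 * T2 => phi z.2 z.1) ->
  (forall y, mpres m1 m1 (phi y)) -> mpres mm mm (fun z => (phi z.2 z.1, z.2)).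
Proof.
move=> mphi mp.
have mpsi : measurable_fun setT (fun z : T1 * T2 => (phi z.2 z.1, z.2)).
  exact: measurable_fun_pair.
split => // A mA.
have mA' : measurable ((fun z : T1 * T2 => (phi z.2 z.1, z.2)) @^-1` A).
  by rewrite -[X in measurable X]setTI; exact: mpsi.
rewrite [LHS](product_measure_ysection m1 m2 mA') [RHS](product_measure_ysection m1 m2 mA).
apply: eq_integral => y _ /=.
rewrite -((mp y).2 (ysection A y)); last exact: measurable_ysection.
congr (m1 _); apply/seteqP; split => x; rewrite /ysection /= !inE //.
Qed.

Lemma mpres_prod (phi : T1 -> T1) (psi : T2 -> T2) :
  mpres m1 m1 phi -> mpres m2 m2 psi -> mpres mm mm (fun z => (phi z.1, psi z.2)).
Proof.
move=> mp1 mp2.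
have h1 : mpres mm mm (fun z => (phi z.1, z.2)).
  by apply: (mpres_fiber1 (phi := fun _ => phi)) => //; exact: measurableT_comp mp1.1 _.
have h2 : mpres mm mm (fun z => (z.1, psi z.2)).
  by apply: (mpres_fiber2 (phi := fun _ => psi)) => //; exact: measurableT_comp mp2.1 _.
exact: (mpres_comp h1 h2).
Qed.

End mpres_product.

Section lebesgue_rV_theory.
Context {R : realType}.
Local Notation leb := (@lebesgue_measure R).

Lemma mpres_shiftR (a : R) : mpres leb leb (fun x => x + a).
Proof.
have mshift : measurable_fun [set: R] (fun x => x + a).
  by apply: measurable_funD => //; exact: measurable_cst.
split => // A mA; apply/esym.
transitivity (pushforward leb (fun x : measurableTypeR R => x + a : measurableTypeR R) A) => //.
apply: lebesgue_measure_unique => //= _ [[b c]] _ <-.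
rewrite /pushforward (_ : _ @^-1` _ = `]b - a, c - a]%classic); last first.
  apply/seteqP; split => x /=; rewrite !in_itv /= => /andP[h1 h2]; apply/andP; split; lra.
rewrite !lebesgue_measure_itv /= !lte_fin ltrBDr subrK.
by case: ifP => // _; congr (_%:E); ring.
Qed.

Lemma mpres_oppR : mpres leb leb (fun x => - x).
Proof.
split; first by apply: measurable_funN.
by move=> A mA; exact: lebesgue_measureN.
Qed.

Lemma mpres_cons n : mpres (leb \x lebesgue_rV R n)%E (lebesgue_rV R n.+1) (@rV_cons R n).
Proof. by split => //; exact: measurable_rV_cons. Qed.

Lemma mpres_uncons n : mpres (lebesgue_rV R n.+1) (leb \x lebesgue_rV R n)%E (@rV_uncons R n).
Proof.
split; first exact: measurable_rV_uncons.
move=> A mA; rewrite -(mpres_cons n).2; last first.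
  by rewrite -[X in measurable X]setTI; exact: measurable_rV_uncons.
rewrite -comp_preimage (_ : _ \o _ = id) // funeqE => p /=; exact: rV_consK.
Qed.

Lemma mpres_shift n (v : 'rV[R]_n) :
  mpres (lebesgue_rV R n) (lebesgue_rV R n) (fun x => x + v).
Proof.
elim: n v => [|n IH] v.
  rewrite (_ : (fun x => _) = id) //; apply/funext => x; apply/rowP; by case.
have := mpres_comp (mpres_comp (mpres_uncons n)
  (mpres_prod (mpres_shiftR (v ord0 ord0)) (IH (\row_j v ord0 (lift ord0 j))))) (mpres_cons n).
congr mpres; apply/funext => x; apply/rowP => j /=.
by rewrite !mxE; case: unliftP => [k|] -> /=; rewrite ?mxE.
Qed.

Lemma measurable_coordT d (T : measurableType d) n (f : T -> 'rV[R]_n) i :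
  measurable_fun setT f -> measurable_fun setT (fun x => f x ord0 i).
Proof. by move=> mf; exact: (measurableT_comp (measurable_coord i) mf). Qed.

Section measurable_ops.
Context d (T : measurableType d) (n : nat).
Implicit Types f g : T -> 'rV[R]_n.

Lemma measurable_rVD f g : measurable_fun setT f -> measurable_fun setT g ->
  measurable_fun setT (fun x => f x + g x).
Proof.
move=> mf mg; apply: measurable_fun_rV => i; under eq_fun do rewrite mxE.
by apply: measurable_funD; exact: measurable_coordT.
Qed.

Lemma measurable_rVZ (c : R) f : measurable_fun setT f ->
  measurable_fun setT (fun x => c *: f x).
Proof.
move=> mf; apply: measurable_fun_rV => i; under eq_fun do rewrite mxE.
by apply: measurable_funM; [exact: measurable_cst|exact: measurable_coordT].
Qed.

Lemma measurable_rVB f g : measurable_fun setT f -> measurable_fun setT g ->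
  measurable_fun setT (fun x => f x - g x).
Proof.
move=> mf mg; apply: measurable_rVD => //.
by under eq_fun do rewrite -scaleN1r; exact: measurable_rVZ.
Qed.

Lemma measurable_dotR f g : measurable_fun setT f -> measurable_fun setT g ->
  measurable_fun setT (fun x => dotR (f x) (g x)).
Proof.
move=> mf mg; apply: measurable_sum => i.
by apply: measurable_funM; exact: measurable_coordT.
Qed.

End measurable_ops.

Lemma dotRC n (u v : 'rV[R]_n) : dotR u v = dotR v u.
Proof. by apply: eq_bigr => i _; rewrite mulrC. Qed.

Lemma dotRDl n (u v w : 'rV[R]_n) : dotR (u + v) w = dotR u w + dotR v w.
Proof. by rewrite /dotR -big_split; apply: eq_bigr => j _; rewrite mxE mulrDl. Qed.

Lemma dotRDr n (u v w : 'rV[R]_n) : dotR w (u + v) = dotR w u + dotR w v.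
Proof. by rewrite dotRC dotRDl !(dotRC _ w). Qed.

Lemma dotRZl n c (u v : 'rV[R]_n) : dotR (c *: u) v = c * dotR u v.
Proof. by rewrite /dotR mulr_sumr; apply: eq_bigr => j _; rewrite mxE mulrA. Qed.

Lemma dotRZr n c (u v : 'rV[R]_n) : dotR u (c *: v) = c * dotR u v.
Proof. by rewrite dotRC dotRZl dotRC. Qed.

Lemma dotRNl n (u v : 'rV[R]_n) : dotR (- u) v = - dotR u v.
Proof. by rewrite -scaleN1r dotRZl mulN1r. Qed.

Lemma dotRNr n (u v : 'rV[R]_n) : dotR u (- v) = - dotR u v.
Proof. by rewrite dotRC dotRNl dotRC. Qed.

Definition dotE := (dotRDl, dotRDr, dotRNl, dotRNr, dotRZl, dotRZr).

(** The unimodular substitution (v, y) |-> (v - y/2, v + y/2) turns the partial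
    Fourier transform of F into the integral kernel of its Weyl transform. *)
Definition wigner_map n (z : Cn R n) : Cn R n :=
  (z.1 - 2^-1 *: z.2, z.1 + 2^-1 *: z.2).

Lemma mpres_shear1 n (c : R) : mpres (lebesgue_Cn R n) (lebesgue_Cn R n)
  (fun z => (z.1 + c *: z.2, z.2)).
Proof.
apply: (@mpres_fiber1 _ _ _ _ R (lebesgue_rV R n) (lebesgue_rV R n) (fun y x => x + c *: y)).
  by apply: measurable_rVD => //; exact: measurable_rVZ.
by move=> y; exact: mpres_shift.
Qed.

Lemma mpres_shear2 n (c : R) : mpres (lebesgue_Cn R n) (lebesgue_Cn R n)
  (fun z => (z.1, z.2 + c *: z.1)).
Proof.
apply: (@mpres_fiber2 _ _ _ _ R (lebesgue_rV R n) (lebesgue_rV R n) (fun x y => y + c *: x)).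
  by apply: measurable_rVD => //; exact: measurable_rVZ.
by move=> y; exact: mpres_shift.
Qed.

Lemma mpres_wigner n : mpres (lebesgue_Cn R n) (lebesgue_Cn R n) (@wigner_map n).
Proof.
have := mpres_comp (mpres_shear1 n (- 2^-1)) (mpres_shear2 n 1).
congr mpres; apply/funext => -[v y]; rewrite /wigner_map /= !scale1r scaleNr.
congr pair; rewrite addrCA; congr (_ + _).
by rewrite -[X in X - _]scale1r -scalerBl; congr (_ *: _); lra.
Qed.

Lemma mpres_shiftCn n (w : Cn R n) : mpres (lebesgue_Cn R n) (lebesgue_Cn R n)
  (fun z => z + w).
Proof. exact: (mpres_prod (mpres_shift w.1) (mpres_shift w.2)). Qed.

(** Fubini, one coordinate at a time. *)
Lemma prod_rV n (f : 'I_n -> R -> R[i]) :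
  (forall i, integrableC leb (f i)) ->
  integrableC (lebesgue_rV R n) (fun x => \prod_i f i (x ord0 i)) /\
  integralC (lebesgue_rV R n) (fun x => \prod_i f i (x ord0 i)) =
  \prod_i integralC leb (f i).
Proof.
elim: n f => [|n IH] f If.
  rewrite big_ord0.
  have mu0 : lebesgue_rV R 0 setT = 1%E by exact: diracT.
  have e1 : (fun x : 'rV[R]_0 => \prod_(i < 0) f i (x ord0 i)) = fun=> (1 : R)%:C.
    by apply/funext => x; rewrite big_ord0.
  rewrite e1 int_real; split.
    apply: iC_real; apply/integrableP; split; first exact: measurable_cst.
    under eq_integral do rewrite abse1.
    rewrite integral_cst // mul1e. by rewrite [X in (X < _)%E](mu0 : _ = 1%E) ltry.
  by rewrite Rintegral_cst // [X in fine X](mu0 : _ = 1%E) /= mulr1.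
have [IHi IHe] := IH (fun i => f (lift ord0 i)) (fun i => If _).
pose g (z : R * 'rV[R]_n) := f ord0 z.1 * \prod_i f (lift ord0 i) (z.2 ord0 i).
have eg (x : 'rV[R]_n.+1) : \prod_i f i (x ord0 i) = g (rV_uncons x).
  rewrite big_ord_recl /g /rV_uncons /=; congr (_ * _).
  by apply: eq_bigr => i _; rewrite mxE.
have Ig : integrableC (leb \x lebesgue_rV R n)%E g.
  exact: (iC_tensor (If ord0) IHi).
have -> : (fun x : 'rV[R]_n.+1 => \prod_i f i (x ord0 i)) = fun x => g (rV_uncons x).
  by apply/funext => x; exact: eg.
split; first exact: (mp_iC (mpres_uncons n) Ig).
rewrite -(mp_int (mpres_uncons n) (iC_mC Ig)) (int_tensor (If ord0) IHi).
by rewrite IHe big_ord_recl.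
Qed.

Lemma hyperplane0 n (i : 'I_n) (a : R) : lebesgue_rV R n [set x | x ord0 i = a] = 0%E.
Proof.
rewrite (_ : [set x | _] = [set x | forall j, (if j == i then [set a] else setT) (x ord0 j)]).
  have mA j : measurable (if j == i then [set a] else setT : set R) by case: ifP.
  transitivity (\prod_j leb (if j == i then [set a] else setT))%E.
    exact: (lebesgue_rV_box mA).
  by rewrite (bigD1 i) //= eqxx lebesgue_measure_set1 mul0e.
apply/seteqP; split => x /=; first by move=> xi j; case: eqP => // ->.
by move/(_ i); rewrite eqxx.
Qed.

Lemma ae_coord n (i : 'I_n) (a : R) : {ae lebesgue_rV R n, forall x : 'rV[R]_n, x ord0 i <> a}.
Proof.
exists [set x : 'rV[R]_n | x ord0 i = a]; split.
- by rewrite -[X in measurable X]setTI; exact: (measurable_coord i measurableT (measurable_set1 a)).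
- exact: hyperplane0.
- by move=> x /= /contrapT.
Qed.

End lebesgue_rV_theory.

(** * Functions are determined by their integrals over a pi-system *)

Section pi_uniqueness.
Context d (T : measurableType d) {R : realType}.
Variable mu : {measure set T -> \bar R}.
Variables (G : set (set T)) (g : (set T)^nat).
Hypotheses (mG : measurable = <<s G >>) (setIG : setI_closed G).
Hypothesis Gg : forall k, G (g k).
Hypothesis g_cover : \bigcup_k (g k) = setT.

Let GM A : G A -> measurable A.
Proof. by move=> GA; rewrite mG; exact: sub_sigma_algebra. Qed.

Let real_case (h : T -> R) : mu.-integrable setT (EFin \o h) ->
  (\int[mu]_x (h x)%:E = 0)%E ->
  (forall A, G A -> \int[mu]_(x in A) (h x)%:E = 0)%E ->
  {ae mu, forall x, h x = 0}.
Proof.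
move=> ih hT hG.
have all0 S : <<s G >> S -> (\int[mu]_(x in S) (h x)%:E = 0)%E.
  apply: (dynkin_induction (P := fun S => \int[mu]_(x in S) (h x)%:E = 0)%E mG setIG) => //.
    move=> A mA hA.
    have : (\int[mu]_(x in A `|` ~` A) (h x)%:E = 0)%E by rewrite setUv.
    rewrite integral_setU ?hA ?add0e //.
    - exact: measurable_structure.measurableC.
    - by rewrite setUv; exact: (measurable_int mu ih).
    - by apply/disj_setPS => x [].
  move=> F mF tF hF; rewrite integral_bigcup //.
    by apply: eseries0 => i _ _; exact: hF.
  by apply: integrableS ih => //; exact: bigcup_measurable.
have : ae_eq mu setT (EFin \o h) (cst 0%E).
  apply: integral_ae_eq => // E _ mE.
  by rewrite integral0 all0 // -mG.
by apply: filterS => x /(_ I) /= [].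
Qed.

(** On each covering set [g k] the function is integrable, and the measurable
    sets over whose intersection with [g k] it integrates to zero form a Dynkin
    system, which contains [G] because [G] is closed under intersection; so it
    vanishes almost everywhere on [g k]. *)
Lemma pi_unique (h : T -> R[i]) :
  (forall A, G A -> integrableC mu (fun x => h x * (\1_A x)%:C)) ->
  (forall A, G A -> integralC mu (fun x => h x * (\1_A x)%:C) = 0) ->
  {ae mu, forall x, h x = 0}.
Proof.
move=> Ih h0.
have ReM (x : T) A : complex.Re (h x * (\1_A x)%:C) = complex.Re (h x) * \1_A x.
  by case: (h x) => a b /=; rewrite mulr0 subr0.
have ImM (x : T) A : complex.Im (h x * (\1_A x)%:C) = complex.Im (h x) * \1_A x.
  by case: (h x) => a b /=; rewrite mulr0 add0r.
have restr (u : T -> R) (k : nat) (A : set T) : measurable A ->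
  (\int[mu]_(x in A) (u x * \1_(g k) x)%:E = \int[mu]_x (u x * \1_(g k `&` A) x)%:E)%E.
  move=> mA; rewrite integral_mkcond; apply: eq_integral => x _.
  by rewrite patchE !indicE in_setI; case: (x \in A); rewrite ?andbT ?andbF ?mulr0.
have ae_k (k : nat) : {ae mu, forall x, h x * (\1_(g k) x)%:C = 0}.
  have [Ire Iim] := Ih _ (Gg k).
  have z (A : set T) : G A -> (\int[mu]_(x in A) (complex.Re (h x) * \1_(g k) x)%:E = 0)%E
      /\ (\int[mu]_(x in A) (complex.Im (h x) * \1_(g k) x)%:E = 0)%E.
    move=> GA; have GI := setIG (Gg k) GA.
    have [i1 i2] := Ih _ GI; have := h0 _ GI.
    move=> /eqP; rewrite eq_complex => /andP[/eqP/= r1 /eqP/= r2].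
    rewrite !restr; try exact: GM.
    split.
      under eq_integral do rewrite -ReM.
      by rewrite -[LHS]fineK ?[X in X%:E]r1 //; exact: integrable_fin_num.
    under eq_integral do rewrite -ImM.
    by rewrite -[LHS]fineK ?[X in X%:E]r2 //; exact: integrable_fin_num.
  have zT (u : T -> R) : (\int[mu]_(x in g k) (u x * \1_(g k) x)%:E =
      \int[mu]_x (u x * \1_(g k) x)%:E)%E.
    by rewrite restr ?setIid //; exact: GM.
  have r0 : {ae mu, forall x, complex.Re (h x) * \1_(g k) x = 0}.
    apply: (real_case (h := fun x => complex.Re (h x) * \1_(g k) x)).
    - by move: Ire; under eq_fun do rewrite ReM.
    - by rewrite -zT; exact: (z _ (Gg k)).1.
    - by move=> A GA; exact: (z A GA).1.
  have i0 : {ae mu, forall x, complex.Im (h x) * \1_(g k) x = 0}.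
    apply: (real_case (h := fun x => complex.Im (h x) * \1_(g k) x)).
    - by move: Iim; under eq_fun do rewrite ImM.
    - by rewrite -zT; exact: (z _ (Gg k)).2.
    - by move=> A GA; exact: (z A GA).2.
  apply: filterS2 r0 i0 => x r0 i0; apply/eqP.
  by rewrite eq_complex ReM ImM r0 i0 !eqxx.
move/ae_foralln : ae_k; apply: filterS => x hx.
have [k _ gkx] : (\bigcup_k g k) x by rewrite g_cover.
by have := hx k; rewrite indicE mem_set // mulr1.
Qed.

End pi_uniqueness.

Section rectangles.
Context d1 d2 (T1 : measurableType d1) (T2 : measurableType d2) {R : realType}.
Variable m1 : {sigma_finite_measure set T1 -> \bar R}.
Variable m2 : {sigma_finite_measure set T2 -> \bar R}.

Let fin1 := [set A : set T1 | measurable A /\ (m1 A < +oo)%E].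
Let fin2 := [set B : set T2 | measurable B /\ (m2 B < +oo)%E].
Let G := [set A `*` B | A in fin1 & B in fin2].

(** Rectangles with sides of finite measure generate the product sigma-algebra,
    as every rectangle is a countable union of such. *)
Lemma rect_unique (h : T1 * T2 -> R[i]) :
  (forall A B, measurable A -> measurable B -> (m1 A < +oo)%E -> (m2 B < +oo)%E ->
    integrableC (m1 \x m2)%E (fun z => h z * (\1_(A `*` B) z)%:C)) ->
  (forall A B, measurable A -> measurable B -> (m1 A < +oo)%E -> (m2 B < +oo)%E ->
    integralC (m1 \x m2)%E (fun z => h z * (\1_(A `*` B) z)%:C) = 0) ->
  {ae (m1 \x m2)%E, forall z, h z = 0}.
Proof.
move=> Ih h0.
have /sigma_finiteP[F [TF ndF Foo]] := sigma_finiteT m1.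
have /sigma_finiteP[H [TH ndH Hoo]] := sigma_finiteT m2.
have cover (A : set T1) (B : set T2) : A `*` B = \bigcup_k ((A `&` F k) `*` (B `&` H k)).
  apply/seteqP; split => [[x y] [Ax By]|[x y] [k _ [[? _] [? _]]] //].
  have [i _ Fi] : (\bigcup_k F k) x by rewrite -TF.
  have [j _ Hj] : (\bigcup_k H k) y by rewrite -TH.
  exists (maxn i j) => //; split; split => //=.
  - by clear -ndF Fi; move: x Fi; exact/subsetPset/ndF/leq_maxl.
  - by clear -ndH Hj; move: y Hj; exact/subsetPset/ndH/leq_maxr.
apply: (@pi_unique _ _ _ _ G (fun k => F k `*` H k)).
- rewrite measurable_prod_measurableType; apply/seteqP; split; last first.
    apply: smallest_sub; first exact: smallest_sigma_algebra.
    move=> _ [A [mA _] [B [mB _] <-]]; apply: sub_sigma_algebra.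
    by exists A => //; exists B.
  apply: smallest_sub; first exact: smallest_sigma_algebra.
  move=> _ [A mA [B mB <-]]; rewrite cover.
  apply: sigma_algebra_bigcup => k.
  have [mF Fk] := Foo k; have [mH Hk] := Hoo k.
  apply: sub_sigma_algebra; exists (A `&` F k).
    split; first exact: measurableI.
    by apply: le_lt_trans Fk; apply: le_measure; rewrite ?inE //; exact: measurableI.
  exists (B `&` H k) => //; split; first exact: measurableI.
  by apply: le_lt_trans Hk; apply: le_measure; rewrite ?inE //; exact: measurableI.
- move=> _ _ [A [mA Aoo] [B [mB Boo] <-]] [C [mC Coo] [D [mD Doo] <-]].
  exists (A `&` C).
    split; first exact: measurableI.
    by apply: le_lt_trans Aoo; apply: le_measure; rewrite ?inE //; exact: measurableI.
  exists (B `&` D); last by rewrite setXI.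
  split; first exact: measurableI.
  by apply: le_lt_trans Boo; apply: le_measure; rewrite ?inE //; exact: measurableI.
- by move=> k; exists (F k); [exact: Foo|exists (H k); [exact: Hoo|]].
- rewrite -setXTT [RHS](cover setT setT); apply: eq_bigcupr => k _.
  by rewrite !setTI.
- by move=> _ [A [mA Aoo] [B [mB Boo] <-]]; exact: Ih.
- by move=> _ [A [mA Aoo] [B [mB Boo] <-]]; exact: h0.
Qed.

End rectangles.

Section boxes.
Context {R : realType} (n : nat).

Definition box (a b : 'I_n -> R) : set 'rV[R]_n :=
  [set x | forall i, `]a i, b i]%classic (x ord0 i)].

Let G := [set B | exists a b, B = box a b].

Lemma measurable_box a b : measurable (box a b).
Proof.
rewrite (_ : box a b = \bigcap_(i in [set: 'I_n])
    ((fun x : 'rV[R]_n => x ord0 i) @^-1` `]a i, b i]%classic)); last first.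
  by apply/seteqP; split => [x Ax i _|x Ax i]; [exact: Ax|exact: (Ax i)].
apply: fin_bigcap_measurable => // i _.
by rewrite -[X in measurable X]setTI; exact: measurable_coord.
Qed.

Let boxI : setI_closed G.
Proof.
move=> _ _ [a [b ->]] [c [d ->]].
exists (fun i => Num.max (a i) (c i)), (fun i => Num.min (b i) (d i)).
apply/seteqP; split => x.
  move=> [h1 h2] i; have := h1 i; have := h2 i; rewrite /= !in_itv /=.
  by move=> /andP[p q] /andP[r s]; rewrite gt_max p r le_min q s.
move=> h; split => i; have := h i; rewrite /= !in_itv /=;
  by rewrite gt_max le_min => /andP[/andP[p q] /andP[r t]]; apply/andP; split.
Qed.

Let box_nat (k : nat) := box (fun=> - k%:R) (fun=> k%:R).

(** A slab is a countable union of boxes, the other sides growing. *)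
Let coord_box (i : 'I_n) (c d : R) :
  <<s G >> ((fun x : 'rV[R]_n => x ord0 i) @^-1` `]c, d]%classic).
Proof.
rewrite (_ : _ @^-1` _ = \bigcup_k box (fun j => if j == i then c else - k%:R)
   (fun j => if j == i then d else k%:R)).
  apply: sigma_algebra_bigcup => k.
  by apply: sub_sigma_algebra; eexists; eexists.
apply/seteqP; split => x /=.
  move=> xi; pose m := \max_(j < n) (Num.truncn `|x ord0 j|).+1.
  exists m => // j; case: eqP => [->//|_]; rewrite /= in_itv /=.
  have jm : `|x ord0 j| < m%:R.
    apply: lt_le_trans (truncnS_gt _) _; rewrite ler_nat.
    exact: (leq_bigmax (F := fun j => (Num.truncn `|x ord0 j|).+1)).
  by move: (jm); rewrite ltr_norml => /andP[-> /ltW ->].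
by move=> [k _ /(_ i)]; rewrite /= eqxx.
Qed.

Lemma measurable_boxes : @measurable _ 'rV[R]_n = <<s G >>.
Proof.
apply/seteqP; split; last first.
  apply: smallest_sub; first exact: sigma_algebra_measurable.
  by move=> _ [a [b ->]]; exact: measurable_box.
apply: smallest_sub; first exact: smallest_sigma_algebra.
have mcoord i : forall A : set R, measurable A ->
    <<s G >> ((fun x : 'rV[R]_n => x ord0 i) @^-1` A).
  have : measurable `<=`
      [set A : set R | <<s G >> ((fun x : 'rV[R]_n => x ord0 i) @^-1` A)].
    apply: smallest_sub.
      split.
      - by rewrite /= preimage_set0; exact: sigma_algebra0.
      - move=> A /= hA; rewrite setTD preimage_setC -setTD.
        exact: sigma_algebraCD.
      - by move=> F hF /=; rewrite preimage_bigcup; exact: sigma_algebra_bigcup.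
    by move=> _ [[c d] _ <-] /=; exact: coord_box.
  by move=> h A /h.
move=> A; rewrite -bigcup_seq => -[i _ [B mB <-]].
by rewrite setTI; exact: mcoord.
Qed.

Lemma box_unique (mu : {measure set 'rV[R]_n -> \bar R}) (h : 'rV[R]_n -> R[i]) :
  (forall a b, integrableC mu (fun x => h x * (\1_(box a b) x)%:C)) ->
  (forall a b, integralC mu (fun x => h x * (\1_(box a b) x)%:C) = 0) ->
  {ae mu, forall x, h x = 0}.
Proof.
move=> Ih h0; apply: (@pi_unique _ _ _ mu G box_nat).
- exact: measurable_boxes.
- exact: boxI.
- by move=> k; eexists; eexists.
- apply/seteqP; split => // x _.
  exists (\max_(j < n) (Num.truncn `|x ord0 j|).+1) => // j; rewrite /= in_itv /=.
  set m := \max_(j < n) _.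
  have jm : `|x ord0 j| < m%:R.
    apply: lt_le_trans (truncnS_gt _) _; rewrite ler_nat.
    exact: (leq_bigmax (F := fun j => (Num.truncn `|x ord0 j|).+1)).
  by move: (jm); rewrite ltr_norml => /andP[-> /ltW ->].
- by move=> _ [a [b ->]]; exact: Ih.
- by move=> _ [a [b ->]]; exact: h0.
Qed.

End boxes.

(** A locally integrable function is determined by its integrals over the sets of
    finite measure; applied to square integrable functions, this makes weak
    integrals unique. *)
Lemma fin_unique d (T : measurableType d) {R : realType}
  (mu : {sigma_finite_measure set T -> \bar R}) (h : T -> R[i]) :
  (forall A, measurable A -> (mu A < +oo)%E -> integrableC mu (fun x => h x * (\1_A x)%:C)) ->
  (forall A, measurable A -> (mu A < +oo)%E -> integralC mu (fun x => h x * (\1_A x)%:C) = 0) ->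
  {ae mu, forall x, h x = 0}.
Proof.
move=> Ih h0; have [F TF Foo] := sigma_finiteT mu.
pose G := [set A : set T | measurable A /\ (mu A < +oo)%E].
have GI A B : measurable A -> G B -> G (A `&` B).
  move=> mA [mB Boo]; split; first exact: measurableI.
  by apply: le_lt_trans Boo; apply: le_measure; rewrite ?inE //; exact: measurableI.
apply: (@pi_unique _ _ _ mu G F).
- apply/seteqP; split; last first.
    by apply: smallest_sub; [exact: sigma_algebra_measurable|move=> A []].
  move=> A mA; rewrite -[A]setIT TF setI_bigcupr.
  apply: sigma_algebra_bigcup => k; apply: sub_sigma_algebra; exact: GI.
- by move=> A B [mA _] GB; exact: GI.
- by move=> k; exact: (Foo k).
- by rewrite TF.
- by move=> A []; exact: Ih.
- by move=> A []; exact: h0.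
Qed.

(** * Fourier inversion *)

Section poisson_kernel.
Context {R : realType}.
Local Notation leb := (@lebesgue_measure R).
Implicit Types e u x : R.

Definition damp e (x : R) : R := expR (- (e * `|x|)).

Lemma damp_continuous e : continuous (damp e).
Proof.
move=> x; rewrite /damp; apply: continuous_comp; last exact: continuous_expR.
apply: continuousN; apply: continuousM; first exact: cvg_cst.
exact: norm_continuous.
Qed.

Lemma damp_ge0 e x : 0 <= damp e x. Proof. exact: expR_ge0. Qed.

Lemma damp_le1 e x : 0 <= e -> damp e x <= 1.
Proof. by move=> e0; rewrite -expR0 ler_expR oppr_le0 mulr_ge0. Qed.

Lemma measurable_damp e : measurable_fun setT (damp e).
Proof. by apply: continuous_measurable_fun; exact: damp_continuous. Qed.

Lemma continuous_cosM u : continuous (fun x => cos (u * x)).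
Proof.
move=> x; apply: continuous_comp; last exact: continuous_cos.
by apply: continuousM; [exact: cvg_cst|exact: cvg_id].
Qed.

Let lin_derive (a x : R) : is_derive x 1 (fun x => a * x) a.
Proof. by apply: is_derive_eq; rewrite /= ?scaler0 ?add0r /GRing.scale /= mulr1. Qed.

Let expderive (a x : R) : is_derive x 1 (fun x => expR (a * x)) (a * expR (a * x)).
Proof.
have := @is_derive1_comp _ (@expR R) (fun x => a * x) x _ _ (is_derive_expR (a * x)) (lin_derive a x).
by rewrite mulrC.
Qed.

Let cosderive (a x : R) : is_derive x 1 (fun x => cos (a * x)) (- (a * sin (a * x))).
Proof.
have := @is_derive1_comp _ (@cos R) (fun x => a * x) x _ _ (is_derive_cos (a * x)) (lin_derive a x).
by rewrite mulrC mulrN.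
Qed.

Let sinderive (a x : R) : is_derive x 1 (fun x => sin (a * x)) (a * cos (a * x)).
Proof.
have := @is_derive1_comp _ (@sin R) (fun x => a * x) x _ _ (is_derive_sin (a * x)) (lin_derive a x).
by rewrite mulrC.
Qed.

Let prim e u x : R := expR (- e * x) *
  (- e^-1 + (u * sin (u * x) - e * cos (u * x)) * (e ^+ 2 + u ^+ 2)^-1).

Let prim_derive e u x : 0 < e ->
  is_derive x 1 (prim e u) (expR (- e * x) * (1 + cos (u * x))).
Proof.
move=> e0; rewrite /prim.
have d1 := expderive (- e) x.
have d2 : is_derive x 1 (fun x => - e^-1 + (u * sin (u * x) - e * cos (u * x)) * (e ^+ 2 + u ^+ 2)^-1)
   ((u * (u * cos (u * x)) + e * (u * sin (u * x))) * (e ^+ 2 + u ^+ 2)^-1).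
  have d3 := sinderive u x; have d4 := cosderive u x.
  have -> : (fun x => - e^-1 + (u * sin (u * x) - e * cos (u * x)) * (e ^+ 2 + u ^+ 2)^-1) =
    cst (- e^-1) + (e ^+ 2 + u ^+ 2)^-1 *: (u *: (fun x => sin (u * x)) - e *: (fun x => cos (u * x))).
    by apply/funext => y; rewrite !fctE /GRing.scale /=; ring.
  apply: is_derive_eq; rewrite /GRing.scale /=; ring.
apply: is_derive_eq; rewrite /GRing.scale /=.
have eu : e ^+ 2 + u ^+ 2 != 0 by rewrite gt_eqF // ltr_pwDl ?sqr_ge0 ?exprn_gt0.
have e1 : e != 0 by rewrite gt_eqF.
by field; rewrite eu e1.
Qed.

Let prim_cvg e u : 0 < e -> prim e u x @[x --> +oo] --> 0.
Proof.
move=> e0; pose B := e^-1 + (`|u| + e) * (e ^+ 2 + u ^+ 2)^-1.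
have expc : expR (- e * x) * B @[x --> +oo] --> 0.
  rewrite -(mul0r B); apply: cvgM; last exact: cvg_cst.
  under eq_fun do rewrite mulNr.
  apply: (@cvg_comp _ _ _ (fun x => e * x) (fun y => expR (- y)) _ (pinfty_nbhs R)).
    exact: gt0_cvgMry.
  exact: cvgr_expR.
have bnd x : `|prim e u x| <= expR (- e * x) * B.
  rewrite /prim normrM ger0_norm ?expR_ge0 // ler_wpM2l ?expR_ge0 //.
  apply: le_trans (ler_normD _ _) _; rewrite normrN [`|e^-1|]ger0_norm ?invr_ge0 ?(ltW e0) //.
  rewrite /B lerD2l normrM [X in _ * X]ger0_norm ?invr_ge0 ?addr_ge0 ?sqr_ge0 //.
  apply: ler_wpM2r; first by rewrite invr_ge0 addr_ge0 ?sqr_ge0.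
  apply: le_trans (ler_normB _ _) _; rewrite !normrM [`|e|]gtr0_norm //.
  apply: lerD; first by rewrite ler_piMr // ler_norml sin_geN1 sin_le1.
  by rewrite ler_piMr ?(ltW e0) // ler_norml cos_geN1 cos_le1.
apply: (squeeze_cvgr (f := fun x => - (expR (- e * x) * B))
  (h := fun x => expR (- e * x) * B)) => //.
  by apply: nearW => x; rewrite -ler_norml.
by rewrite -oppr0; exact: cvgN.
Qed.

Let damp1cos e u : 0 < e ->
  (\int[leb]_x (damp e x * (1 + cos (u * x)))%:E = (2 * (e^-1 + e / (e ^+ 2 + u ^+ 2)))%:E)%E.
Proof.
move=> e0.
have cont : continuous (fun x => damp e x * (1 + cos (u * x))).
  move=> x; apply: continuousM; first exact: damp_continuous.
  by apply: continuousD; [exact: cvg_cst|exact: continuous_cosM].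
rewrite ge0_symfun_integralT //; last 2 first.
- by move=> x; rewrite mulr_ge0 ?damp_ge0 //; have := cos_geN1 (u * x); lra.
- by move=> x; rewrite /damp /= normrN mulrN cosN.
rewrite EFinM -set_itvcy; congr (_ * _)%E.
have contF : continuous (prim e u).
  by move=> x; apply: differentiable_continuous; apply/derivable1_diffP;
    have [] := prim_derive u x e0.
transitivity (\int[leb]_(x in `[0%R, +oo[%classic) (expR (- e * x) * (1 + cos (u * x)))%:E)%E.
  apply: eq_integral => x; rewrite inE /= in_itv /= andbT => x0.
  by rewrite /damp ger0_norm // mulNr.
rewrite (@ge0_continuous_FTC2y _ _ (prim e u) 0 0).
- rewrite -EFinB /prim !mulr0 expR0 sin0 cos0; congr (_%:E).
  by rewrite mulr0 mulr1 mul1r; ring.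
- by move=> x _; rewrite mulr_ge0 ?expR_ge0 //; have := cos_geN1 (u * x); lra.
- apply: continuous_subspaceT.
  have : continuous (fun x => expR (- e * x) * (1 + cos (u * x))); last by [].
  move=> x; apply: cvgM.
    by have [/derivable1_diffP/differentiable_continuous] := expderive (- e) x.
  by apply: cvgD; [exact: cvg_cst|exact: continuous_cosM].
- exact: prim_cvg.
- by move=> x _; have [] := prim_derive u x e0.
- by apply: cvg_at_right_filter; exact: contF.
- by move=> x _; rewrite derive1E; have [] := prim_derive u x e0.
Qed.

Lemma integrable_damp e : 0 < e -> leb.-integrable setT (EFin \o damp e).
Proof.
move=> e0; apply/integrableP; split.
  by apply/measurable_EFinP; exact: measurable_damp.
have := damp1cos 0 e0; under eq_integral do rewrite mul0r cos0.
move=> h; apply: (@le_lt_trans _ _ (\int[leb]_x (damp e x * (1 + 1))%:E)%E); last by rewrite h ltry.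
apply: ge0_le_integral => //.
- by apply: measurableT_comp => //; apply/measurable_EFinP; exact: measurable_damp.
- by apply/measurable_EFinP; apply: measurable_funM => //; exact: measurable_damp.
- move=> x _ /=; rewrite lee_fin ger0_norm ?damp_ge0 //.
  by rewrite ler_peMr ?damp_ge0 //; lra.
Qed.

Lemma iC_damp e u : 0 < e -> integrableC leb (fun x => (damp e x)%:C * expi (u * x)).
Proof.
move=> e0; apply: (@iCM _ _ _ _ _ _ 2).
- exact: iC_real (integrable_damp e0).
- by apply: mC_expi; apply: measurable_funM => //; exact: measurable_cst.
- by move=> x; exact: n1_expi.
Qed.

(** Integrating [1 + cos] instead of [cos] keeps the integrand nonnegative, so
    that the improper fundamental theorem applies. *)
Lemma poisson_kernel e u : 0 < e ->
  integralC leb (fun x => (damp e x)%:C * expi (u * x)) = (2 * e / (e ^+ 2 + u ^+ 2))%:C.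
Proof.
move=> e0.
have [i1 i2] := iC_damp u e0.
have re x : complex.Re ((damp e x)%:C * expi (u * x)) = damp e x * cos (u * x).
  by rewrite /= mul0r subr0.
have im x : complex.Im ((damp e x)%:C * expi (u * x)) = damp e x * sin (u * x).
  by rewrite /= mul0r addr0.
have icos : leb.-integrable setT (fun x => (damp e x * cos (u * x))%:E).
  by move: i1; under eq_fun do rewrite re.
have isin : leb.-integrable setT (fun x => (damp e x * sin (u * x))%:E).
  by move: i2; under eq_fun do rewrite im.
have split1 w : leb.-integrable setT (fun x => (damp e x * cos (w * x))%:E) ->
  \int[leb]_x damp e x + \int[leb]_x (damp e x * cos (w * x)) = 2 * (e^-1 + e / (e ^+ 2 + w ^+ 2)).
  move=> iw; rewrite -RintegralD //; last exact: integrable_damp.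
  rewrite (_ : (fun x => _) = fun x => damp e x * (1 + cos (w * x))); last first.
    by apply/funext => x; rewrite mulrDr mulr1.
  by rewrite /Rintegral damp1cos.
have h0 := split1 0; have hu := split1 u icos.
have h0' : \int[leb]_x damp e x = 2 * e^-1.
  have e00 : (fun x => damp e x * cos (0 * x)) = damp e.
    by apply/funext => x; rewrite mul0r cos0 mulr1.
  have : e^-1 + e / (e ^+ 2 + 0 ^+ 2) = e^-1 + e^-1.
    by field; rewrite gt_eqF.
  move: h0; rewrite (_ : (fun x => (damp e x * cos (0 * x))%:E) = EFin \o damp e); last first.
    by apply/funext => x; rewrite mul0r cos0 mulr1.
  move=> /(_ (integrable_damp e0)); rewrite e00 => h2 h1; rewrite h1 in h2; lra.
rewrite /integralC; apply/eqP; rewrite eq_complex; apply/andP; split; apply/eqP.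
  have -> : (fun x => complex.Re ((damp e x)%:C * expi (u * x))) = fun x => damp e x * cos (u * x).
    by apply/funext.
  move: hu; rewrite h0' mulrDr => /addrI ->; rewrite /=; ring.
have -> : (fun x => complex.Im ((damp e x)%:C * expi (u * x))) = fun x => damp e x * sin (u * x).
  by apply/funext.
rewrite /=; set I := (X in X = 0).
suff : I = - I by lra.
rewrite {1}/I /Rintegral (mp_integral mpres_oppR); last exact: (measurable_int leb isin).
rewrite -/(Rintegral _ _ _) /I -mulN1r -RintegralZl //.
apply: eq_Rintegral => x _; rewrite /damp normrN mulrN sinN; ring.
Qed.

Let atan_derive (c x t : R) : is_derive t 1 (fun t => atan (c * (t - x))) (c / (1 + (c * (t - x)) ^+ 2)).
Proof.
have d1 : is_derive t 1 (fun t => c * (t - x)) c.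
  have -> : (fun t => c * (t - x)) = (fun t => c * t) + cst (- (c * x)).
    by apply/funext => y /=; rewrite mulrBr.
  by have d := lin_derive c t; apply: is_derive_eq; rewrite subr0.
have := @is_derive1_comp _ (@atan R) (fun t => c * (t - x)) t _ _ (is_derive1_atan _) d1.
by rewrite mulrC.
Qed.

(** The Poisson kernel is integrated over an interval in closed form: letting
    [e] tend to 0 in its convolution with an indicator function then only takes
    the limits of the arctangent at infinity. *)
Lemma poisson_primitive e (lam a b x : R) : 0 < e -> lam != 0 -> a <= b ->
  \int[leb]_t (2 * e / (e ^+ 2 + (lam * (x - t)) ^+ 2) * \1_(`]a, b]%classic) t) =
  2 / lam * (atan (lam / e * (b - x)) - atan (lam / e * (a - x))).
Proof.
move=> e0 l0; rewrite le_eqVlt => /orP[/eqP <-|ab].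
  rewrite subrr mulr0 set_itvoc0; under eq_Rintegral do rewrite indic0 mulr0.
  by rewrite Rintegral_cst // mul0r.
pose f t := 2 * e / (e ^+ 2 + (lam * (x - t)) ^+ 2).
pose F t := 2 / lam * atan (lam / e * (t - x)).
have dF (t : R) : is_derive t 1 F (f t).
  have d := atan_derive (lam / e) x t.
  have -> : F = (2 / lam) *: (fun t => atan (lam / e * (t - x))) by [].
  apply: is_derive_eq; rewrite /GRing.scale /= /f.
  have p1 : e ^+ 2 + (lam * (x - t)) ^+ 2 != 0.
    by rewrite gt_eqF // ltr_pwDl ?sqr_ge0 ?exprn_gt0.
  have p2 : 1 + (lam / e * (t - x)) ^+ 2 != 0.
    by rewrite gt_eqF // ltr_pwDl ?sqr_ge0.
  by field; rewrite p1 l0 gt_eqF.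
have contF : continuous F.
  by move=> t; have [/derivable1_diffP/differentiable_continuous] := dF t.
have contf : continuous f.
  move=> t; apply: cvgM; first exact: cvg_cst.
  apply: cvgV; first by rewrite gt_eqF // ltr_pwDl ?sqr_ge0 ?exprn_gt0.
  apply: cvgD; first exact: cvg_cst.
  have c1 : lam * (x - s) @[s --> t] --> lam * (x - t).
    apply: cvgM; first exact: cvg_cst.
    by apply: cvgB; [exact: cvg_cst|exact: cvg_id].
  by under eq_fun do rewrite expr2; rewrite expr2; exact: cvgM.
transitivity (\int[leb]_(t in `]a, b]) f t).
  rewrite [RHS]Rintegral_mkcond; apply: eq_Rintegral => t _.
  by rewrite patchE indicE; case: (t \in _); rewrite ?mulr1 ?mulr0.
rewrite /Rintegral integral_itv_obnd_cbnd; last first.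
  apply: measurable_funTS; apply/measurable_EFinP.
  exact: continuous_measurable_fun.
rewrite (@continuous_FTC2 _ _ F _ _ ab).
- by rewrite /= mulrBr.
- exact: continuous_subspaceT.
- split.
  + by move=> t _; have [] := dF t.
  + by apply: cvg_at_right_filter; exact: contF.
  + by apply: cvg_at_left_filter; exact: contF.
- by move=> t _; rewrite derive1E; have [] := dF t.
Qed.

End poisson_kernel.

Section limits.
Context {R : realType}.

Lemma expi_sum I (s : seq I) (F : I -> R) :
  expi (\sum_(i <- s) F i) = \prod_(i <- s) expi (F i).
Proof.
elim: s => [|i s IH]; first by rewrite !big_nil expi0.
by rewrite !big_cons expiD IH.
Qed.

Lemma realC_prod I (s : seq I) (F : I -> R) :
  (\prod_(i <- s) F i)%:C = \prod_(i <- s) (F i)%:C.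
Proof. exact: (rmorph_prod (real_complex R)). Qed.

Lemma cvg_prod I (s : seq I) (u : I -> nat -> R) (l : I -> R) :
  (forall i, u i @ \oo --> l i) ->
  (fun k => \prod_(i <- s) u i k) @ \oo --> \prod_(i <- s) l i.
Proof.
move=> ul; elim: s => [|i s IH].
  by under eq_fun do rewrite big_nil; rewrite big_nil; exact: cvg_cst.
by under eq_fun do rewrite big_cons; rewrite big_cons; exact: cvgM.
Qed.

Lemma cvg_atan_sg (c : R) :
  (fun k : nat => atan (c * k.+1%:R)) @ \oo --> Num.sg c * (pi / 2).
Proof.
have pos (d : R) : 0 < d -> (fun k : nat => atan (d * k.+1%:R)) @ \oo --> pi / 2.
  move=> d0; apply: (@cvg_comp _ _ _ (fun k : nat => d * k.+1%:R) (@atan R) _ (pinfty_nbhs R)).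
    apply/cvgryPge => A; near=> k; rewrite mulrC -ler_pdivrMr //.
    have : A / d <= k%:R by near: k; exact: nbhs_infty_ger.
    by move/le_trans; apply; rewrite ler_nat.
  exact: cvgy_atan.
case: (ltrgt0P c) => [c0|c0|->].
- by rewrite gtr0_sg // mul1r; exact: pos.
- rewrite ltr0_sg // mulN1r.
  rewrite (_ : (fun k => _) = fun k : nat => - atan (- c * k.+1%:R)); last first.
    by apply/funext => k; rewrite mulNr atanN opprK.
  by apply: cvgN; apply: pos; rewrite oppr_gt0.
- rewrite sgr0 mul0r; under eq_fun do rewrite mul0r atan0; exact: cvg_cst.
Unshelve. all: by end_near. Qed.

Lemma n1_real (r : R) : n1 r%:C = `|r|.
Proof. by rewrite /n1 /= normr0 addr0. Qed.

Lemma n1_realM (r : R) (z : R[i]) : n1 (r%:C * z) = `|r| * n1 z.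
Proof.
by case: z => a b; rewrite /n1 /= !mul0r subr0 addr0 !normrM mulrDr.
Qed.

End limits.

Section inversion.
Context {R : realType} (n : nat).
Local Notation mu := (lebesgue_rV R n).
Local Notation leb := (@lebesgue_measure R).
Implicit Types h p : 'rV[R]_n -> R[i].

Definition ft (lam : R) h (v : 'rV[R]_n) : R[i] :=
  integralC mu (fun x => h x * expi (lam * dotR x v)).

Lemma mC_phase d (T : measurableType d) (lam : R) (f g : T -> 'rV[R]_n) :
  measurable_fun setT f -> measurable_fun setT g ->
  measurableC (fun x => expi (lam * dotR (f x) (g x))).
Proof.
move=> mf mg; apply: mC_expi; apply: measurable_funM; first exact: measurable_cst.
exact: measurable_dotR.
Qed.

Lemma iC_phase (lam : R) h v : integrableC mu h ->
  integrableC mu (fun x => h x * expi (lam * dotR x v)).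
Proof.
move=> Ih; apply: (iCM Ih _ (fun _ => n1_expi _)).
apply: mC_phase => //; exact: measurable_cst.
Qed.

Lemma mC_ft (lam : R) h : measurableC h -> measurableC (ft lam h).
Proof.
move=> mh; apply: (@mC_int1 _ _ _ _ _ mu (fun z => h z.2 * expi (lam * dotR z.2 z.1))).
apply: mCM; first exact: (mC_comp mh measurable_snd).
exact: mC_phase.
Qed.

Lemma ft_bound (lam : R) h v : integrableC mu h ->
  n1 (ft lam h v) <= 2 * \int[mu]_x n1 (h x).
Proof.
move=> Ih; apply: le_trans (n1_int (iC_phase lam v Ih)) _.
rewrite -RintegralZl //; last exact: iC_n1.
apply: le_Rintegral => //; first exact: iC_n1 (iC_phase lam v Ih).
  exact: (integrableZl measurableT 2 (iC_n1 Ih)).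
move=> x _; apply: le_trans (n1M _ _) _; rewrite mulrC; apply: ler_wpM2r.
  exact: n1_ge0.
exact: n1_expi.
Qed.

Definition dampn (e : R) (v : 'rV[R]_n) : R := \prod_i damp e (v ord0 i).

Lemma dampn_ge0 e v : 0 <= dampn e v.
Proof. by apply: prodr_ge0 => i _; exact: damp_ge0. Qed.

Lemma dampn_le1 e v : 0 <= e -> dampn e v <= 1.
Proof.
move=> e0; apply: prodr_ile1 => i _; rewrite damp_ge0 /=; exact: damp_le1.
Qed.

Lemma measurable_dampn e : measurable_fun setT (dampn e).
Proof.
apply: measurable_prod => i _; apply: (measurableT_comp (measurable_damp e)).
exact: measurable_coord.
Qed.

Variable lam : R.
Hypothesis lam0 : lam != 0.

(** The Poisson kernel of [poisson_kernel] at frequency [lam * u]. *)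
Let pk (e u : R) := 2 * e / (e ^+ 2 + (lam * u) ^+ 2).

Let pk_ge0 e u : 0 < e -> 0 <= pk e u.
Proof.
by move=> e0; rewrite divr_ge0 ?addr_ge0 ?sqr_ge0 // mulr_ge0 // ltW.
Qed.

Let pk_le e u : 0 < e -> pk e u <= 2 / e.
Proof.
move=> e0; rewrite ler_pdivrMr; last by rewrite ltr_pwDl ?sqr_ge0 ?exprn_gt0.
have -> : 2 / e * (e ^+ 2 + (lam * u) ^+ 2) = 2 * e + 2 / e * (lam * u) ^+ 2.
  by field; rewrite gt_eqF.
by rewrite lerDl mulr_ge0 ?sqr_ge0 // divr_ge0 // ltW.
Qed.

Let measurable_pk d (T : measurableType d) e (f : T -> R) : 0 < e ->
  measurable_fun setT f -> measurable_fun setT (fun x => pk e (f x)).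
Proof.
move=> e0 mf; apply: (@measurableT_comp _ _ _ _ _ _ (pk e)) => //.
apply: continuous_measurable_fun => u.
apply: cvgM; first exact: cvg_cst.
apply: cvgV; first by rewrite gt_eqF // ltr_pwDl ?sqr_ge0 ?exprn_gt0.
apply: cvgD; first exact: cvg_cst.
have c1 : lam * s @[s --> u] --> lam * u.
  by apply: cvgM; [exact: cvg_cst|exact: cvg_id].
by under eq_fun do rewrite expr2; rewrite expr2; exact: cvgM.
Qed.

Section fixed_damping.
Variables (e : R) (h p : 'rV[R]_n -> R[i]).
Hypotheses (e0 : 0 < e) (Ih : integrableC mu h) (Ip : integrableC mu p).
Hypothesis hp : {ae mu, forall v, ft lam h v = p v}.

Let integrable_dampn : integrableC mu (fun v => (dampn e v)%:C).
Proof.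
have [I _] := prod_rV (fun i : 'I_n => iC_real (integrable_damp e0)).
by apply: iC_eq I => v; rewrite /dampn realC_prod.
Qed.

Let dampn_phase (w : 'rV[R]_n) :
  integralC mu (fun v => (dampn e v)%:C * expi (lam * dotR w v)) =
  (\prod_i pk e (w ord0 i))%:C.
Proof.
have [_ E] := prod_rV (fun i : 'I_n => iC_damp (lam * w ord0 i) e0).
rewrite realC_prod; under [RHS]eq_bigr => i _ do rewrite -poisson_kernel //.
rewrite -E; apply: int_eq => v; rewrite big_split /= -realC_prod; congr (_ * _).
rewrite -expi_sum; congr expi; rewrite /dotR mulr_sumr.
by apply: eq_bigr => i _; rewrite mulrA.
Qed.

(** Damping makes the inversion integral absolutely convergent; undoing the
    definition of the transform then leaves a Poisson integral of [h]. *)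
Lemma damped_inversion t :
  integralC mu (fun v => (dampn e v)%:C * (p v * expi (- (lam * dotR t v)))) =
  integralC mu (fun x => h x * (\prod_i pk e (x ord0 i - t ord0 i))%:C).
Proof.
have md := iC_mC integrable_dampn.
have mph : measurableC (fun v : 'rV[R]_n => expi (- (lam * dotR t v))).
  apply: mC_expi; apply: measurableT_comp => //.
  apply: measurable_funM; first exact: measurable_cst.
  by apply: measurable_dotR; [exact: measurable_cst|exact: measurable_id].
have mft := mC_ft lam (iC_mC Ih).
rewrite (int_ae (g := fun v => (dampn e v)%:C * (ft lam h v * expi (- (lam * dotR t v))))); last 3 first.
- by apply: mCM => //; apply: mCM => //; exact: iC_mC Ip.
- by apply: mCM => //; apply: mCM.
- by apply: filterS hp => v ->.
pose Phi (z : Cn R n) := (h z.1 * (dampn e z.2)%:C) * expi (lam * dotR (z.1 - t) z.2).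
have IPhi : integrableC (mu \x mu)%E Phi.
  apply: (iCM (iC_tensor Ih integrable_dampn) _ (fun _ => n1_expi _)).
  apply: mC_phase => //; apply: measurable_rVB => //; exact: measurable_cst.
transitivity (integralC mu (fun v => integralC mu (fun x => Phi (x, v)))).
  apply: int_eq => v; rewrite /ft mulrA mulrC mulrA -intZ; last exact: iC_phase.
  apply: int_eq => x; rewrite /Phi /= dotRDl dotRNl mulrBr expiD; ring.
rewrite -fubiniC //; apply: int_eq => x.
rewrite (_ : \prod_i _ = \prod_i pk e ((x - t) ord0 i)); last first.
  by apply: eq_bigr => i _; rewrite !mxE.
rewrite -dampn_phase -intZ; last first.
  apply: (iCM integrable_dampn _ (fun _ => n1_expi _)).
  by apply: mC_phase => //; exact: measurable_cst.
by apply: int_eq => v; rewrite /Phi mulrA.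
Qed.

Variables (a b : 'I_n -> R).
Hypothesis ab : forall i, a i <= b i.

(** The Poisson integral of the indicator function of an edge of a box. *)
Definition atan_window (e : R) (x : R) (i : 'I_n) : R :=
  2 / lam * (atan (lam / e * (b i - x)) - atan (lam / e * (a i - x))).

Lemma indic_box (t : 'rV[R]_n) :
  (\1_(box a b) t : R) = \prod_i \1_(`]a i, b i]%classic) (t ord0 i).
Proof.
have [tb|tb] := pselect (box a b t).
  rewrite indicE mem_set //; apply/esym; apply: big1 => i _.
  by rewrite indicE mem_set //; exact: tb.
rewrite indicE memNset //; move/existsNP : tb => [i tb].
by rewrite (bigD1 i) //= indicE memNset ?mul0r.
Qed.

Lemma iC_box c d : integrableC mu (fun t => (\1_(box c d) t)%:C).
Proof.
apply: iC_indic; first exact: measurable_box.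
have mI i : measurable (`]c i, d i]%classic : set R) by exact: measurable_itv.
rewrite [X in (X < _)%E](_ : _ = \prod_(i < n) leb `]c i, d i]%classic)%E; last first.
  exact: (lebesgue_rV_box mI).
have : (\prod_(i < n) leb `]c i, d i]%classic)%E \is a fin_num.
  apply: prode_fin_num => i _.
  by rewrite lebesgue_measure_itv /=; case: ifP.
by move/fin_numPlt => /andP[].
Qed.

Let phase_box (F : 'rV[R]_n -> R[i]) M c d : measurableC F -> (forall t, n1 (F t) <= M) ->
  integrableC mu (fun t => F t * (\1_(box c d) t)%:C).
Proof. by move=> mF bF; apply: (iCMl (iC_box c d) mF bF). Qed.

Let window_pk (x : 'rV[R]_n) : integralC mu (fun t => (\prod_i pk e (x ord0 i - t ord0 i))%:C * (\1_(box a b) t)%:C)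
  = (\prod_i atan_window e (x ord0 i) i)%:C.
Proof.
pose f i (t : R) := (pk e (x ord0 i - t) * \1_(`]a i, b i]%classic) t)%:C.
have If i : integrableC leb (f i).
  apply: (@iC_le _ _ _ leb (f i) (fun t => 2 / e * \1_(`]a i, b i]%classic) t)).
  - apply: mC_real; apply: measurable_funM; last exact: measurable_indic.
    by apply: measurable_pk => //; apply: measurable_funB.
  - exact: (integrableZl measurableT (2 / e) (integrable_indic_itv (a i) (b i) false false)).
  - move=> t; rewrite n1_real ger0_norm; last first.
      by rewrite mulr_ge0 ?pk_ge0 // indicE.
    by rewrite ler_wpM2r ?pk_le // indicE.
have [_ E] := prod_rV If.
rewrite realC_prod; under [RHS]eq_bigr => i _ do
  rewrite /atan_window -poisson_primitive // -int_real.
rewrite -E; apply: int_eq => t; rewrite indic_box -realC_prod -rmorphM /= -big_split /=.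
by rewrite realC_prod.
Qed.

(** Fubini moves the Poisson kernel from [h] to the indicator function of the
    box, where its integral is explicit. *)
Lemma damped_inversion_box :
  integralC mu (fun t => integralC mu
    (fun v => (dampn e v)%:C * (p v * expi (- (lam * dotR t v)))) * (\1_(box a b) t)%:C) =
  integralC mu (fun x => h x * (\prod_i atan_window e (x ord0 i) i)%:C).
Proof.
pose Psi (z : Cn R n) := (h z.1 * (\1_(box a b) z.2)%:C) *
  (\prod_i pk e (z.1 ord0 i - z.2 ord0 i))%:C.
have mpk : measurableC (fun z : Cn R n => (\prod_i pk e (z.1 ord0 i - z.2 ord0 i))%:C).
  apply: mC_real; apply: measurable_prod => i _; apply: measurable_pk => //.
  by apply: measurable_funB; exact: measurable_coordT.
have bpk (z : Cn R n) : n1 (\prod_i pk e (z.1 ord0 i - z.2 ord0 i))%:C <= (2 / e) ^+ n.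
  rewrite n1_real ger0_norm; last by apply: prodr_ge0 => i _; exact: pk_ge0.
  rewrite -[n in leRHS]card_ord -prodr_const; apply: ler_prod => i _.
  by rewrite pk_ge0 ?pk_le.
have IPsi : integrableC (mu \x mu)%E Psi.
  exact: (iCM (iC_tensor Ih (iC_box a b)) mpk bpk).
transitivity (integralC mu (fun t => integralC mu (fun x => Psi (x, t)))).
  apply: int_eq => t; rewrite damped_inversion -intZr.
    by apply: int_eq => x; rewrite /Psi /=; ring.
  apply: (iCM Ih (mC_pair2 t mpk)) => x; exact: (bpk (x, t)).
rewrite -fubiniC //; apply: int_eq => x.
rewrite -window_pk -intZ; first by apply: int_eq => t; rewrite /Psi /=; ring.
by apply: phase_box; [exact: (mC_pair1 x mpk)|move=> t; exact: (bpk (x, t))].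
Qed.

End fixed_damping.

(** Off the faces of the box the two arctangents tend to plus or minus [pi / 2],
    with the same sign exactly when the coordinate is outside the edge. *)
Let window_cvg (a b : 'I_n -> R) (x : 'rV[R]_n) : (forall i, a i <= b i) ->
  (forall i, x ord0 i != a i /\ x ord0 i != b i) ->
  (fun k => \prod_i atan_window a b k.+1%:R^-1 (x ord0 i) i) @ \oo -->
  (2 * pi / `|lam|) ^+ n * \1_(box a b) x.
Proof.
move=> ab xab.
pose l i := 2 / lam * (Num.sg (lam * (b i - x ord0 i)) * (pi / 2) - Num.sg (lam * (a i - x ord0 i)) * (pi / 2)).
have -> : (2 * pi / `|lam|) ^+ n * \1_(box a b) x = \prod_i l i.
  rewrite indic_box -[n in _ ^+ n]card_ord -prodr_const -big_split /=.
  apply: eq_bigr => i _; rewrite /l !sgrM; have [xa xb] := xab i.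
  have lamE : lam^-1 * Num.sg lam = `|lam|^-1.
    by rewrite -{1}[lam]mulr_sg_norm invfM mulrAC mulVf ?mul1r // sgr_eq0.
  rewrite indicE; have [xi|xi] := boolP (x ord0 i \in `]a i, b i]%classic).
    move: xi; rewrite inE /= in_itv /= => /andP[ax xb'].
    rewrite [Num.sg (b i - _)]gtr0_sg ?subr_gt0 1?lt_neqAle ?xb //.
    rewrite [Num.sg (a i - _)]ltr0_sg ?subr_lt0 //.
    rewrite mulr1 -lamE mulrN1 mulr1 mulNr opprK -mulrDr -splitr; ring.
  rewrite mulr0; have : Num.sg (b i - x ord0 i) = Num.sg (a i - x ord0 i).
    move/negP : xi; rewrite inE /= in_itv /= => /negP; rewrite negb_and -!leNgt -ltNge.
    move=> /orP[xa'|bx].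
      have xa2 : x ord0 i < a i by rewrite lt_neqAle xa.
      by rewrite !gtr0_sg ?subr_gt0 // (lt_le_trans xa2).
    by rewrite !ltr0_sg ?subr_lt0 // (le_lt_trans _ bx).
  by move=> ->; rewrite subrr mulr0.
apply: cvg_prod => i; rewrite /atan_window /l.
apply: cvgM; first exact: cvg_cst.
rewrite (_ : (fun k => _) = (fun k : nat => atan (lam * (b i - x ord0 i) * k.+1%:R)
   - atan (lam * (a i - x ord0 i) * k.+1%:R))); last first.
  by apply/funext => k; rewrite invrK; congr (atan _ - atan _); ring.
by apply: cvgB; exact: cvg_atan_sg.
Qed.

Let window_bound a b e x i : `|atan_window a b e x i| <= 2 / `|lam| * pi.
Proof.
rewrite /atan_window normrM normrM normfV ger0_norm // ler_wpM2l ?divr_ge0 //.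
apply: le_trans (ler_normB _ _) _.
have h (y : R) : `|atan y| <= pi / 2.
  by rewrite ler_norml !ltW ?atan_ltpi2 ?atan_gtNpi2.
have := h (lam / e * (b i - x)); have := h (lam / e * (a i - x)); lra.
Qed.

Let damp_cvg (v : 'rV[R]_n) : (fun k => dampn k.+1%:R^-1 v) @ \oo --> (1 : R).
Proof.
rewrite [X in _ --> X](_ : 1 = \prod_(i < n) (1 : R)); last by rewrite big1.
apply: cvg_prod => i; rewrite /damp.
have : (fun k : nat => - (k.+1%:R^-1 * `|v ord0 i|)) @ \oo --> (0 : R).
  rewrite -oppr0; apply: cvgN; rewrite -(mul0r `|v ord0 i|).
  by apply: cvgM; [exact: cvg_harmonic|exact: cvg_cst].
move=> h; rewrite -[X in _ --> X]expR0.
apply: (@cvg_comp _ _ _ (fun k : nat => - (k.+1%:R^-1 * `|v ord0 i|)) (@expR R) _ _ _ h).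
exact: continuous_expR.
Qed.

(** The two sides have the same integral over every box: this is the limit of
    [damped_inversion_box] as the damping is removed, by dominated convergence
    on either side. *)
Theorem fourier_inversion h p : integrableC mu h -> integrableC mu p ->
  {ae mu, forall v, ft lam h v = p v} ->
  {ae mu, forall x, h x = ((`|lam| / (2 * pi)) ^+ n)%:C *
     integralC mu (fun v => p v * expi (- (lam * dotR x v)))}.
Proof.
move=> Ih Ip hp.
pose Q (t : 'rV[R]_n) := integralC mu (fun v => p v * expi (- (lam * dotR t v))).
pose C := (2 * pi / `|lam|) ^+ n.
have C0 : C != 0 by rewrite expf_neq0 // mulf_neq0 ?invr_eq0 ?normr_eq0 // mulf_neq0 // gt_eqF // pi_gt0.
have QE t : Q t = ft (- lam) p t.
  by apply: int_eq => v; rewrite dotRC mulNr.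
have mQ : measurableC Q.
  by apply: (mC_eq (f := ft (- lam) p)) => [t|]; [rewrite QE|apply: mC_ft; exact: iC_mC Ip].
have bQ t : n1 (Q t) <= 2 * \int[mu]_v n1 (p v) by rewrite QE; exact: ft_bound.
have mph (t : 'rV[R]_n) : measurableC (fun v : 'rV[R]_n => expi (- (lam * dotR t v))).
  apply: mC_expi; apply: measurableT_comp => //.
  apply: measurable_funM; first exact: measurable_cst.
  by apply: measurable_dotR; [exact: measurable_cst|exact: measurable_id].
have Ipph (t : 'rV[R]_n) : integrableC mu (fun v => p v * expi (- (lam * dotR t v))).
  exact: (iCM Ip (mph t) (fun _ => n1_expi _)).
have IQ a b : integrableC mu (fun t => Q t * (\1_(box a b) t)%:C).
  exact: (iCMl (iC_box a b) mQ bQ).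
have IhB a b : integrableC mu (fun t => h t * (\1_(box a b) t)%:C).
  apply: (@iCM _ _ _ _ _ _ 1) => //.
    by apply: mC_real; apply: measurable_indic; exact: measurable_box.
  by move=> t; rewrite n1_real indicE; case: (_ \in _); rewrite ?normr0 ?normr1.
have key a b : (forall i, a i <= b i) ->
    integralC mu (fun t => Q t * (\1_(box a b) t)%:C) =
    integralC mu (fun t => h t * (C * \1_(box a b) t)%:C).
  move=> ab.
  pose Qk (k : nat) t := integralC mu
    (fun v => (dampn k.+1%:R^-1 v)%:C * (p v * expi (- (lam * dotR t v)))).
  have k0 (k : nat) : 0 < k.+1%:R^-1 :> R by rewrite invr_gt0.
  have n1d (k : nat) v : n1 (dampn k.+1%:R^-1 v)%:C <= 1.
    by rewrite n1_real ger0_norm ?dampn_ge0 // dampn_le1 // ltW.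
  have md (k : nat) : measurableC (fun v => (dampn k.+1%:R^-1 v)%:C).
    by apply: mC_real; exact: measurable_dampn.
  have IQk (k : nat) t : integrableC mu
      (fun v => (dampn k.+1%:R^-1 v)%:C * (p v * expi (- (lam * dotR t v)))).
    exact: (iCMl (Ipph t) (md k) (n1d k)).
  have ig2 : mu.-integrable setT (EFin \o (fun v => 2 * n1 (p v))).
    exact: (integrableZl measurableT 2 (iC_n1 Ip)).
  have bnd (k : nat) t v : n1 ((dampn k.+1%:R^-1 v)%:C * (p v * expi (- (lam * dotR t v)))) <= 2 * n1 (p v).
    rewrite n1_realM ger0_norm ?dampn_ge0 //.
    apply: le_trans (ler_piMl (n1_ge0 _) (dampn_le1 _ (ltW (k0 k)))) _.
    apply: le_trans (n1M _ _) _; rewrite mulrC.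
    by apply: ler_wpM2r; [exact: n1_ge0|exact: n1_expi].
  have cQ t : cvgC (fun k => Qk k t) (Q t).
    apply: (dctC (g := fun v => 2 * n1 (p v))) => //.
    - by move=> k; exact: iC_mC (IQk k t).
    - exact: iC_mC (Ipph t).
    - apply: aeW => v; rewrite -[X in cvgC _ X]mul1r.
      by apply: cvgC_mul; [apply: (cvgC_real (damp_cvg v))|exact: cvgC_cst].
  apply: (@cvgC_unique _ (fun k => integralC mu (fun t => Qk k t * (\1_(box a b) t)%:C))).
    have bQk (k : nat) t : n1 (Qk k t) <= 2 * \int[mu]_v n1 (p v).
      apply: le_trans (n1_int (IQk k t)) _.
      rewrite -RintegralZl //; last exact: iC_n1.
      by apply: le_Rintegral => //; exact: iC_n1 (IQk k t).
    have mQk (k : nat) : measurableC (Qk k).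
      apply: (@mC_int1 _ _ _ _ _ mu (fun z => (dampn k.+1%:R^-1 z.2)%:C * (p z.2 * expi (- (lam * dotR z.1 z.2))))).
      apply: mCM; first exact: (mC_comp (md k) measurable_snd).
      apply: mCM; first exact: (mC_comp (iC_mC Ip) measurable_snd).
      apply: mC_expi; apply: measurableT_comp => //.
      apply: measurable_funM; first exact: measurable_cst.
      exact: measurable_dotR.
    apply: (dctC (g := fun t => (2 * \int[mu]_v n1 (p v)) * n1 (\1_(box a b) t : R)%:C)).
    - by move=> k; apply: mCM => //; exact: iC_mC (iC_box a b).
    - exact: iC_mC (IQ a b).
    - by apply: aeW => t; apply: cvgC_mul => //; exact: cvgC_cst.
    - exact: (integrableZl measurableT _ (iC_n1 (iC_box a b))).
    - by move=> k t; apply: le_trans (n1M _ _) _; apply: ler_wpM2r; [exact: n1_ge0|exact: bQk].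
  rewrite (_ : (fun k => _) = fun k : nat =>
      integralC mu (fun x => h x * (\prod_i atan_window a b k.+1%:R^-1 (x ord0 i) i)%:C)); last first.
    by apply/funext => k; apply: damped_inversion_box.
  pose M : R := (2 / `|lam| * pi) ^+ n.
  have bW (k : nat) (x : 'rV[R]_n) : n1 (\prod_i atan_window a b k.+1%:R^-1 (x ord0 i) i)%:C <= M.
    rewrite n1_real normr_prod /M -[n in leRHS]card_ord -prodr_const.
    by apply: ler_prod => i _; rewrite normr_ge0 window_bound.
  have mW (k : nat) : measurableC (fun x : 'rV[R]_n => (\prod_i atan_window a b k.+1%:R^-1 (x ord0 i) i)%:C).
    apply: mC_real; apply: measurable_prod => i _.
    apply: (@measurableT_comp _ _ _ _ _ _ (fun y : R => atan_window a b k.+1%:R^-1 y i)); last first.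
      exact: measurable_coord.
    apply: measurable_funM => //.
    have mat c : measurable_fun setT (fun x : R => atan (lam / k.+1%:R^-1 * (c - x))).
      apply: (@measurableT_comp _ _ _ _ _ _ (@atan R)).
        by apply: continuous_measurable_fun => y; exact: continuous_atan.
      apply: measurable_funM; first exact: measurable_cst.
      by apply: measurable_funB => //; exact: measurable_cst.
    by apply: measurable_funB; exact: mat.
  apply: (dctC (g := fun x => M * n1 (h x))).
  - by move=> k; apply: mCM => //; exact: iC_mC Ih.
  - apply: mCM; first exact: iC_mC Ih.
    apply: mC_real; apply: measurable_funM; first exact: measurable_cst.
    by apply: measurable_indic; exact: measurable_box.
  - have ae1 : {ae mu, forall x : 'rV[R]_n, forall i : 'I_n, x ord0 i != a i /\ x ord0 i != b i}.
      apply: filter_forall => i.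
      have hy (c : R) : {ae mu, forall x : 'rV[R]_n, x ord0 i != c}.
        by apply: filterS (ae_coord i c) => x /eqP.
      by apply: filterS2 (hy (a i)) (hy (b i)) => x.
    apply: filterS ae1 => x xab; apply: cvgC_mul; first exact: cvgC_cst.
    by apply: cvgC_real; exact: window_cvg.
  - exact: (integrableZl measurableT _ (iC_n1 Ih)).
  - move=> k x; apply: le_trans (n1M _ _) _; rewrite mulrC; apply: ler_wpM2r => //.
    exact: n1_ge0.
have main : {ae mu, forall x, h x - (C^-1)%:C * Q x = 0}.
  apply: box_unique => [a b|a b].
    rewrite (_ : (fun x => _) = fun x => h x * (\1_(box a b) x)%:C - (C^-1)%:C * (Q x * (\1_(box a b) x)%:C)).
      by apply: iCB => //; exact: iCZ.
    by apply/funext => x; ring.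
  rewrite (_ : (fun x => _) = fun x => h x * (\1_(box a b) x)%:C - (C^-1)%:C * (Q x * (\1_(box a b) x)%:C)); last first.
    by apply/funext => x; ring.
  rewrite intB //; last exact: iCZ.
  rewrite intZ //.
  have [ab|] := pselect (forall i, a i <= b i); last first.
    move=> /existsNP[i /negP]; rewrite -ltNge => bai.
    have b0 : box a b = set0.
      apply/seteqP; split => // x /(_ i); rewrite /= in_itv /= => /andP[p1 p2].
      by have := lt_le_trans p1 p2; rewrite ltNge ltW.
    have z (F : 'rV[R]_n -> R[i]) : integralC mu (fun x => F x * (\1_(box a b) x)%:C) = 0.
      by rewrite -(int0 mu); apply: int_eq => x; rewrite b0 indic0 mulr0.
    by rewrite !z mulr0 subr0.
  rewrite key // -intZ; last first.
    apply: (iC_eq (f := fun x => C%:C * (h x * (\1_(box a b) x)%:C))); last exact: iCZ.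
    by move=> x; rewrite rmorphM /=; ring.
  rewrite -intB //; last first.
    apply: (iC_eq (f := fun x => h x * (\1_(box a b) x)%:C)) => //.
    by move=> x; rewrite rmorphM /= fmorphV; field; apply/eqP => /complexI/eqP; rewrite (negbTE C0).
  rewrite -[RHS](int0 mu); apply: int_eq => x.
  by rewrite rmorphM /= fmorphV; field; apply/eqP => /complexI/eqP; rewrite (negbTE C0).
apply: filterS main => x /eqP; rewrite subr_eq0 => /eqP ->.
by rewrite /C -exprVn invf_div.
Qed.

End inversion.

Section inversion_line.
Context {R : realType}.
Local Notation leb := (@lebesgue_measure R).

Lemma mpres_coord1 : mpres (lebesgue_rV R 1) leb (fun x => x ord0 ord0).
Proof.
split; first exact: measurable_coord.
move=> A mA.
transitivity (\prod_(i < 1) leb A)%E; last by rewrite big_ord1.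
have box1 := lebesgue_rV_box (A := fun _ : 'I_1 => A) (fun _ => mA).
apply: etrans box1.
have -> // : (fun x : 'rV[R]_1 => x ord0 ord0) @^-1` A = [set x | forall i, A (x ord0 i)].
by apply/seteqP; split => [x Ax i|x /(_ ord0)] //=; rewrite (ord1 i).
Qed.

Lemma mpres_const1 : mpres leb (lebesgue_rV R 1) (fun t => const_mx t).
Proof.
have mc : measurable_fun setT (fun t : R => const_mx t : 'rV[R]_1).
  by apply: measurable_fun_rV => i; under eq_fun do rewrite mxE; exact: measurable_id.
split => // A mA.
rewrite -mpres_coord1.2; last by rewrite -[X in measurable X]setTI; exact: mc.
rewrite -comp_preimage (_ : _ \o _ = id) //; apply/funext => x /=.
by apply/rowP => j; rewrite mxE (ord1 j).
Qed.

(** Inversion on row vectors of length one gives uniqueness of the Fourier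
    transform on the line. *)
Lemma fourier_line_unique (h : R -> R[i]) : integrableC leb h ->
  {ae leb, forall lam, integralC leb (fun t => h t * expi (lam * t)) = 0} ->
  {ae leb, forall t, h t = 0}.
Proof.
move=> Ih h0.
pose h' (x : 'rV[R]_1) := h (x ord0 ord0).
have Ih' : integrableC (lebesgue_rV R 1) h' by exact: (mp_iC mpres_coord1 Ih).
have ft0 : {ae lebesgue_rV R 1, forall v, ft 1 h' v = 0}.
  apply: filterS (mp_ae mpres_coord1 h0) => v; rewrite /ft.
  rewrite (mp_int mpres_coord1); last first.
    apply: mCM; first exact: iC_mC Ih.
    by apply: mC_expi; apply: measurable_funM => //; exact: measurable_cst.
  move=> e; rewrite -[RHS]e; apply: int_eq => x.
  by rewrite /h' /dotR big_ord1 mul1r [X in expi X]mulrC.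
have := fourier_inversion (oner_neq0 R) Ih' (iC0 _) ft0.
move/(mp_ae mpres_const1); apply: filterS => t; rewrite /h' mxE => ->.
rewrite (_ : (fun _ => _) = fun=> 0); last by apply/funext => v; rewrite mul0r.
by rewrite int0 mulr0.
Qed.

End inversion_line.

(** * The operators [fourier f lam] as integral operators *)

Section weyl.
Context {R : realType} {n : nat}.
Local Notation mu := (lebesgue_rV R n).
Local Notation nu := (lebesgue_Cn R n).
Local Notation leb := (@lebesgue_measure R).
Implicit Types (phi psi : 'rV[R]_n -> R[i]) (E D : set 'rV[R]_n).

Definition indC E : 'rV[R]_n -> R[i] := fun x => (\1_E x)%:C.

Lemma n1_indC E x : n1 (indC E x) = \1_E x.
Proof. by rewrite /indC n1_real ger0_norm // indicE. Qed.

Lemma mC_indC E : measurable E -> measurableC (indC E).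
Proof. by move=> mE; apply: mC_real; exact: measurable_indic. Qed.

Lemma L2_sqn phi : L2 phi -> mu.-integrable setT (fun x => (sqn (phi x))%:E).
Proof.
move=> [mphi phioo]; apply/integrableP; split.
  by apply/measurable_EFinP; exact: measurable_sqn.
by under eq_integral do rewrite gee0_abs ?lee_fin ?sqn_ge0 //.
Qed.

Lemma L2_indC E : measurable E -> (mu E < +oo)%E -> L2 (indC E).
Proof.
move=> mE Eoo; split; first exact: mC_indC.
have : (\int[mu]_x (\1_E x : R)%:E < +oo)%E.
  by rewrite (integral_indic mu measurableT mE) setIT.
congr (_ < _)%E; apply: eq_integral => x _.
by rewrite /indC /= expr0n addr0 indicE; case: (_ \in _); rewrite ?expr1n ?expr0n.
Qed.

Lemma iC_L2_mul phi psi : L2 phi -> L2 psi -> integrableC mu (fun x => phi x * psi x).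
Proof.
move=> p q; apply: (@iC_le _ _ _ _ _ (fun x => sqn (phi x) + sqn (psi x))).
- by apply: mCM; [exact: p.1|exact: q.1].
- by under eq_fun do rewrite EFinD; apply: integrableD => //; exact: L2_sqn.
- by move=> x; exact: n1_young.
Qed.

Lemma L2_conj phi : L2 phi -> L2 (fun x => (phi x)^*%R).
Proof.
move=> [mphi phioo]; split; first exact: mC_conj.
by move: phioo; congr (_ < _)%E; apply: eq_integral => x _; rewrite -/(sqn _) -/(sqn _) sqn_conj.
Qed.

Lemma iC_L2_fin phi E : L2 phi -> measurable E -> (mu E < +oo)%E ->
  integrableC mu (fun x => phi x * indC E x).
Proof. by move=> p mE Eoo; apply: iC_L2_mul => //; exact: L2_indC. Qed.

Lemma conj_indC E x : (indC E x)^*%R = indC E x.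
Proof. exact: conj_realC. Qed.

Lemma mpres_haar (m : nat) : mpres (lebesgue_Cn R m \x leb)%E (haar R m) id.
Proof. by split. Qed.

Section fixed_f.
Variables (f : heisenberg R n -> R[i]) (lam : R).
Hypothesis f_L1 : integrableC (haar R n) f.

(** The Fourier transform of [f] in the central variable, through which alone
    [fourier f lam] depends on [f]. *)
Definition central_ft (z : Cn R n) : R[i] :=
  integralC leb (fun t => f (z, t) * expi (lam * t)).

Local Notation F := central_ft.

Let fphase : integrableC (nu \x leb)%E (fun p => f p * expi (lam * p.2)).
Proof.
have f_L1' : integrableC (nu \x leb)%E f by exact: (mp_iC (mpres_haar n) f_L1).
apply: (iCM f_L1' _ (fun _ => n1_expi _)); apply: mC_expi.
by apply: measurable_funM; [exact: measurable_cst|exact: measurable_snd].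
Qed.

Lemma iC_central_ft : integrableC nu F.
Proof. exact: (iC_int1 fphase). Qed.

Let mF := iC_mC iC_central_ft.

(** The action of [(z, 0)] in the Schroedinger representation. *)
Definition rho (z : Cn R n) phi (xi : 'rV[R]_n) : R[i] :=
  expi (lam * (dotR z.1 xi + 2^-1 * dotR z.1 z.2)) * phi (xi + z.2).

Lemma schrodingerE z t phi : schrodinger lam (z, t) phi = fun xi => expi (lam * t) * rho z phi xi.
Proof. by case: z => x y; apply/funext => xi; rewrite /schrodinger /rho /= mulrA. Qed.

(** The formula for [fourier f lam phi] with the weak integral replaced by a
    pointwise one. *)
Definition weyl phi (xi : 'rV[R]_n) : R[i] := integralC nu (fun z => F z * rho z phi xi).

Lemma mC_rho phi : measurableC phi -> measurableC (fun p : Cn R n * 'rV[R]_n => rho p.1 phi p.2).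
Proof.
move=> mphi.
have m1 : measurable_fun setT (fun p : Cn R n * 'rV[R]_n => p.1.1).
  exact: (measurableT_comp measurable_fst measurable_fst).
have m2 : measurable_fun setT (fun p : Cn R n * 'rV[R]_n => p.1.2).
  exact: (measurableT_comp measurable_snd measurable_fst).
apply: mCM.
  apply: mC_expi; apply: measurable_funM; first exact: measurable_cst.
  apply: measurable_funD; first exact: measurable_dotR.
  by apply: measurable_funM; [exact: measurable_cst|exact: measurable_dotR].
by apply: (mC_comp mphi); exact: measurable_rVD.
Qed.

Lemma n1_rho z phi xi : n1 (rho z phi xi) <= 2 * n1 (phi (xi + z.2)).
Proof.
by apply: le_trans (n1M _ _) _; apply: ler_wpM2r; [exact: n1_ge0|exact: n1_expi].
Qed.

Section indicator.
Variable E : set 'rV[R]_n.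
Hypotheses (mE : measurable E) (Eoo : (mu E < +oo)%E).

Lemma iC_shear (g : Cn R n -> R[i]) : integrableC nu g ->
  integrableC (nu \x mu)%E (fun p => g p.1 * indC E (p.2 + p.1.2)).
Proof.
move=> Ig.
have mp : mpres (nu \x mu)%E (nu \x mu)%E (fun p => (p.1, p.2 + p.1.2)).
  apply: (@mpres_fiber2 _ _ _ _ R nu mu (fun z xi => xi + z.2)).
    apply: measurable_rVD => //; exact: (measurableT_comp measurable_snd measurable_fst).
  by move=> z; exact: mpres_shift.
exact: (mp_iC mp (iC_tensor Ig (iC_indic mE Eoo))).
Qed.

Lemma iC_weyl_integrand :
  integrableC (nu \x mu)%E (fun p => F p.1 * rho p.1 (indC E) p.2).
Proof.
have I := iC_shear iC_central_ft.
apply: (iC_eq (f := fun p : Cn R n * 'rV[R]_n => (F p.1 * indC E (p.2 + p.1.2)) *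
  expi (lam * (dotR p.1.1 p.2 + 2^-1 * dotR p.1.1 p.1.2)))).
  by move=> p; rewrite /rho -!mulrA; congr (_ * _); rewrite mulrC.
apply: (iCM I _ (fun _ => n1_expi _)).
apply: (mC_eq (f := fun p : Cn R n * 'rV[R]_n => rho p.1 (fun=> 1) p.2)).
  by move=> p; rewrite /rho mulr1.
by apply: mC_rho; exact: mC_cst.
Qed.

Lemma iC_weyl : integrableC mu (weyl (indC E)).
Proof. exact: (iC_int2 iC_weyl_integrand). Qed.

Lemma weyl_bound xi : n1 (weyl (indC E) xi) <= 2 * \int[nu]_z n1 (F z).
Proof.
have I : integrableC nu (fun z => F z * rho z (indC E) xi).
  apply: (@iCM _ _ _ _ _ _ 2 iC_central_ft).
    exact: (mC_pair2 xi (mC_rho (mC_indC mE))).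
  move=> z; apply: le_trans (n1_rho _ _ _) _.
  by rewrite n1_indC indicE ler_piMr //; case: (_ \in _).
apply: le_trans (n1_int I) _.
rewrite -RintegralZl //; last exact: (iC_n1 iC_central_ft).
apply: le_Rintegral => //; first exact: iC_n1 I.
  exact: (integrableZl measurableT 2 (iC_n1 iC_central_ft)).
move=> z _; apply: le_trans (n1M _ _) _; rewrite mulrC; apply: ler_wpM2r.
  exact: n1_ge0.
apply: le_trans (n1_rho _ _ _) _.
by rewrite n1_indC indicE ler_piMr //; case: (_ \in _).
Qed.

Lemma L2_weyl : L2 (weyl (indC E)).
Proof.
have Iw := iC_weyl; have mw := iC_mC Iw; split => //.
pose B := 2 * \int[nu]_z n1 (F z).
have ib : mu.-integrable setT (EFin \o (fun xi => B * n1 (weyl (indC E) xi))).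
  exact: (integrableZl measurableT B (iC_n1 Iw)).
have ibs : mu.-integrable setT (EFin \o (fun xi => sqn (weyl (indC E) xi))).
  apply: le_integrable ib => //.
    by apply/measurable_EFinP; exact: measurable_sqn.
  move=> xi _; rewrite /= lee_fin ger0_norm ?sqn_ge0 // (le_trans _ (ler_norm _)) //.
  apply: le_trans (sqn_n1 _) _; rewrite expr2; apply: ler_wpM2r; first exact: n1_ge0.
  exact: weyl_bound.
by have /integrableP[_] := ibs; under eq_integral do rewrite gee0_abs ?lee_fin ?sqn_ge0 //.
Qed.

Variable psi : 'rV[R]_n -> R[i].
Hypothesis psi2 : L2 psi.

Let H (p : Cn R n * 'rV[R]_n) := F p.1 * (rho p.1 (indC E) p.2 * (psi p.2)^*).

Let mH : measurableC H.
Proof.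
apply: mCM; first exact: (mC_comp mF measurable_fst).
apply: mCM; first exact: (mC_rho (mC_indC mE)).
by apply: mC_conj; exact: (mC_comp psi2.1 measurable_snd).
Qed.

Let n1_rho_psi z xi : n1 (rho z (indC E) xi * (psi xi)^*) <= 2 * (\1_E (xi + z.2) + sqn (psi xi)).
Proof.
rewrite /rho -mulrA; apply: le_trans (n1M _ _) _.
have e1 := n1_expi (lam * (dotR z.1 xi + 2^-1 * dotR z.1 z.2)).
apply: (@le_trans _ _ (2 * n1 (indC E (xi + z.2) * (psi xi)^*))).
  by apply: ler_wpM2r => //; exact: n1_ge0.
rewrite ler_pM2l //; apply: le_trans (n1_young _ _) _; rewrite sqn_conj lerD2r.
by rewrite /sqn /indC /= expr0n addr0 indicE; case: (_ \in _); rewrite ?expr1n ?expr0n.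
Qed.

Let iC_sqn : integrableC mu (fun xi => (sqn (psi xi))%:C).
Proof. by apply: iC_real; exact: L2_sqn. Qed.

Let IH : integrableC (nu \x mu)%E H.
Proof.
have I1 := iC_shear iC_central_ft.
have I2 := iC_tensor iC_central_ft iC_sqn.
apply: (@iC_le _ _ _ _ _ (fun p : Cn R n * 'rV[R]_n => 2 * (n1 (F p.1 * indC E (p.2 + p.1.2)) + n1 (F p.1 * (sqn (psi p.2))%:C)))) => //.
  exact: (integrableZl measurableT 2 (integrableD measurableT (iC_n1 I1) (iC_n1 I2))).
move=> p; apply: le_trans (n1M _ _) _.
rewrite /indC ![F p.1 * _]mulrC !n1_realM !ger0_norm ?sqn_ge0 ?indicE //.
rewrite -mulrDl mulrA mulrC; apply: ler_wpM2r; first exact: n1_ge0.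
by have := n1_rho_psi p.1 p.2; rewrite indicE.
Qed.

Let iC_rho_psi z : integrableC mu (fun xi => rho z (indC E) xi * (psi xi)^*).
Proof.
apply: (@iC_le _ _ _ mu _ (fun xi : 'rV[R]_n => 2 * (\1_E (xi + z.2) + sqn (psi xi)))).
- apply: mCM; first exact: (mC_pair1 z (mC_rho (mC_indC mE))).
  by apply: mC_conj; exact: psi2.1.
- have [iEz _] := mp_iC (mpres_shift z.2) (iC_indic mE Eoo).
  exact: (integrableZl measurableT 2 (integrableD measurableT iEz (L2_sqn psi2))).
- by move=> xi; exact: n1_rho_psi.
Qed.

Let J z := inner (rho z (indC E)) psi.

Let mJ : measurableC J.
Proof.
apply: (@mC_int1 _ _ _ _ _ mu (fun p : Cn R n * 'rV[R]_n => rho p.1 (indC E) p.2 * (psi p.2)^*)).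
apply: mCM; first exact: (mC_rho (mC_indC mE)).
by apply: mC_conj; exact: (mC_comp psi2.1 measurable_snd).
Qed.

Let bJ : exists M, forall z, n1 (J z) <= M.
Proof.
exists (2 * (\int[mu]_xi \1_E xi + \int[mu]_xi sqn (psi xi))) => z.
apply: le_trans (n1_int (iC_rho_psi z)) _.
have iE := integrable_indic_fin mE Eoo.
have iEz : mu.-integrable setT (fun xi => (\1_E (xi + z.2) : R)%:E).
  by have [] := mp_iC (mpres_shift z.2) (iC_indic mE Eoo).
have -> : \int[mu]_xi \1_E xi = \int[mu]_xi (\1_E (xi + z.2) : R).
  by rewrite /Rintegral (mp_integral (mpres_shift z.2)) //; exact: measurable_int iE.
rewrite -RintegralD //; last exact: L2_sqn.
rewrite -RintegralZl //; last exact: (integrableD measurableT iEz (L2_sqn psi2)).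
apply: le_Rintegral => //; first exact: iC_n1 (iC_rho_psi z).
exact: (integrableZl measurableT 2 (integrableD measurableT iEz (L2_sqn psi2))).
Qed.

Lemma inner_weyl : inner (weyl (indC E)) psi = integralC (haar R n)
  (fun p => f p * inner (schrodinger lam p (indC E)) psi).
Proof.
have [M bJM] := bJ.
transitivity (integralC nu (fun z => F z * J z)).
  transitivity (integralC mu (fun xi => integralC nu (fun z => H (z, xi)))).
    apply: int_eq => xi; rewrite -intZr.
      by apply: int_eq => z; rewrite /H mulrA.
    apply: (@iCM _ _ _ _ _ _ 2 iC_central_ft).
      exact: (mC_pair2 xi (mC_rho (mC_indC mE))).
    move=> z; apply: le_trans (n1_rho _ _ _) _.
    by rewrite n1_indC indicE ler_piMr //; case: (_ \in _).
  rewrite -fubiniC //; apply: int_eq => z.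
  by rewrite /J /inner -intZ.
have mf : measurableC f := iC_mC f_L1.
have I2 : integrableC (nu \x leb)%E (fun p => f p * expi (lam * p.2) * J p.1).
  exact: (iCM fphase (mC_comp mJ measurable_fst) (fun p => bJM p.1)).
transitivity (integralC (nu \x leb)%E (fun p => f p * expi (lam * p.2) * J p.1)); last first.
  have e : (fun p => f p * inner (schrodinger lam p (indC E)) psi) =
      fun p => f p * expi (lam * p.2) * J p.1.
    apply/funext => -[z t]; rewrite schrodingerE -mulrA; congr (_ * _).
    rewrite /J /inner /= -intZ //.
    by apply: int_eq => xi; rewrite mulrA.
  rewrite e; apply/esym; apply: (mp_int (mpres_haar n)).
  exact: (iC_mC I2).
rewrite [RHS](fubiniC1 I2).
apply: (@int_ae _ _ _ nu (fun z => F z * J z)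
  (fun z => integralC leb (fun t => f (z, t) * expi (lam * t) * J z))).
- exact: (mCM mF mJ).
- exact: (iC_mC (iC_int1 I2)).
- apply: filterS (ae_iC1 fphase) => z Iz; rewrite -intZr //.
Qed.

End indicator.

Lemma is_fourier_weyl E : measurable E -> (mu E < +oo)%E ->
  is_fourier f lam (indC E) (weyl (indC E)).
Proof.
by move=> mE Eoo; split; [exact: L2_weyl|move=> psi psi2; exact: inner_weyl].
Qed.

Lemma is_fourier_unique phi g1 g2 : is_fourier f lam phi g1 -> is_fourier f lam phi g2 ->
  {ae mu, forall xi, g1 xi = g2 xi}.
Proof.
move=> [L1 e1] [L2' e2].
have : {ae mu, forall xi, g1 xi - g2 xi = 0}.
  apply: fin_unique => A mA Aoo.
    apply: (iC_eq (f := fun x => g1 x * indC A x - g2 x * indC A x)).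
      by move=> x; rewrite -mulrBl.
    by apply: iCB; exact: iC_L2_fin.
  have Lp := L2_indC mA Aoo.
  transitivity (inner g1 (indC A) - inner g2 (indC A)).
    rewrite /inner -intB.
    - apply: int_eq => x; transitivity ((g1 x - g2 x) * (indC A x)^*).
        by rewrite conj_indC.
      by rewrite mulrBl.
    - by apply: iC_L2_mul => //; exact: L2_conj.
    - by apply: iC_L2_mul => //; exact: L2_conj.
  by rewrite e1 // e2 // subrr.
by apply: filterS => xi /eqP; rewrite subr_eq0 => /eqP.
Qed.

(** On the indicator function of a set of finite measure the pointwise integral
    converges to a bounded integrable function, hence one in [L^2]; by Fubini it
    satisfies the equation that defines the weak integral. *)
Lemma fourier_indC E : measurable E -> (mu E < +oo)%E ->
  {ae mu, forall xi, fourier f lam (indC E) xi = weyl (indC E) xi}.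
Proof.
move=> mE Eoo; apply: (@is_fourier_unique (indC E)); last exact: is_fourier_weyl.
rewrite /fourier; case: xgetP => [g -> //|/(_ (weyl (indC E)))].
by move=> /(_ (is_fourier_weyl mE Eoo)).
Qed.

End fixed_f.

End weyl.

Section kernel.
Context {R : realType} {n : nat}.
Local Notation mu := (lebesgue_rV R n).
Local Notation nu := (lebesgue_Cn R n).
Local Notation mm := (lebesgue_rV R n \x lebesgue_rV R n)%E.
Implicit Types (E D : set 'rV[R]_n).

Variables (F : Cn R n -> R[i]) (lam : R).
Hypothesis IF : integrableC nu F.

Let IF' : integrableC mm F := IF.
Let mF := iC_mC IF.

(** The partial Fourier transform of [F] in its first variable. *)
Definition pft (z : Cn R n) : R[i] := ft lam (fun x => F (x, z.2)) z.1.

(** The integral kernel of the operator [weyl], as [weyl_kern] shows: up to the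
    change of variables [wigner_map] it is a partial Fourier transform. *)
Definition kern (z : Cn R n) : R[i] := pft (2^-1 *: (z.1 + z.2), z.2 - z.1).

Lemma kern_wigner z : kern (wigner_map z) = pft z.
Proof.
case: z => v y; rewrite /kern /wigner_map /=; congr (pft (_, _)).
  by apply/rowP => i; rewrite !mxE; lra.
by apply/rowP => i; rewrite !mxE; lra.
Qed.

Lemma mC_pft : measurableC pft.
Proof.
apply: (@mC_int1 _ _ _ _ _ mu (fun p : Cn R n * 'rV[R]_n => F (p.2, p.1.2) * expi (lam * dotR p.2 p.1.1))).
have m1 : measurable_fun setT (fun p : Cn R n * 'rV[R]_n => p.1.1).
  exact: (measurableT_comp measurable_fst measurable_fst).
have m2 : measurable_fun setT (fun p : Cn R n * 'rV[R]_n => p.1.2).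
  exact: (measurableT_comp measurable_snd measurable_fst).
apply: mCM; last exact: mC_phase.
by apply: (mC_comp mF); exact: measurable_fun_pair.
Qed.

Lemma mC_kern : measurableC kern.
Proof.
apply: (mC_comp mC_pft); apply: measurable_fun_pair.
  by apply: measurable_rVZ; exact: measurable_rVD.
exact: measurable_rVB.
Qed.

(** Stated for extended reals so that it can be integrated over all sections,
    integrable or not. *)
Lemma n1_ft_ereal (h : 'rV[R]_n -> R[i]) v : measurableC h ->
  ((n1 (ft lam h v))%:E <= 2%:E * \int[mu]_x (n1 (h x))%:E)%E.
Proof.
move=> mh; have [hoo|] := boolP (\int[mu]_x (n1 (h x))%:E < +oo)%E.
  have Ih : integrableC mu h by apply/(iCP _ mh).
  rewrite -[X in (_ <= _ * X)%E]fineK; last exact: (integrable_fin_num measurableT (iC_n1 Ih)).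
  by rewrite -EFinM lee_fin; exact: ft_bound.
by rewrite -leNgt leye_eq => /eqP ->; rewrite gt0_muley ?lte_fin // leey.
Qed.

Lemma rho_phase (x y xi : 'rV[R]_n) : lam * (dotR x xi + 2^-1 * dotR x y) = lam * dotR x (2^-1 *: (xi + (xi + y))).
Proof. by rewrite !dotE; field. Qed.

Lemma pft_rho E xi : measurable E -> (mu E < +oo)%E ->
  integralC nu (fun z => F z * rho lam z (indC E) xi) =
  integralC mu (fun y => pft (2^-1 *: (xi + (xi + y)), y) * indC E (xi + y)).
Proof.
move=> mE Eoo.
have I : integrableC mm (fun z => F z * rho lam z (indC E) xi).
  apply: (@iCM _ _ _ _ _ _ 2 IF').
    exact: (mC_pair2 xi (mC_rho lam (mC_indC mE))).
  move=> z; apply: le_trans (n1_rho _ _ _ _) _.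
  by rewrite n1_indC indicE ler_piMr //; case: (_ \in _).
rewrite [LHS](fubiniC2 I); apply: int_eq => y.
rewrite /pft /ft /rho /indC indicE /=; case: (_ \in _); last first.
  rewrite mulr0 -(int0 mu); apply: int_eq => x; by rewrite !mulr0.
rewrite mulr1; apply: int_eq => x; by rewrite mulr1 rho_phase.
Qed.

Lemma weyl_kern E xi : measurable E -> (mu E < +oo)%E ->
  integralC nu (fun z => F z * rho lam z (indC E) xi) =
  integralC mu (fun eta => kern (xi, eta) * indC E eta).
Proof.
move=> mE Eoo; rewrite pft_rho // [RHS](mp_int (mpres_shift xi)); last first.
  by apply: mCM; [exact: (mC_pair1 xi mC_kern)|exact: mC_indC].
apply: int_eq => y; rewrite /kern /= [y + xi]addrC; congr (pft (_, _) * _).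
by rewrite addrAC subrr add0r.
Qed.

(** At a fixed [xi] the integral of [n1 (kern (xi, eta))] over [eta] is at most
    twice the integral of [n1 F], so that a bound on [D] suffices. *)
Lemma iC_kern D E : measurable D -> measurable E -> (mu D < +oo)%E -> (mu E < +oo)%E ->
  integrableC mm (fun z => kern z * (\1_(D `*` E) z)%:C).
Proof.
move=> mD mE Doo Eoo.
have mDE : measurableC (fun z : Cn R n => kern z * (\1_(D `*` E) z)%:C).
  by apply: mCM; [exact: mC_kern|apply: mC_real; apply: measurable_indic; exact: measurableX].
apply/(iC_tonelli1 _ _ mDE).
pose N := (\int[mm]_z (n1 (F z))%:E)%E.
have Noo : (N < +oo)%E by exact: ((iCP _ mF).1 IF').
have N0 : (0 <= N)%E by apply: integral_ge0 => z _; rewrite lee_fin n1_ge0.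
have mnF : measurable_fun setT (fun z : Cn R n => (n1 (F z))%:E).
  by apply/measurable_EFinP; exact: measurable_n1.
have mg : measurable_fun setT (fun y => \int[mu]_x (n1 (F (x, y)))%:E)%E.
  apply: (@measurable_fun_fubini_tonelli_G _ _ _ _ _ mu (fun z : Cn R n => (n1 (F z))%:E)) => //.
  by move=> z; rewrite lee_fin n1_ge0.
have inner_bound xi : (\int[mu]_eta (n1 (kern (xi, eta) * (\1_(D `*` E) (xi, eta))%:C))%:E
    <= (\1_D xi)%:E * (2%:E * N))%E.
  rewrite indicE; have [xiD|xiD] := boolP (xi \in D); last first.
    rewrite mul0e integral0_eq // => eta _; rewrite indicE in_setX (negbTE xiD) /=.
    by rewrite mulr0 n1_0.
  rewrite mul1e /N fubini_tonelli2 //; last by move=> z; rewrite lee_fin n1_ge0.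
  rewrite -[X in (_ <= X)%E]ge0_integralZl //; last first.
    by move=> y _; apply: integral_ge0 => x _; rewrite lee_fin n1_ge0.
  rewrite [X in (_ <= X)%E](mp_ge0 (mpres_shift (- xi))).
  - apply: ge0_le_integral => //.
    + by move=> eta _; rewrite lee_fin n1_ge0.
    + apply/measurable_EFinP; apply: measurable_n1; exact: (mC_pair1 xi mDE).
    + apply: emeasurable_funM; first exact: measurable_cst.
      exact: (measurableT_comp mg (mpres_shift (- xi)).1).
    + move=> eta _; apply: le_trans (n1_ft_ereal (2^-1 *: (xi + eta)) _).
        rewrite lee_fin; apply: le_trans (n1M _ _) _; rewrite ler_piMr ?n1_ge0 //.
        by rewrite n1_real indicE; case: (_ \in _); rewrite ?normr0 ?normr1.
      by apply: (mC_pair2 (eta - xi)); exact: mF.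
  - by apply: emeasurable_funM => //; exact: measurable_cst.
  - move=> y; rewrite mule_ge0 //; apply: integral_ge0 => x _; by rewrite lee_fin n1_ge0.
apply: (@le_lt_trans _ _ (\int[mu]_xi ((\1_D xi)%:E * (2%:E * N)))%E).
  apply: ge0_le_integral => //.
  - by move=> xi _; apply: integral_ge0 => eta _; rewrite lee_fin n1_ge0.
  - apply: (@measurable_fun_fubini_tonelli_F _ _ _ _ _ mu (fun z : Cn R n => (n1 (kern z * (\1_(D `*` E) z)%:C))%:E)) => //.
      by apply/measurable_EFinP; exact: measurable_n1.
    by move=> z; rewrite lee_fin n1_ge0.
  - apply: emeasurable_funM; last exact: measurable_cst.
    by apply/measurable_EFinP; exact: measurable_indic.
rewrite ge0_integralZr //; last 2 first.
- by apply/measurable_EFinP; exact: measurable_indic.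
- by rewrite mule_ge0.
rewrite (integral_indic mu measurableT mD) setIT.
apply: lte_mul_pinfty => //; first by rewrite ge0_fin_numE.
by apply: lte_mul_pinfty.
Qed.

Lemma int_kern D E : measurable D -> measurable E -> (mu D < +oo)%E -> (mu E < +oo)%E ->
  integralC mm (fun z => kern z * (\1_(D `*` E) z)%:C) =
  integralC mu (fun xi => indC D xi * integralC nu (fun z => F z * rho lam z (indC E) xi)).
Proof.
move=> mD mE Doo Eoo; rewrite fubiniC1; last exact: iC_kern.
apply: int_eq => xi; rewrite weyl_kern //.
rewrite /indC indicE; have [xiD|xiD] := boolP (xi \in D); last first.
  rewrite mul0r -(int0 mu); apply: int_eq => eta.
  by rewrite indicE in_setX (negbTE xiD) mulr0.
rewrite mul1r; apply: int_eq => eta; congr (_ * _).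
by rewrite !indicE in_setX xiD.
Qed.

End kernel.

Section rank_one_kernel.
Context {R : realType} {n : nat}.
Local Notation mu := (lebesgue_rV R n).
Local Notation nu := (lebesgue_Cn R n).
Local Notation mm := (lebesgue_rV R n \x lebesgue_rV R n)%E.

(** A rank one operator has the kernel [psi2 xi * (psi1 eta)^*]; [kern] has the
    same integrals over rectangles, as these are tested by applying the operator
    to indicator functions. *)
Lemma rank_one_pft (f : heisenberg R n -> R[i]) (lam : R) :
  integrableC (haar R n) f -> rank_one (fourier f lam) ->
  exists a b, [/\ L2 a, L2 b &
   {ae nu, forall z, pft (central_ft f lam) lam z =
      a (z.1 - 2^-1 *: z.2) * b (z.1 + 2^-1 *: z.2)}].
Proof.
move=> If [psi1 [psi2 [L1 L2' Tpsi]]].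
have IF := iC_central_ft lam If.
exists psi2, (fun x => (psi1 x)^*%R); split => //; first exact: L2_conj.
pose K := kern (central_ft f lam) lam.
pose P (z : Cn R n) := psi2 z.1 * (psi1 z.2)^*%R.
have mP : measurableC P.
  apply: mCM; first exact: (mC_comp L2'.1 measurable_fst).
  by apply: mC_conj; exact: (mC_comp L1.1 measurable_snd).
have tensorE D E z : P z * (\1_(D `*` E) z)%:C = psi2 z.1 * indC D z.1 * ((psi1 z.2)^*%R * indC E z.2).
  rewrite /P /indC !indicE in_setX.
  by case: (_ \in _); case: (_ \in _); rewrite /= ?mulr0 ?mulr1 ?mul0r ?mulr0.
have IP D E : measurable D -> measurable E -> (mu D < +oo)%E -> (mu E < +oo)%E ->
   integrableC mm (fun z => P z * (\1_(D `*` E) z)%:C).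
  move=> mD mE Doo Eoo.
  apply: (iC_eq (f := fun z : Cn R n => psi2 z.1 * indC D z.1 * ((psi1 z.2)^*%R * indC E z.2))).
    by move=> z; rewrite tensorE.
  apply: (@iC_tensor _ _ _ _ _ mu mu (fun x => psi2 x * indC D x) (fun x => (psi1 x)^*%R * indC E x)).
    exact: iC_L2_fin.
  by apply: iC_L2_fin => //; exact: L2_conj.
have : {ae mm, forall z, K z - P z = 0}.
  apply: rect_unique => D E mD mE Doo Eoo.
    apply: (iC_eq (f := fun z => K z * (\1_(D `*` E) z)%:C - P z * (\1_(D `*` E) z)%:C)).
      by move=> z; rewrite -mulrBl.
    by apply: iCB; [exact: iC_kern|exact: IP].
  transitivity (integralC mm (fun z => K z * (\1_(D `*` E) z)%:C) -
     integralC mm (fun z => P z * (\1_(D `*` E) z)%:C)).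
    rewrite -intB; [|exact: iC_kern|exact: IP].
    by apply: int_eq => z; rewrite -mulrBl.
  apply/eqP; rewrite subr_eq0; apply/eqP.
  rewrite int_kern //.
  have -> : (fun z => P z * (\1_(D `*` E) z)%:C) = fun z : Cn R n => psi2 z.1 * indC D z.1 * ((psi1 z.2)^*%R * indC E z.2).
    by apply/funext => z; rewrite tensorE.
  have LE := L2_indC mE Eoo; have LD := L2_indC mD Doo.
  rewrite (@int_tensor _ _ _ _ _ mu mu (fun x => psi2 x * indC D x) (fun x => (psi1 x)^*%R * indC E x)); last 2 first.
  - exact: iC_L2_fin.
  - by apply: iC_L2_fin => //; exact: L2_conj.
  have -> : integralC mu (fun x => (psi1 x)^*%R * indC E x) = inner (indC E) psi1.
    by apply: int_eq => x; rewrite mulrC.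
  rewrite -intZr; last exact: iC_L2_fin.
  apply: int_ae.
  - apply: mCM; first exact: mC_indC.
    exact: (iC_mC (iC_weyl lam If mE Eoo)).
  - apply: mCM; last exact: mC_cst.
    by apply: mCM; [exact: L2'.1|exact: mC_indC].
  - apply: filterS2 (Tpsi _ LE) (fourier_indC lam If mE Eoo) => xi e1 e2.
    rewrite -/(weyl f lam (indC E) xi) -e2 e1; ring.
move/(mp_ae (mpres_wigner n)); apply: filterS => z /eqP.
by rewrite /K kern_wigner subr_eq0 => /eqP ->.
Qed.

End rank_one_kernel.

(** * Compact support and finite rank *)

Section newton.
Context {R : realType} {n : nat}.
Local Notation mu := (lebesgue_rV R n).

Lemma n1_expiB1 (t : R) : n1 (expi t - 1) <= 2 * `|t|.
Proof.
have -> : n1 (expi t - 1) = `|cos `|t| - cos 0| + `|sin `|t| - sin 0|.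
  rewrite /n1 /= subr0 cos0 sin0 subr0.
  by case: (ger0P t) => _; rewrite ?cosN ?sinN ?normrN.
rewrite mulr2n mulrDl mul1r; apply: lerD.
  have cc : {within `[0, `|t|], continuous (@cos R)}.
    by apply: continuous_subspaceT; exact: continuous_cos.
  have [c _ ->] := MVT_segment (normr_ge0 t) (fun x _ => is_derive_cos x) cc.
  by rewrite subr0 normrM normr_id ler_piMl // normrN sin_max.
have cs : {within `[0, `|t|], continuous (@sin R)}.
  by apply: continuous_subspaceT; exact: continuous_sin.
have [c _ ->] := MVT_segment (normr_ge0 t) (fun x _ => is_derive_sin x) cs.
by rewrite subr0 normrM normr_id ler_piMl // cos_max.
Qed.

Lemma n1X_le (z : R[i]) a k : n1 z <= a -> n1 (z ^+ k) <= a ^+ k.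
Proof.
move=> za; elim: k => [|k IH]; first by rewrite !expr0 /n1 /= normr1 normr0 addr0.
rewrite !exprS; apply: le_trans (n1M _ _) _.
by apply: ler_pM => //; exact: n1_ge0.
Qed.

Lemma ffact_le_expn (m k : nat) : (m ^_ k <= m ^ k)%N.
Proof.
elim: k => // k IH; rewrite ffactnSr expnSr.
exact: (leq_mul IH (leq_subr k m)).
Qed.

(** The restriction of the sum, rather than a shift of its index, matches the way
    Newton's formula loses its first terms in [newton_zero]. *)
Lemma exp_tail (a e : R) : 0 <= a -> 0 < e -> exists K : nat, forall m : nat,
  \sum_(i < m | (K <= i)%N) a ^+ i / i`!%:R <= e.
Proof.
move=> a0 e0; pose S := series (exp_coeff a).
have cS : S @ \oo --> expR a by exact: is_cvg_series_exp_coeff.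
have ndS : nondecreasing_seq S.
  apply/nondecreasing_seqP => k; rewrite /S /series /= big_nat_recr //= lerDl.
  by rewrite exp_coeff_ge0.
have leS k : S k <= expR a.
  by rewrite -(cvg_lim (@Rhausdorff R) cS); apply: nondecreasing_cvgn_le => //; apply/cvg_ex; exists (expR a).
have /cvgrPdist_le/(_ _ e0)[K _ /(_ K (leqnn K))] := cS.
rewrite ger0_norm ?subr_ge0 // => hK.
exists K => m; apply: le_trans hK; have [mK|Km] := leqP m K.
  rewrite big1 ?subr_ge0 // => i Ki; have := leq_trans (ltn_ord i) mK.
  by rewrite ltnNge Ki.
have : S m <= expR a by [].
rewrite /S /series /= (big_cat_nat (n := K)) ?(ltnW Km) //= => h.
rewrite lerBrDr; apply: le_trans h; rewrite [leLHS]addrC lerD2l.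
rewrite -(big_mkord (fun i => (K <= i)%N) (fun i => a ^+ i / i`!%:R)).
rewrite (big_cat_nat (n := K)) ?(ltnW Km) //= big_nat_cond big1 ?add0r; last first.
  by move=> i /andP[/andP[_ iK]]; rewrite leqNgt iK.
rewrite big_nat_cond [leRHS]big_nat_cond le_eqVlt; apply/orP; left; apply/eqP.
by apply: eq_bigl => i; case: (K <= i)%N; case: (i < m)%N.
Qed.

(** The transform of a function supported in a slab is entire of exponential type
    along the normal of the slab, so that it vanishes at [v] if it vanishes on an
    interval of the line through [v]; here only on the points [s0 - k (s0 / m)]
    with [k |s0 / m| <= r], which allows almost everywhere hypotheses. The forward
    differences at [s0] with step [d = - (s0 / m)] are bounded by powers of
    [|d| M], and those of small order vanish by hypothesis; Newton's formula at
    [s0 + m d = 0] is then bounded by the tail of an exponential series. *)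
Lemma newton_zero (lam M r s0 : R) (i0 : 'I_n) (v : 'rV[R]_n) (h : 'rV[R]_n -> R[i]) :
  integrableC mu h -> (forall x : 'rV[R]_n, M < `|x ord0 i0| -> h x = 0) -> 0 < r ->
  (forall m k : nat, (0 < m)%N -> k%:R * `|s0| <= r * m%:R ->
     ft lam h (v + (s0 - k%:R * (s0 / m%:R)) *: delta_mx ord0 i0) = 0) ->
  ft lam h v = 0.
Proof.
move=> Ih hM r0 gz; have M0 : 0 <= Num.max M 0 by rewrite le_max lexx orbT.
pose M' := Num.max M 0.
pose g s := ft lam h (v + s *: delta_mx ord0 i0).
have dot_e (x : 'rV[R]_n) : dotR x (delta_mx ord0 i0) = x ord0 i0.
  rewrite /dotR (bigD1 i0) //= mxE !eqxx mulr1 big1 ?addr0 // => j ji.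
  by rewrite mxE (negbTE ji) andbF mulr0.
pose N := \int[mu]_x n1 (h x).
have N0 : 0 <= N by apply: Rintegral_ge0 => x _; exact: n1_ge0.
pose a := 2 * `|lam| * M' * `|s0|.
have a0 : 0 <= a by rewrite !mulr_ge0.
suff main e : 0 < e -> n1 (ft lam h v) <= 2 * N * e.
  apply: n1_eq0; apply/eqP; rewrite eq_le n1_ge0 andbT.
  apply/ler_addgt0Pr => e e0; rewrite add0r.
  apply: le_trans (main (e / (2 * N + 1)) _) _; first by rewrite divr_gt0 // ltr_wpDl // mulr_ge0.
  rewrite mulrA ler_pdivrMr; last by rewrite ltr_wpDl // mulr_ge0.
  by rewrite mulrC ler_wpM2l ?(ltW e0) // lerDl.
move=> e0; have [K hK] := exp_tail a0 e0.
have [m m0 mK] : exists2 m : nat, (0 < m)%N & K%:R * `|s0| <= r * m%:R.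
  exists (Num.truncn (K%:R * `|s0| / r)).+1 => //.
  by rewrite [leRHS]mulrC -ler_pdivrMr //; apply/ltW; exact: truncnS_gt.
pose d := - (s0 / m%:R).
pose H x := h x * expi (lam * dotR x (v + s0 *: delta_mx ord0 i0)).
pose w (x : 'rV[R]_n) := expi (lam * (d * x ord0 i0)).
have IH : integrableC mu H by exact: iC_phase.
have mw : measurableC w.
  apply: mC_expi; apply: measurable_funM; first exact: measurable_cst.
  by apply: measurable_funM; [exact: measurable_cst|exact: measurable_coord].
have wX x j : w x ^+ j = expi (j%:R * (lam * (d * x ord0 i0))).
  elim: j => [|j IHj]; first by rewrite expr0 mul0r expi0.
  by rewrite exprS IHj -expiD -[j.+1]addn1 natrD mulrDl mul1r addrC.
have HwX x j : H x * w x ^+ j = h x * expi (lam * dotR x (v + (s0 + j%:R * d) *: delta_mx ord0 i0)).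
  rewrite /H wX -mulrA -expiD; congr (_ * expi _).
  by rewrite !dotE dot_e; ring.
have IHw j : integrableC mu (fun x => H x * w x ^+ j).
  under eq_fun do rewrite HwX; exact: iC_phase.
have intHw j : integralC mu (fun x => H x * w x ^+ j) = g (s0 + j%:R * d).
  by rewrite /g /ft; apply: int_eq => x; rewrite HwX.
pose D k := integralC mu (fun x => H x * (w x - 1) ^+ k).
have mw1 k : measurableC (fun x => (w x - 1) ^+ k).
  elim: k => [|k IHk]; first by under [X in measurableC X]eq_fun do rewrite expr0; exact: mC_cst.
  under [X in measurableC X]eq_fun do rewrite exprS.
  by apply: mCM => //; apply: mCB => //; exact: mC_cst.
have bD_pt k x : n1 (H x * (w x - 1) ^+ k) <= 2 * (2 * (`|lam| * (`|d| * M'))) ^+ k * n1 (h x).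
  have [xM|xM] := leP `|x ord0 i0| M; last first.
    by rewrite /H hM // !mul0r n1_0 mulr0.
  apply: le_trans (n1M _ _) _; rewrite [X in _ <= X * _]mulrC -mulrA mulrC.
  apply: ler_pM; rewrite ?n1_ge0 //.
    apply: n1X_le; apply: le_trans (n1_expiB1 _) _; rewrite !normrM.
    do 3 (apply: ler_wpM2l => //); by rewrite le_max xM.
  by apply: le_trans (n1M _ _) _; rewrite mulrC; apply: ler_wpM2r; [exact: n1_ge0|exact: n1_expi].
have ID k : integrableC mu (fun x => H x * (w x - 1) ^+ k).
  apply: (iC_le _ (integrableZl measurableT (2 * (2 * (`|lam| * (`|d| * M'))) ^+ k) (iC_n1 Ih))) => //.
  by apply: mCM; [exact: iC_mC IH|exact: mw1].
have bD k : n1 (D k) <= 2 * N * (2 * (`|lam| * (`|d| * M'))) ^+ k.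
  apply: le_trans (n1_int (ID k)) _.
  rewrite mulrAC -RintegralZl //; last exact: iC_n1 Ih.
  apply: le_Rintegral => //; first exact: iC_n1 (ID k).
  exact: (integrableZl measurableT (2 * (2 * (`|lam| * (`|d| * M'))) ^+ k) (iC_n1 Ih)).
have D0 k : (k < K)%N -> D k = 0.
  move=> kK; rewrite /D.
  rewrite (_ : (fun x => _) = fun x => \sum_(j < k.+1)
     ((-1) ^+ j *+ 'C(k, j)) * (H x * w x ^+ (k - j))); last first.
    apply/funext => x; rewrite exprBn mulr_sumr; apply: eq_bigr => j _.
    rewrite expr1n mulr1 !mulrnAr !mulrnAl; congr (_ *+ _); ring.
  rewrite int_sum => [|j]; last exact: iCZ.
  apply: big1 => j _; rewrite intZ // intHw /d mulrN /g gz ?mulr0 //.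
  apply: le_trans mK; apply: ler_wpM2r => //.
  by rewrite ler_nat (leq_trans (leq_subr _ _)) // ltnW.
have -> : ft lam h v = \sum_(k < m.+1) 'C(m, k)%:R * D k.
  transitivity (g (s0 + m%:R * d)).
    rewrite /g /d mulrN mulrCA divff ?mulr1 ?subrr ?scale0r ?addr0 //.
    by rewrite pnatr_eq0 -lt0n.
  rewrite -intHw.
  transitivity (\sum_(k < m.+1) integralC mu (fun x => 'C(m, k)%:R * (H x * (w x - 1) ^+ k))).
    rewrite -int_sum; last by move=> k; exact: iCZ.
    apply: int_eq => x; rewrite -{1}[w x](subrK 1) exprD1n mulr_sumr.
    by apply: eq_bigr => k _; rewrite mulr_natl mulrnAr.
  by apply: eq_bigr => k _; rewrite intZ.
apply: le_trans (n1_sum _ _) _.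
apply: (@le_trans _ _ (\sum_(k < m.+1 | (K <= k)%N) (2 * N * (a ^+ k / k`!%:R)))); last first.
  by rewrite -mulr_sumr; apply: ler_wpM2l; [rewrite mulr_ge0|exact: hK].
rewrite [leRHS]big_mkcond; apply: ler_sum => k _; case: leqP => kK; last first.
  by rewrite D0 // mulr0 n1_0.
apply: le_trans (n1M _ _) _.
have -> : n1 ('C(m, k)%:R : R[i]) = 'C(m, k)%:R.
  by rewrite -(rmorph_nat (real_complex R)) n1_real normr_nat.
apply: le_trans (ler_wpM2l (ler0n _ _) (bD k)) _.
rewrite mulrCA; apply: ler_wpM2l; first by rewrite mulr_ge0.
rewrite ler_pdivlMr ?ltr0n ?fact_gt0 // mulrAC -natrM bin_ffact.
have -> : a = m%:R * (2 * (`|lam| * (`|d| * M'))).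
  rewrite /a /d normrN normrM normfV normr_nat; field.
  by rewrite pnatr_eq0 -lt0n.
rewrite [leRHS]exprMn; apply: ler_wpM2r; first by rewrite exprn_ge0 // !mulr_ge0.
by rewrite -natrX ler_nat ffact_le_expn.
Qed.

End newton.

Section finite_rank_case.
Context {R : realType} {n : nat}.
Local Notation mu := (lebesgue_rV R n).
Local Notation nu := (lebesgue_Cn R n).
Local Notation mm := (lebesgue_rV R n \x lebesgue_rV R n)%E.
Local Notation leb := (@lebesgue_measure R).

Lemma compact_coord_bound (B : set (Cn R n)) (i : 'I_n) : compact B ->
  exists2 M : R, 0 < M & forall z, B z -> `|z.1 ord0 i| <= M /\ `|z.2 ord0 i| <= M.
Proof.
move=> cB.
have bnd (g : Cn R n -> R) : continuous g -> exists2 M : R, 0 < M & forall z, B z -> `|g z| <= M.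
  move=> cg.
  have /compact_bounded[M [_ hM]] : compact (g @` B).
    by apply: continuous_compact => //; exact: continuous_subspaceT.
  exists (Num.max M 0 + 1); first by rewrite ltr_wpDl // le_max lexx orbT.
  move=> z Bz; apply: (hM (Num.max M 0 + 1)); last by exists z.
  by rewrite ltr_pwDr // le_max lexx.
have [M1 M10 h1] : exists2 M : R, 0 < M & forall z, B z -> `|z.1 ord0 i| <= M.
  apply: (bnd (fun z => z.1 ord0 i)) => z.
  apply: (@cvg_comp _ _ _ (@fst 'rV[R]_n 'rV[R]_n) (fun x : 'rV[R]_n => x ord0 i) (nbhs z) (nbhs z.1)).
    exact: cvg_fst.
  exact: coord_continuous.
have [M2 M20 h2] : exists2 M : R, 0 < M & forall z, B z -> `|z.2 ord0 i| <= M.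
  apply: (bnd (fun z => z.2 ord0 i)) => z.
  apply: (@cvg_comp _ _ _ (@snd 'rV[R]_n 'rV[R]_n) (fun x : 'rV[R]_n => x ord0 i) (nbhs z) (nbhs z.2)).
    exact: cvg_snd.
  exact: coord_continuous.
exists (Num.max M1 M2); first by rewrite lt_max M10.
by move=> z Bz; rewrite !le_max h1 // h2 // orbT.
Qed.

Lemma central_ft_supp (f : heisenberg R n -> R[i]) (lam : R) (B : set (Cn R n)) :
  integrableC (haar R n) f -> supported_on f (B `*` [set: R]) ->
  {ae nu, forall z, ~ B z -> central_ft f lam z = 0}.
Proof.
move=> If fB; have mf := iC_mC If.
have fB' : {ae (nu \x leb)%E, forall p, ~ (B `*` [set: R]) p -> f p = 0}.
  exact: (mp_ae (mpres_haar n) fB).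
apply: filterS (ae_sections1 fB') => z hz Bz; rewrite /central_ft -(int0 leb).
apply: int_ae.
- apply: mCM; first exact: (mC_pair1 z mf).
  by apply: mC_expi; apply: measurable_funM => //; exact: measurable_cst.
- exact: mC_cst.
- by apply: filterS hz => t /= ->; [rewrite mul0r|move=> []].
Qed.

(** [N + 1] elements of a space of dimension [N] satisfy a nontrivial linear
    relation; if their supports are disjoint, an element that occurs in it with a
    nonzero coefficient has to vanish. *)
Lemma disjoint_supports_dependent (N : nat) (b : 'I_N -> 'rV[R]_n -> R[i])
  (g : 'I_N.+1 -> 'rV[R]_n -> R[i]) (P : 'I_N.+1 -> set 'rV[R]_n) :
  (forall i, exists c : 'I_N -> R[i], {ae mu, forall xi, g i xi = \sum_k c k * b k xi}) ->
  (forall i xi, ~ P i xi -> g i xi = 0) ->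
  (forall i j xi, P i xi -> P j xi -> i = j) ->
  exists i, {ae mu, forall xi, g i xi = 0}.
Proof.
move=> /choice[c hc] gP Pdisj.
pose A : 'M[R[i]]_(N.+1, N) := \matrix_(i, k) c i k.
have kA : kermx A != 0.
  rewrite kermx_eq0 /row_free; apply/negP => /eqP rA.
  by have := rank_leq_col A; rewrite rA ltnn.
have /rowV0Pn[w /sub_kermxP wA w0] := kA.
have [j wj] : exists j, w ord0 j != 0.
  apply: contrapT => /forallNP no; move/eqP : w0; apply; apply/rowP => j.
  by rewrite mxE; apply/eqP; have /negP := no j; rewrite negbK.
exists j; have hcA : {ae mu, forall xi i, g i xi = \sum_k c i k * b k xi}.
  by apply: filter_forall => i; exact: hc.
apply: filterS hcA => xi e; have [Pj|/gP //] := pselect (P j xi).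
have : \sum_i w ord0 i * g i xi = 0.
  under eq_bigr do rewrite e mulr_sumr.
  rewrite exchange_big /= big1 // => k _.
  have := congr1 (fun M : 'rV[R[i]]_N => M ord0 k * b k xi) wA; rewrite !mxE mul0r => e0.
  rewrite -[RHS]e0 mulr_suml; by apply: eq_bigr => i _; rewrite mxE mulrA.
rewrite (bigD1 j) //= big1 ?addr0.
  by move/eqP; rewrite mulf_eq0 (negbTE wj) /= => /eqP.
move=> i ij; rewrite gP ?mulr0 // => Pi.
by move/eqP: ij; apply; exact: (Pdisj _ _ xi).
Qed.

(** The operator [weyl] moves supports by at most the size of the support of
    [central_ft] in the second variable. *)
Lemma weyl_slab_zero (f : heisenberg R n -> R[i]) (lam M : R) (i0 : 'I_n) (E : set 'rV[R]_n) (xi : 'rV[R]_n) :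
  integrableC (haar R n) f -> measurable E ->
  {ae nu, forall z : Cn R n, M < `|z.2 ord0 i0| -> central_ft f lam z = 0} ->
  (forall eta : 'rV[R]_n, E eta -> M < `|eta ord0 i0 - xi ord0 i0|) ->
  weyl f lam (indC E) xi = 0.
Proof.
move=> If mE F0 hE; rewrite /weyl -(int0 nu); apply: int_ae.
- apply: mCM; first exact: iC_mC (iC_central_ft lam If).
  exact: (mC_pair2 xi (mC_rho lam (mC_indC mE))).
- exact: mC_cst.
- apply: filterS F0 => z F0; have [Ez|Ez] := pselect (E (xi + z.2)).
    rewrite F0 ?mul0r //; have := hE _ Ez; rewrite mxE.
    by rewrite addrAC subrr add0r.
  by rewrite /rho /indC indicE memNset // mulr0 mulr0.
Qed.

(** Functions carried by slabs that are far apart are mapped to functions with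
    disjoint supports, so the operator annihilates all the functions carried by
    one of [N + 1] slabs. Its kernel then vanishes over that slab, that is, the
    partial transform of [central_ft] vanishes on a strip; it extends analytically
    off the strip because the support of [central_ft] is bounded in the first
    variable too. *)
Theorem finite_rank_central_ft (n_ge1 : (1 <= n)%N) (B : set (Cn R n))
  (f : heisenberg R n -> R[i]) (lam : R) :
  integrableC (haar R n) f -> supported_on f (B `*` [set: R]) -> compact B ->
  lam != 0 -> finite_rank (fourier f lam) ->
  {ae nu, forall z, central_ft f lam z = 0}.
Proof.
move=> If fB cB lam0 [N [b [L2b hb]]].
pose i0 := Ordinal n_ge1.
have [M M0 BM] := compact_coord_bound i0 cB.
pose F := central_ft f lam.
have IF : integrableC nu F := iC_central_ft lam If.
have mF := iC_mC IF.
have F0 : {ae nu, forall z : Cn R n, M < `|z.1 ord0 i0| \/ M < `|z.2 ord0 i0| -> F z = 0}.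
  apply: filterS (central_ft_supp lam If fB) => z hz h; apply: hz => /BM[h1 h2].
  by case: h; rewrite ltNge ?h1 ?h2.
have F0y : {ae nu, forall z : Cn R n, M < `|z.2 ord0 i0| -> F z = 0}.
  by apply: filterS F0 => z h ?; apply: h; right.
(* the slabs have width 1; the operator enlarges them by M on either side *)
pose L := 2 * M + 2.
pose slab (j : 'I_N.+1) : set 'rV[R]_n := [set eta | j%:R * L <= eta ord0 i0 < j%:R * L + 1].
pose P (j : 'I_N.+1) : set 'rV[R]_n := [set xi | j%:R * L - M <= xi ord0 i0 <= j%:R * L + 1 + M].
have mslab j : measurable (slab j).
  rewrite (_ : slab j = (fun x : 'rV[R]_n => x ord0 i0) @^-1` `[j%:R * L, j%:R * L + 1[%classic); last first.
    by apply/seteqP; split => x /=; rewrite in_itv.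
  rewrite -[X in measurable X]setTI; exact: (measurable_coord i0 measurableT (measurable_itv _)).
have [j hj] : exists j, forall E, measurable E -> (mu E < +oo)%E -> E `<=` slab j ->
    {ae mu, forall xi, weyl f lam (indC E) xi = 0}.
  apply: contrapT => /forallNP no.
  have /choice[E hE] : forall j, exists E, [/\ measurable E, (mu E < +oo)%E, E `<=` slab j &
      ~ {ae mu, forall xi, weyl f lam (indC E) xi = 0}].
    move=> j; have := no j => /existsNP[E /not_implyP[mE /not_implyP[Eoo /not_implyP[Ej hE]]]].
    by exists E.
  have [|||i hi] := @disjoint_supports_dependent N b (fun j => weyl f lam (indC (E j))) P _ _ _.
  + move=> i; have [mE Eoo _ _] := hE i.
    have [c hc] := hb _ (L2_indC mE Eoo); exists c.
    by apply: filterS2 hc (fourier_indC lam If mE Eoo) => xi -> .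
  + move=> i xi Pi; have [mE Eoo Ej _] := hE i.
    apply: (weyl_slab_zero If mE F0y) => eta /Ej /= /andP[h1 h2].
    rewrite ltNge; apply/negP; rewrite ler_norml => /andP[h3 h4]; apply: Pi => /=.
    by apply/andP; split; lra.
  + move=> i j xi /= /andP[h1 h2] /andP[h3 h4]; apply/val_inj => /=.
    have lt_contra (k l : 'I_N.+1) : (k < l)%N -> k%:R * L + 1 + M < l%:R * L - M.
      move=> kl; have : k%:R + 1 <= l%:R :> R by rewrite natr1 ler_nat.
      move=> kl1; have : (k%:R + 1) * L <= l%:R * L.
        by apply: ler_wpM2r => //; rewrite /L; lra.
      by rewrite mulrDl mul1r {2}/L; lra.
    case: (ltngtP i j) => // [/lt_contra ij|/lt_contra ij].
      by have := lt_le_trans ij (le_trans h3 h2); rewrite ltxx.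
    by have := lt_le_trans ij (le_trans h1 h4); rewrite ltxx.
  + by have [_ _ _] := hE i; apply.
have kern0 : {ae mm, forall z : Cn R n, slab j z.2 -> kern F lam z = 0}.
  have : {ae mm, forall z : Cn R n, kern F lam z * (\1_(slab j) z.2)%:C = 0}.
    have eDE (D E : set 'rV[R]_n) (z : Cn R n) : kern F lam z * (\1_(slab j) z.2)%:C * (\1_(D `*` E) z)%:C =
        kern F lam z * (\1_(D `*` (E `&` slab j)) z)%:C.
      rewrite !indicE !in_setX in_setI -mulrA; congr (_ * _).
      by case: (_ \in D); case: (_ \in E); case: (_ \in _); rewrite /= ?mulr0 ?mulr1.
    have fin (E : set 'rV[R]_n) : measurable E -> (mu E < +oo)%E ->
        measurable (E `&` slab j) /\ (mu (E `&` slab j) < +oo)%E.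
      move=> mE Eoo; have mI : measurable (E `&` slab j) by exact: measurableI.
      by split=> //; apply: le_lt_trans Eoo; apply: le_measure; rewrite ?inE.
    apply: rect_unique => D E mD mE Doo /(fin _ mE)[mI Ioo].
      apply: (iC_eq (f := fun z => kern F lam z * (\1_(D `*` (E `&` slab j)) z)%:C)).
        by move=> z; rewrite eDE.
      exact: iC_kern.
    have -> : (fun z => kern F lam z * (\1_(slab j) z.2)%:C * (\1_(D `*` E) z)%:C) =
        fun z => kern F lam z * (\1_(D `*` (E `&` slab j)) z)%:C.
      by apply/funext => z; rewrite eDE.
    rewrite int_kern // -(int0 mu); apply: int_ae.
    - by apply: mCM; [exact: mC_indC|exact: (iC_mC (iC_weyl lam If mI Ioo))].
    - exact: mC_cst.
    - apply: filterS (hj _ mI Ioo (@subIsetr _ _ _)) => xi e.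
      by rewrite -/(weyl f lam (indC (E `&` slab j)) xi) e mulr0.
  apply: filterS => z; rewrite indicE => h zj; move: h.
  by rewrite mem_set // mulr1.
have pft0 : {ae nu, forall z : Cn R n, slab j (z.1 + 2^-1 *: z.2) -> pft F lam z = 0}.
  apply: filterS (mp_ae (mpres_wigner n) kern0) => z h zj.
  by rewrite -kern_wigner; apply: h.
(* rational translations only, so that one null set serves for all of them *)
have pftq : {ae nu, forall z : Cn R n, forall q : rat,
    slab j (z.1 + ratr q *: delta_mx ord0 i0 + 2^-1 *: z.2) ->
    pft F lam (z.1 + ratr q *: delta_mx ord0 i0, z.2) = 0}.
  have ae_q (q : rat) : {ae nu, forall z : Cn R n,
      slab j (z.1 + ratr q *: delta_mx ord0 i0 + 2^-1 *: z.2) ->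
      pft F lam (z.1 + ratr q *: delta_mx ord0 i0, z.2) = 0}.
    have := mp_ae (mpres_shiftCn (ratr q *: delta_mx ord0 i0, 0)) pft0.
    apply: filterS => -[v y].
    rewrite (_ : (v, y) + _ = (v + ratr q *: delta_mx ord0 i0, y)) //.
    by congr pair; exact: addr0.
  have /ae_foralln : forall k : nat, {ae nu, forall z : Cn R n,
      forall q, choice.unpickle k = Some q ->
      slab j (z.1 + ratr q *: delta_mx ord0 i0 + 2^-1 *: z.2) ->
      pft F lam (z.1 + ratr q *: delta_mx ord0 i0, z.2) = 0}.
    move=> k; case: (choice.unpickle k) => [q|]; last by apply: aeW.
    by apply: filterS (ae_q q) => z h _ [<-].
  by apply: filterS => z h q; apply: (h (choice.pickle q)); exact: choice.pickleK.
have IF' : integrableC mm F := IF.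
have secF0 : {ae mu, forall y, {ae mu, forall x : 'rV[R]_n, M < `|x ord0 i0| -> F (x, y) = 0}}.
  by apply: filterS (ae_sections2 F0) => y; apply: filterS => x h ?; apply: h; left.
have sec : {ae mu, forall y, {ae mu, forall x, F (x, y) = 0}}.
  apply: filterS3 (ae_iC2 IF') secF0 (ae_sections2 pftq) => y Iy Fy0 pq.
  pose S := [set x : 'rV[R]_n | `|x ord0 i0| <= M].
  have mS : measurable S.
    rewrite (_ : S = (fun x : 'rV[R]_n => x ord0 i0) @^-1` `[- M, M]%classic); last first.
      by apply/seteqP; split => x; rewrite /S /= in_itv /= ler_norml.
    rewrite -[X in measurable X]setTI; exact: (measurable_coord i0 measurableT (measurable_itv _)).
  pose h (x : 'rV[R]_n) := F (x, y) * indC S x.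
  have Ih : integrableC mu h.
    apply: (@iCM _ _ _ _ _ _ 1 Iy); first exact: mC_indC.
    by move=> x; rewrite n1_indC indicE; case: (_ \in _).
  have hF : {ae mu, forall x, F (x, y) = h x}.
    apply: filterS Fy0 => x hx; rewrite /h /indC indicE.
    have [xM|xM] := leP `|x ord0 i0| M; first by rewrite mem_set // mulr1.
    by rewrite hx // mul0r.
  have fth v : ft lam (fun x => F (x, y)) v = ft lam h v.
    apply: int_ae.
    - exact: (iC_mC (iC_phase _ _ Iy)).
    - exact: (iC_mC (iC_phase _ _ Ih)).
    - by apply: filterS hF => x ->.
  have h_supp (x : 'rV[R]_n) : M < `|x ord0 i0| -> h x = 0.
    move=> xM; rewrite /h /indC indicE memNset ?mulr0 //= => h1.
    by move: xM; rewrite ltNge h1.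
  have ft0 : {ae mu, forall v, ft lam h v = 0}.
    apply: filterS pq => v pqv.
    (* [ratr q] brings the point into the middle half of the slab, which leaves
       room 1/4 for the steps of the interpolation *)
    pose sg := (v + 2^-1 *: y) ord0 i0.
    have [q] : exists q : rat, ratr q \in `]j%:R * L + 4^-1 - sg, j%:R * L + 3/4 - sg[.
      by apply: rat_in_itvoo; lra.
    rewrite in_itv /= => /andP[q1 q2].
    apply: (@newton_zero _ _ lam M 4^-1 (ratr q) i0 v h Ih h_supp) => // m k m0 hk.
    have -> : ratr q - k%:R * (ratr q / m%:R) = ratr (q - k%:R * (q / m%:R)) :> R.
      by rewrite rmorphB !rmorphM /= fmorphV !rmorph_nat.
    rewrite -(fth (v + _)); apply: (pqv (q - k%:R * (q / m%:R))).
    have hk2 : `|k%:R * (ratr q / m%:R)| <= 4^-1 :> R.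
      rewrite normrM normr_nat normrM normfV normr_nat mulrA ler_pdivrMr ?ltr0n //.
    move: hk2; rewrite ler_norml => /andP[k1 k2].
    rewrite /slab /=.
    have -> : (v + ratr (q - k%:R * (q / m%:R)) *: delta_mx ord0 i0 + 2^-1 *: y) ord0 i0 =
       sg + (ratr q - k%:R * (ratr q / m%:R)).
      rewrite /sg !mxE !eqxx mulr1 rmorphB !rmorphM /= fmorphV !rmorph_nat; ring.
    by apply/andP; split; lra.
  have := fourier_inversion lam0 Ih (iC0 _) ft0; apply: filterS2 hF => x -> ->.
  rewrite (_ : (fun _ => _) = fun=> 0); last by apply/funext => v; rewrite mul0r.
  by rewrite int0 mulr0.
by apply: ae_prod2 => //; exact: measurable_neq0.
Qed.

End finite_rank_case.

(** * Finite measure support and rank one *)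

Section ambiguity.
Context {R : realType} {n : nat}.
Local Notation mu := (lebesgue_rV R n).
Local Notation nu := (lebesgue_Cn R n).
Local Notation mm := (lebesgue_rV R n \x lebesgue_rV R n)%E.

Lemma L2_shift (phi : 'rV[R]_n -> R[i]) (v : 'rV[R]_n) : L2 phi -> L2 (fun x => phi (x + v)).
Proof.
move=> [mphi phioo]; split; first exact: (mC_comp mphi (mpres_shift v).1).
apply: le_lt_trans phioo; rewrite le_eqVlt; apply/orP; left; apply/eqP.
rewrite [RHS](mp_ge0 (mpres_shift v)) //; last by move=> x; rewrite lee_fin sqn_ge0.
by apply/measurable_EFinP; exact: measurable_sqn.
Qed.

Lemma int_sqn_shift (phi : 'rV[R]_n -> R[i]) (v : 'rV[R]_n) : L2 phi ->
  \int[mu]_x sqn (phi (x + v)) = \int[mu]_x sqn (phi x).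
Proof.
move=> [mphi _]; rewrite /Rintegral [in RHS](mp_integral (mpres_shift v)) //.
by apply/measurable_EFinP; exact: measurable_sqn.
Qed.

Variables (lam : R) (a b : 'rV[R]_n -> R[i]) (F : Cn R n -> R[i]).
Hypotheses (lam0 : lam != 0) (L2a : L2 a) (L2b : L2 b) (IF : integrableC nu F).

(** The tensor product of [a] and [b] in the coordinates of [wigner_map]. *)
Definition wig (z : Cn R n) : R[i] :=
  a (z.1 - 2^-1 *: z.2) * b (z.1 + 2^-1 *: z.2).

Hypothesis pftF : {ae nu, forall z, pft F lam z = wig z}.

(** The constant of the inversion formula. *)
Definition cst_inv : R := (`|lam| / (2 * pi)) ^+ n.

Lemma cst_inv_gt0 : 0 < cst_inv.
Proof. by rewrite exprn_gt0 // divr_gt0 ?normr_gt0 // mulr_gt0 // pi_gt0. Qed.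

(** The (cross-)ambiguity function of the pair [(a, b)], everywhere defined and
    bounded, whereas [F] is only given almost everywhere. *)
Definition ambig (z : Cn R n) : R[i] :=
  cst_inv%:C * integralC mu (fun v => wig (v, z.2) * expi (- (lam * dotR z.1 v))).

Lemma mC_wig : measurableC wig.
Proof.
apply: mCM; first apply: (mC_comp L2a.1).
  by apply: measurable_rVB => //; exact: measurable_rVZ.
by apply: (mC_comp L2b.1); apply: measurable_rVD => //; exact: measurable_rVZ.
Qed.

Lemma iC_wig y : integrableC mu (fun v => wig (v, y)).
Proof.
exact: (iC_L2_mul (L2_shift (- (2^-1 *: y)) L2a) (L2_shift (2^-1 *: y) L2b)).
Qed.

Lemma mC_phaseN d (T : measurableType d) (f g : T -> 'rV[R]_n) :
  measurable_fun setT f -> measurable_fun setT g ->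
  measurableC (fun x => expi (- (lam * dotR (f x) (g x)))).
Proof.
move=> mf mg; apply: mC_expi; apply: measurableT_comp => //.
by apply: measurable_funM; [exact: measurable_cst|exact: measurable_dotR].
Qed.

Lemma iC_wig_phase x y : integrableC mu (fun v => wig (v, y) * expi (- (lam * dotR x v))).
Proof.
apply: (iCM (iC_wig y) _ (fun _ => n1_expi _)).
by apply: mC_phaseN; [exact: measurable_cst|exact: measurable_id].
Qed.

Lemma mC_ambig : measurableC ambig.
Proof.
apply: mCM; first exact: mC_cst.
apply: (@mC_int1 _ _ _ _ _ mu (fun p : Cn R n * 'rV[R]_n => wig (p.2, p.1.2) * expi (- (lam * dotR p.1.1 p.2)))).
have m1 : measurable_fun setT (fun p : Cn R n * 'rV[R]_n => p.1.1).
  exact: (measurableT_comp measurable_fst measurable_fst).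
have m2 : measurable_fun setT (fun p : Cn R n * 'rV[R]_n => p.1.2).
  exact: (measurableT_comp measurable_snd measurable_fst).
apply: mCM; last exact: mC_phaseN.
by apply: (mC_comp mC_wig); exact: measurable_fun_pair.
Qed.

Lemma ambig_bounded : exists M, forall z, n1 (ambig z) <= M.
Proof.
exists (cst_inv * (2 * (\int[mu]_x sqn (a x) + \int[mu]_x sqn (b x)))) => -[x y].
rewrite /ambig n1_realM ger0_norm ?(ltW cst_inv_gt0) //.
apply: ler_wpM2l; first exact: ltW cst_inv_gt0.
apply: le_trans (n1_int (iC_wig_phase x y)) _.
have ia := L2_sqn (L2_shift (- (2^-1 *: y)) L2a).
have ib := L2_sqn (L2_shift (2^-1 *: y) L2b).
rewrite -(int_sqn_shift (- (2^-1 *: y)) L2a) -(int_sqn_shift (2^-1 *: y) L2b).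
rewrite -RintegralD // -RintegralZl //; last exact: (integrableD measurableT ia ib).
apply: le_Rintegral => //; first exact: iC_n1 (iC_wig_phase x y).
  exact: (integrableZl measurableT 2 (integrableD measurableT ia ib)).
move=> v _; apply: le_trans (n1M _ _) _; rewrite mulrC.
by apply: ler_pM; rewrite ?n1_ge0 ?n1_expi // n1_young.
Qed.

Let IF' : integrableC mm F := IF.

Let pft_sec : {ae mu, forall y, {ae mu, forall v, ft lam (fun x => F (x, y)) v = wig (v, y)}}.
Proof. exact: (ae_sections2 pftF). Qed.

(** Fourier inversion in the first variable. *)
Lemma ae_ambig : {ae nu, forall z, F z = ambig z}.
Proof.
apply: ae_prod2.
  rewrite (_ : [set z | ~ _] = [set z | F z - ambig z <> 0]).
    by apply: measurable_neq0; apply: mCB; [exact: iC_mC IF|exact: mC_ambig].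
  apply/seteqP; split => z /= h e; apply: h; first by apply/eqP; rewrite -subr_eq0 e.
  by rewrite e subrr.
apply: filterS2 (ae_iC2 IF') pft_sec => y Iy Wy.
exact: (fourier_inversion lam0 Iy (iC_wig y) Wy).
Qed.

Lemma iC_ambig : integrableC nu ambig.
Proof. exact: (iC_ae mC_ambig ae_ambig IF). Qed.

Let IA : integrableC mm ambig := iC_ambig.

Lemma ft_ambig : {ae mu, forall y, integrableC mu (fun x => ambig (x, y)) /\
  {ae mu, forall v, ft lam (fun x => ambig (x, y)) v = wig (v, y)}}.
Proof.
have FAm : {ae mm, forall z, F z = ambig z} := ae_ambig.
have c1 := ae_iC2 IA; have c3 := ae_iC2 IF'; have c4 := ae_sections2 FAm.
apply: filterS2 (filterI c1 pft_sec) (filterI c3 c4) => y [Iy Wy] [IFy FA].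
split => //; apply: filterS Wy => v <-; apply: int_ae.
- exact: (iC_mC (iC_phase _ _ Iy)).
- exact: (iC_mC (iC_phase _ _ IFy)).
- by apply: filterS FA => x ->.
Qed.

(** This product is self-dual, and its value at 0 is the square of [ambig z0]. *)
Definition sym_ambig (z0 z : Cn R n) : R[i] := ambig (z0 + z) * ambig (z0 - z).

Section fixed_center.
Variable z0 : Cn R n.

Lemma mpres_shiftl (w : Cn R n) : mpres nu nu (fun z => w + z).
Proof. by have := mpres_shiftCn w; congr mpres; apply/funext => z; rewrite addrC. Qed.

Let measurable_refl : measurable_fun setT (fun z : Cn R n => z0 - z).
Proof.
have m1 : measurable_fun setT (fun z : Cn R n => z0.1 - z.1).
  by apply: measurable_rVB => //; exact: measurable_cst.
have m2 : measurable_fun setT (fun z : Cn R n => z0.2 - z.2).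
  by apply: measurable_rVB => //; exact: measurable_cst.
exact: (measurable_fun_pair m1 m2).
Qed.

Lemma iC_sym_ambig : integrableC nu (sym_ambig z0).
Proof.
have [M bM] := ambig_bounded.
apply: (@iCM _ _ _ _ _ _ M (mp_iC (mpres_shiftl z0) iC_ambig)) => //.
exact: (mC_comp mC_ambig measurable_refl).
Qed.

Variables tau sigma : 'rV[R]_n.

(** The value at [(tau, sigma)] splits into the integrals of [alpha], from
    [ambig (z0 + (tau, sigma))], and [beta], from [ambig (z0 - (tau, sigma))]; the
    substitution [psi] separates the variables of [G] into these two. *)
Let alpha (p : 'rV[R]_n) := wig (p, z0.2 + sigma) * expi (- (lam * dotR (z0.1 + tau) p)).
Let beta (q : 'rV[R]_n) := wig (q, z0.2 - sigma) * expi (- (lam * dotR (z0.1 - tau) q)).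

Let G (z : Cn R n) := wig (z.1, z0.2 - z.2) * wig (sigma + z.1, z0.2 + z.2) *
  expi (- (lam * dotR z0.1 (z.1 + z.1 + sigma))) * expi (- (lam * dotR tau z.2)).

Let psi (z : Cn R n) : Cn R n := wigner_map (z + (2^-1 *: sigma, 0)).

Let mpres_psi : mpres mm mm psi.
Proof. exact: (mpres_comp (mpres_shiftCn (2^-1 *: sigma, 0)) (mpres_wigner n)). Qed.

Let GE z : G z = beta (psi z).1 * alpha (psi z).2.
Proof.
case: z => w y; rewrite /G /beta /alpha /psi /wigner_map /wig /= addr0.
set q := w + 2^-1 *: sigma - 2^-1 *: y; set p := w + 2^-1 *: sigma + 2^-1 *: y.
have -> : w - 2^-1 *: (z0.2 - y) = p - 2^-1 *: (z0.2 + sigma).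
  by apply/rowP => i; rewrite !mxE; lra.
have -> : w + 2^-1 *: (z0.2 - y) = q + 2^-1 *: (z0.2 - sigma).
  by apply/rowP => i; rewrite !mxE; lra.
have -> : sigma + w - 2^-1 *: (z0.2 + y) = q - 2^-1 *: (z0.2 - sigma).
  by apply/rowP => i; rewrite !mxE; lra.
have -> : sigma + w + 2^-1 *: (z0.2 + y) = p + 2^-1 *: (z0.2 + sigma).
  by apply/rowP => i; rewrite !mxE; lra.
have -> : w + w + sigma = p + q by apply/rowP => i; rewrite !mxE; lra.
have -> : dotR tau y = dotR tau (p - q).
  by congr dotR; apply/rowP => i; rewrite !mxE; lra.
have e : expi (- (lam * dotR z0.1 (p + q))) * expi (- (lam * dotR tau (p - q))) =
  expi (- (lam * dotR (z0.1 - tau) q)) * expi (- (lam * dotR (z0.1 + tau) p)).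
  by rewrite -!expiD !dotE; congr expi; ring.
rewrite -mulrA e; ring.
Qed.

Let Ia : integrableC mu alpha. Proof. exact: iC_wig_phase. Qed.
Let Ib : integrableC mu beta. Proof. exact: iC_wig_phase. Qed.

Let IG : integrableC mm G.
Proof.
apply: (iC_eq (f := fun z => beta (psi z).1 * alpha (psi z).2)) => [z|]; first by rewrite GE.
exact: (mp_iC mpres_psi (iC_tensor Ib Ia)).
Qed.

Let int_G : integralC mm G = integralC mu beta * integralC mu alpha.
Proof.
rewrite -(int_tensor Ib Ia) [RHS](mp_int mpres_psi); first by apply: int_eq => z; rewrite GE.
exact: (iC_mC (iC_tensor Ib Ia)).
Qed.

(** One factor of [sym_ambig] is replaced by its definition; integrating the other
    one against the phase that results recovers its partial Fourier transform,
    which is [wig]. *)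
Let inner_fiber y : integrableC mu (fun x => ambig (x, z0.2 + y)) ->
  {ae mu, forall v, ft lam (fun x => ambig (x, z0.2 + y)) v = wig (v, z0.2 + y)} ->
  integralC mu (fun x => sym_ambig z0 (x, y) * expi (lam * dotR sigma x)) =
  cst_inv%:C * integralC mu (fun w => wig (w, z0.2 - y) * wig (sigma + w, z0.2 + y) *
    expi (- (lam * dotR z0.1 (w + w + sigma)))).
Proof.
move=> Iy Wy.
have Iys : integrableC mu (fun x => ambig (x + z0.1, z0.2 + y)).
  exact: (mp_iC (mpres_shift z0.1) Iy).
pose Phi (p : Cn R n) := ambig (p.1 + z0.1, z0.2 + y) * wig (p.2, z0.2 - y) *
  expi (lam * dotR p.1 (sigma + p.2) - lam * dotR z0.1 p.2).
have IPhi : integrableC mm Phi.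
  apply: (iCM (iC_tensor Iys (iC_wig (z0.2 - y))) _ (fun _ => n1_expi _)).
  apply: mC_expi; apply: measurable_funB.
    apply: measurable_funM; first exact: measurable_cst.
    by apply: measurable_dotR => //; apply: measurable_rVD => //; exact: measurable_cst.
  apply: measurable_funM; first exact: measurable_cst.
  by apply: measurable_dotR => //; exact: measurable_cst.
transitivity (integralC mu (fun x => cst_inv%:C * integralC mu (fun w => Phi (x, w)))).
  apply: int_eq => x; rewrite /sym_ambig.
  rewrite [z0 + (x, y)](_ : _ = (x + z0.1, z0.2 + y)); last first.
    by case: (z0) => ? ?; congr pair; rewrite addrC.
  have -> : ambig (z0 - (x, y)) = cst_inv%:C *
    integralC mu (fun w => wig (w, z0.2 - y) * expi (- (lam * dotR (z0.1 - x) w))) by [].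
  set I := integralC _ _.
  transitivity (cst_inv%:C * (ambig (x + z0.1, z0.2 + y) * expi (lam * dotR sigma x) * I)).
    by ring.
  congr (_ * _); rewrite /I -intZ; last exact: iC_wig_phase.
  apply: int_eq => w; rewrite /Phi /=.
  rewrite (_ : lam * dotR x (sigma + w) - lam * dotR z0.1 w = lam * dotR sigma x + - (lam * dotR (z0.1 - x) w)).
    by rewrite expiD; ring.
  by rewrite !dotE (dotRC x sigma); ring.
rewrite intZ; last exact: (iC_int1 IPhi).
congr (_ * _); rewrite (fubiniC IPhi); apply: int_ae.
- exact: (iC_mC (iC_int2 IPhi)).
- have mw2 : measurableC (fun w => wig (sigma + w, z0.2 + y)).
    apply: (mC_comp mC_wig); apply: measurable_fun_pair; last exact: measurable_cst.
    by apply: measurable_rVD => //; exact: measurable_cst.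
  apply: mCM; first by apply: mCM => //; exact: iC_mC (iC_wig _).
  apply: mC_phaseN; first exact: measurable_cst.
  by apply: measurable_rVD; [exact: measurable_rVD|exact: measurable_cst].
- have := mp_ae (mpres_shift sigma) Wy; apply: filterS => w Ww.
  rewrite [w + sigma]addrC in Ww; rewrite -Ww /ft.
  rewrite (mp_int (mpres_shift z0.1)); last exact: (iC_mC (iC_phase _ _ Iy)).
  set X := integralC _ _; set Y := integralC _ _.
  suff : X = wig (w, z0.2 - y) * expi (- (lam * dotR z0.1 (w + w + sigma))) * Y.
    by move=> ->; ring.
  rewrite /X /Y -intZ; last exact: (mp_iC (mpres_shift z0.1) (iC_phase lam (sigma + w) Iy)).
  apply: int_eq => x; rewrite /Phi /=.
  rewrite (_ : lam * dotR x (sigma + w) - lam * dotR z0.1 w =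
     - (lam * dotR z0.1 (w + w + sigma)) + lam * dotR (x + z0.1) (sigma + w)).
    by rewrite expiD; ring.
  by rewrite !dotE; ring.
Qed.

(** [sym_ambig z0] is, up to a constant, its own symplectic Fourier transform: the
    transform is an integral of four factors [a], [b], [a], [b], which are merely
    paired off differently on the two sides. *)
Theorem sym_ambig_self_dual : sym_ambig z0 (tau, sigma) = cst_inv%:C *
  integralC nu (fun z => sym_ambig z0 z * expi (lam * (dotR sigma z.1 - dotR tau z.2))).
Proof.
have IU : integrableC mm (fun z => sym_ambig z0 z * expi (lam * (dotR sigma z.1 - dotR tau z.2))).
  have IU' : integrableC mm (sym_ambig z0) := iC_sym_ambig.
  apply: (iCM IU' _ (fun _ => n1_expi _)); apply: mC_expi.
  apply: measurable_funM; first exact: measurable_cst.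
  by apply: measurable_funB; apply: measurable_dotR => //; exact: measurable_cst.
have -> : integralC nu (fun z => sym_ambig z0 z * expi (lam * (dotR sigma z.1 - dotR tau z.2))) =
   cst_inv%:C * integralC mm G.
  rewrite [LHS](fubiniC2 IU) (fubiniC2 IG) -intZ; last exact: (iC_int2 IG).
  apply: int_ae.
  - exact: (iC_mC (iC_int2 IU)).
  - by apply: mCM; [exact: mC_cst|exact: (iC_mC (iC_int2 IG))].
  - have := mp_ae (mpres_shift z0.2) ft_ambig.
    have h := ae_iC2 IG; have h2 := ae_iC2 IU; move=> h3; apply: filterS3 h h2 h3 => y IGy IUy.
    rewrite [y + _]addrC => -[Iy Wy].
    have e1 : integralC mu (fun x => sym_ambig z0 (x, y) * expi (lam * (dotR sigma x - dotR tau y))) =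
       expi (- (lam * dotR tau y)) * integralC mu (fun x => sym_ambig z0 (x, y) * expi (lam * dotR sigma x)).
      rewrite -intZ.
        by apply: int_eq => x; rewrite mulrBr expiD; ring.
      apply: (iC_eq (f := fun x => expi (lam * dotR tau y) * (sym_ambig z0 (x, y) * expi (lam * (dotR sigma x - dotR tau y))))).
        move=> x; rewrite mulrCA -expiD; congr (_ * expi _); ring.
      exact: iCZ.
    rewrite [LHS]e1 (inner_fiber Iy Wy) mulrCA; congr (_ * _).
    rewrite -intZ; first by apply: int_eq => w; rewrite /G /= mulrC.
    apply: (iC_eq (f := fun w => expi (lam * dotR tau y) * G (w, y))).
      move=> w; rewrite /G /= mulrCA -expiD subrr expi0 mulr1 //.
    exact: iCZ.
have ea : ambig (z0 + (tau, sigma)) = cst_inv%:C * integralC mu alpha by [].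
have eb : ambig (z0 - (tau, sigma)) = cst_inv%:C * integralC mu beta by [].
by rewrite int_G /sym_ambig ea eb; ring.
Qed.

End fixed_center.

End ambiguity.

(** * Self-dual functions of finite measure support *)

Section gram_schmidt.
Context {R : realType}.
Implicit Types p q r : {poly R[i]}.

(** Gram-Schmidt for the powers of ['X], with the degrees under control. *)
Lemma gram_schmidt (B : {poly R[i]} -> {poly R[i]} -> R[i]) :
  (forall c p q r, B (c *: p + q) r = c * B p r + B q r) ->
  (forall p q, B q p = (B p q)^*%R) ->
  (forall p, B p p = 0 -> p = 0) ->
  forall N : nat, exists P : nat -> {poly R[i]},
    (forall k, (k < N)%N -> size (P k) = k.+1) /\
    (forall k l, (k < N)%N -> (l < N)%N -> k <> l -> B (P k) (P l) = 0).
Proof.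
move=> Blin Bherm Bdef; elim => [|N [P [sP oP]]]; first by exists (fun=> 0).
have B0l r : B 0 r = 0.
  by have := Blin 1 0 0 r; rewrite scale1r addr0 mul1r => /eqP; rewrite eq_sym -subr_eq0 addrK => /eqP.
have Bsum (s : seq nat) (a : nat -> R[i]) (Q : nat -> {poly R[i]}) r :
    B (\sum_(j <- s) a j *: Q j) r = \sum_(j <- s) a j * B (Q j) r.
  elim: s => [|j s IH]; first by rewrite !big_nil B0l.
  by rewrite !big_cons Blin IH.
pose S := \sum_(0 <= j < N) (B 'X^N (P j) / B (P j) (P j)) *: P j.
pose P' k := if (k < N)%N then P k else 'X^N - S.
have sS : (size S <= N)%N.
  apply: leq_trans (size_sum _ _ _) _; rewrite big_nat_cond.
  apply/bigmax_leqP_seq => j; rewrite mem_index_iota => _ /andP[/andP[_ jN] _].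
  by apply: leq_trans (size_scale_leq _ _) _; rewrite sP.
have oN l : (l < N)%N -> B ('X^N - S) (P l) = 0.
  move=> lN; have -> : 'X^N - S = (-1) *: S + 'X^N by rewrite scaleN1r addrC.
  rewrite Blin /S Bsum (bigD1_seq l) /= ?mem_index_iota ?iota_uniq //.
  rewrite big_nat_cond big1 ?addr0 => [|j /andP[/andP[_ jN] jl]].
    rewrite divfK ?mulN1r ?addNr //; apply/eqP => /Bdef Pl.
    by have := sP _ lN; rewrite Pl size_poly0.
  by have /eqP jl' := jl; rewrite (oP j l jN lN jl') mulr0.
exists P'; split => [k|k l].
  rewrite ltnS leq_eqVlt => /orP[/eqP ->|kN]; last by rewrite /P' kN sP.
  by rewrite /P' ltnn size_polyDl size_polyXn // size_polyN ltnS.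
rewrite !ltnS [(k <= N)%N]leq_eqVlt [(l <= N)%N]leq_eqVlt /P'.
move=> /orP[/eqP ->|kN] /orP[/eqP ->|lN] kl //.
- by rewrite ltnn lN oN.
- by rewrite ltnn kN Bherm oN // conjC0.
- by rewrite kN lN oP.
Qed.

Lemma expi_inj (t u : R) : `|t - u| < 2 -> expi t = expi u -> t = u.
Proof.
move=> tu e; apply/eqP; rewrite -subr_eq0; apply/negPn/negP => tu0.
have e1 : expi (t - u) = 1 by rewrite expiD e -expiD subrr expi0.
have c1 : cos `|t - u| = 1.
  have [c _] : expi (t - u) = 1 +i* 0 by rewrite e1.
  by case: (ger0P (t - u)) => _; rewrite ?cosN.
have : 0 < sin (`|t - u| / 2).
  apply: sin_gt0_pi; rewrite divr_gt0 ?normr_gt0 //=.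
  have := pi_ge2 R; lra.
have : cos (`|t - u| / 2 + `|t - u| / 2) = 1 by rewrite -splitr.
rewrite cosD -!expr2 => h; have := cos2Dsin2 (`|t - u| / 2).
move=> h2 s0; have : sin (`|t - u| / 2) ^+ 2 = 0 by lra.
by move/eqP; rewrite sqrf_eq0 => /eqP s1; rewrite s1 ltxx in s0.
Qed.

End gram_schmidt.

Section null_phase.
Context {R : realType} {n : nat}.
Local Notation mu := (lebesgue_rV R n).
Local Notation nu := (lebesgue_Cn R n).

Lemma ae_coord2 (i : 'I_n) (a : R) : {ae nu, forall z : Cn R n, z.2 ord0 i <> a}.
Proof.
apply: (@ae_prod2 _ _ _ _ R mu mu (fun z : Cn R n => z.2 ord0 i <> a)).
  rewrite (_ : [set z | _] = (fun z : Cn R n => z.2 ord0 i) @^-1` [set a]); last first.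
    by apply/seteqP; split => z /=; [move/contrapT|move=> -> ].
  rewrite -[X in measurable X]setTI.
  exact: (measurable_coordT i measurable_snd measurableT (measurable_set1 a)).
by apply: filterS (ae_coord i a) => y h; apply: aeW.
Qed.

(** The level sets of the phase are countable unions of hyperplanes. The solutions
    of [expi t = w] are enumerated by choosing one in each interval
    [[k, k + 1[], where by [expi_inj] there is at most one. *)
Lemma ae_phase_neq (i : 'I_n) (c : R) (w : R[i]) : c != 0 ->
  {ae nu, forall z : Cn R n, expi (c * z.2 ord0 i) <> w}.
Proof.
move=> c0.
pose T (k : int) : R := xget 0 [set t | k%:~R <= t < k%:~R + 1 /\ expi t = w].
have /ae_foralln : forall m : nat, {ae nu, forall z : Cn R n, forall k : int,
    choice.unpickle m = Some k -> z.2 ord0 i <> T k / c}.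
  move=> m; case: (choice.unpickle m) => [k|]; last by apply: aeW.
  by apply: filterS (ae_coord2 i (T k / c)) => z h _ [<-].
apply: filterS => z h e.
pose t := c * z.2 ord0 i; pose k := Num.floor t.
have tk : k%:~R <= t < k%:~R + 1.
  by rewrite -[X in _ + X]/(1%:~R) -intrD floor_itv.
have /(_ k) := h (choice.pickle k); rewrite choice.pickleK => /(_ erefl); apply.
have [/andP[T1 T2] eT] : [set t | k%:~R <= t < k%:~R + 1 /\ expi t = w] (T k).
  by apply: (xgetI 0 (x := t)); split.
have -> : T k = t.
  apply: expi_inj; last by rewrite eT e.
  by move/andP : tk => [t1 t2]; rewrite ltr_norml; apply/andP; split; lra.
by rewrite /t mulrC mulKf.
Qed.

Lemma ae_poly_phase_neq0 (i : 'I_n) (c : R) (p : {poly R[i]}) : c != 0 -> p != 0 ->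
  {ae nu, forall z : Cn R n, p.[expi (c * z.2 ord0 i)] <> 0}.
Proof.
move=> c0 p0; have [s ps] := closed_field_poly_normal p.
have : {ae nu, forall z : Cn R n, forall j : 'I_(size s), expi (c * z.2 ord0 i) <> s`_j}.
  by apply: filter_forall => j; exact: ae_phase_neq.
apply: filterS => z h /eqP; rewrite -/(root p _) ps rootZ ?lead_coef_eq0 // root_prod_XsubC.
by move=> /(nthP 0)[j js e]; apply: (h (Ordinal js)).
Qed.

End null_phase.

Section benedicks.
Context {R : realType} {n : nat}.
Local Notation mu := (lebesgue_rV R n).
Local Notation nu := (lebesgue_Cn R n).
Local Notation mm := (lebesgue_rV R n \x lebesgue_rV R n)%E.

Variables (i0 : 'I_n) (lam c : R) (U : Cn R n -> R[i]).
Hypotheses (lam0 : lam != 0) (c0 : 0 < c) (IU : integrableC nu U).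

Definition omega (w z : Cn R n) : R := lam * (dotR w.2 z.1 - dotR w.1 z.2).

Hypothesis selfdual : forall w, U w = c%:C * integralC nu (fun z => U z * expi (omega w z)).
Hypothesis Uoo : (nu [set z | U z <> 0%R] < +oo)%E.

Let mU := iC_mC IU.

Lemma omegaC w z : omega w z = - omega z w.
Proof. by rewrite /omega [dotR w.2 _]dotRC [dotR w.1 _]dotRC; ring. Qed.

Lemma omegaDl w w' z : omega (w + w') z = omega w z + omega w' z.
Proof. by rewrite /omega /= !dotE; ring. Qed.

Lemma omegaDr w z z' : omega w (z + z') = omega w z + omega w z'.
Proof. by rewrite /omega /= !dotE; ring. Qed.

(** Translations along one real coordinate, to which the phase [omega (hdir t)] in
    the conjugate coordinate corresponds. *)
Definition hdir (t : R) : Cn R n := (t *: delta_mx ord0 i0, 0).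

Lemma omega_hdir t z : omega (hdir t) z = - (lam * t) * z.2 ord0 i0.
Proof.
have dot_e (x : 'rV[R]_n) : dotR (delta_mx ord0 i0) x = x ord0 i0.
  rewrite /dotR (bigD1 i0) //= mxE !eqxx mul1r big1 ?addr0 // => j ji.
  by rewrite mxE (negbTE ji) andbF mul0r.
have dot0 (x : 'rV[R]_n) : dotR 0 x = 0.
  by rewrite /dotR big1 // => j _; rewrite mxE mul0r.
by rewrite /omega /= dot0 dotRZl dot_e; ring.
Qed.

Lemma measurable_omega w : measurable_fun setT (omega w).
Proof.
apply: measurable_funM; first exact: measurable_cst.
by apply: measurable_funB; apply: measurable_dotR => //; exact: measurable_cst.
Qed.

Lemma measurable_omega2 : measurable_fun setT (fun p : Cn R n * Cn R n => omega p.1 p.2).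
Proof.
have m11 : measurable_fun setT (fun p : Cn R n * Cn R n => p.1.1).
  exact: (measurableT_comp measurable_fst measurable_fst).
have m12 : measurable_fun setT (fun p : Cn R n * Cn R n => p.1.2).
  exact: (measurableT_comp measurable_snd measurable_fst).
have m21 : measurable_fun setT (fun p : Cn R n * Cn R n => p.2.1).
  exact: (measurableT_comp measurable_fst measurable_snd).
have m22 : measurable_fun setT (fun p : Cn R n * Cn R n => p.2.2).
  exact: (measurableT_comp measurable_snd measurable_snd).
apply: measurable_funM; first exact: measurable_cst.
by apply: measurable_funB; exact: measurable_dotR.
Qed.

Lemma iC_omega w (f : Cn R n -> R[i]) : integrableC nu f ->
  integrableC nu (fun z => f z * expi (omega w z)).
Proof.
move=> If; apply: (iCM If _ (fun _ => n1_expi _)).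
by apply: mC_expi; exact: measurable_omega.
Qed.

Lemma U_bounded : exists2 M, 0 <= M & forall w, n1 (U w) <= M.
Proof.
exists (c * (2 * \int[nu]_z n1 (U z))).
  by rewrite !mulr_ge0 ?(ltW c0) //; apply: Rintegral_ge0 => z _; exact: n1_ge0.
move=> w; rewrite selfdual n1_realM gtr0_norm //; apply: ler_wpM2l; first exact: ltW.
apply: le_trans (n1_int (iC_omega w IU)) _.
rewrite -RintegralZl //; last exact: iC_n1 IU.
apply: le_Rintegral => //; first exact: iC_n1 (iC_omega w IU).
  exact: (integrableZl measurableT 2 (iC_n1 IU)).
move=> z _; apply: le_trans (n1M _ _) _; rewrite mulrC; apply: ler_wpM2r; first exact: n1_ge0.
exact: n1_expi.
Qed.

Lemma U_continuous x (t : nat -> R) : t @ \oo --> 0 -> cvgC (fun k => U (x + hdir (t k))) (U x).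
Proof.
move=> t0; rewrite [U x]selfdual.
rewrite (_ : (fun k => _) = fun k => c%:C * integralC nu (fun z => U z * expi (omega (x + hdir (t k)) z))); last first.
  by apply/funext => k; rewrite selfdual.
apply: cvgC_mul; first exact: cvgC_cst.
apply: (dctC (g := fun z => 2 * n1 (U z))).
- by move=> k; exact: iC_mC (iC_omega _ IU).
- exact: iC_mC (iC_omega _ IU).
- apply: aeW => z; apply: cvgC_mul; first exact: cvgC_cst.
  apply: cvgC_expi; rewrite (_ : (fun k => _) = fun k => omega x z + - (lam * t k) * z.2 ord0 i0); last first.
    by apply/funext => k; rewrite omegaDl omega_hdir.
  rewrite -[X in _ --> X]addr0; apply: cvgD; first exact: cvg_cst.
  rewrite -[X in _ --> X](mul0r (z.2 ord0 i0)); apply: cvgM; last exact: cvg_cst.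
  rewrite -oppr0; apply: cvgN; rewrite -(mulr0 lam).
  by apply: cvgM => //; exact: cvg_cst.
- exact: (integrableZl measurableT 2 (iC_n1 IU)).
- move=> k z; apply: le_trans (n1M _ _) _; rewrite mulrC; apply: ler_wpM2r; first exact: n1_ge0.
  exact: n1_expi.
Qed.

Let S := [set z | U z <> 0].
Let mS : measurable S. Proof. exact: measurable_neq0. Qed.
Let kap := fine (nu S).

Let Sh (t : R) := [set z | U (z + hdir t) <> 0].

Let mSh t : measurable (Sh t).
Proof. by apply: measurable_neq0; exact: (mC_comp mU (mpres_shiftCn (hdir t)).1). Qed.

Let nuSh t : nu (Sh t) = nu S.
Proof. exact: ((mpres_shiftCn (hdir t)).2 S mS). Qed.

(** [U] is continuous along the translations, so that a point of [S] is in
    [Sh (t k)] for large [k], and [S] minus [Sh (t k)] shrinks to nothing; the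
    opposite difference has the same measure because [Sh (t k)] and [S] do. *)
Lemma shift_support_small (t : nat -> R) : t @ \oo --> 0 ->
  (fun k => fine (nu (Sh (t k) `\` S))) @ \oo --> (0 : R).
Proof.
move=> t0.
have swap k : nu (Sh (t k) `\` S) = nu (S `\` Sh (t k)).
  have D (A B : set (Cn R n)) : measurable A -> measurable B -> (nu A < +oo)%E ->
      nu (A `\` B) = (nu A - nu (A `&` B))%E by exact: measureD.
  have -> : nu (Sh (t k) `\` S) = (nu (Sh (t k)) - nu (Sh (t k) `&` S))%E.
    by apply: D => //; rewrite nuSh.
  by rewrite nuSh setIC; apply/esym; exact: D.
pose f_ (k : nat) (z : Cn R n) : R[i] := (\1_(S `\` Sh (t k)) z)%:C.
have IS : integrableC nu (fun z => (\1_S z : R)%:C) by exact: iC_indic.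
have h : cvgC (fun k => integralC nu (f_ k)) (integralC nu (fun _ => 0)).
  apply: (dctC (g := \1_S)).
  - by move=> k; apply: mC_real; apply: measurable_indic; exact: measurableD.
  - exact: mC_cst.
  - apply: aeW => z; apply: cvgC_real.
    have [Sz|Sz] := pselect (S z); last first.
      rewrite (_ : (fun k => _) = fun=> 0); first exact: cvg_cst.
      by apply/funext => k; rewrite indicE memNset // => -[].
    have [u1 u2] := U_continuous z t0.
    have near0 : \forall k \near \oo, U (z + hdir (t k)) <> 0.
      have [re0|re0] := eqVneq (complex.Re (U z)) 0.
        have im0 : complex.Im (U z) != 0.
          by apply/eqP => im0; apply: Sz; apply/eqP; rewrite eq_complex re0 im0 !eqxx.
        by apply: filterS (cvgr_neq0 _ u2 im0) => k /eqP im e; apply: im; rewrite e.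
      by apply: filterS (cvgr_neq0 _ u1 re0) => k /eqP re e; apply: re; rewrite e.
    apply: cvg_near_cst; apply: filterS near0 => k hk.
    by rewrite indicE memNset // => -[].
  - exact: integrable_indic_fin.
  - move=> k z; rewrite n1_real ger0_norm ?indicE // ler_nat.
    have [Sz|nSz] := boolP (z \in S); first exact: leq_b1.
    by rewrite memNset // => -[Sz _]; move: nSz; rewrite mem_set.
have := h.1; rewrite int0 /=.
apply: cvg_trans; apply: near_eq_cvg; apply: nearW => k; rewrite swap /Rintegral integral_indic //.
  by rewrite setIT.
exact: measurableD.
Qed.

Section step.
Variable eps : R.
Hypothesis eps0 : eps != 0.

Let e (z : Cn R n) : R[i] := expi (- (lam * eps) * z.2 ord0 i0).

Let eX (z : Cn R n) j : e z ^+ j = expi (omega (hdir (j%:R * eps)) z).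
Proof.
rewrite omega_hdir; elim: j => [|j IH].
  by rewrite expr0 mul0r mulr0 oppr0 mul0r expi0.
rewrite exprS IH /e -expiD; congr expi; rewrite -[j.+1]addn1 natrD; ring.
Qed.

(** A polynomial [p] acts on [U] by multiplication with [p] evaluated at the
    character [e], and on the other side of the self-duality by a combination
    of translations. *)
Definition pmul (p : {poly R[i]}) z : R[i] := p.[e z] * U z.
Definition ptrans (p : {poly R[i]}) x : R[i] :=
  \sum_(j < size p) p`_j * U (x + hdir (j%:R * eps)).

Let mC_horner (p : {poly R[i]}) : measurableC (fun z => p.[e z]).
Proof.
under [X in measurableC X]eq_fun do rewrite horner_coef.
apply: mC_sum => j; apply: mCM; first exact: mC_cst.
by under [X in measurableC X]eq_fun do rewrite eX; apply: mC_expi; exact: measurable_omega.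
Qed.

Let horner_bounded (p : {poly R[i]}) : exists2 M, 0 <= M & forall z, n1 p.[e z] <= M.
Proof.
exists (\sum_(j < size p) n1 p`_j * 2).
  by apply: sumr_ge0 => j _; rewrite mulr_ge0 ?n1_ge0.
move=> z; rewrite horner_coef; apply: le_trans (n1_sum _ _) _; apply: ler_sum => j _.
apply: le_trans (n1M _ _) _; apply: ler_wpM2l; first exact: n1_ge0.
by rewrite eX n1_expi.
Qed.

Lemma iC_pmul p : integrableC nu (pmul p).
Proof. by have [M _ bM] := horner_bounded p; exact: (iCMl IU (mC_horner p) bM). Qed.

Lemma pmul_bounded p : exists M, forall z, n1 (pmul p z) <= M.
Proof.
have [M M0 bM] := horner_bounded p; have [MU MU0 bU] := U_bounded.
exists (M * MU) => z; apply: le_trans (n1M _ _) _.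
by apply: ler_pM; rewrite ?n1_ge0.
Qed.

Lemma iC_ptrans p : integrableC nu (ptrans p).
Proof.
apply: iC_sum => j; apply: iCZ; exact: (mp_iC (mpres_shiftCn _) IU).
Qed.

Lemma ptransE p x : ptrans p x = c%:C * integralC nu (fun z => pmul p z * expi (omega x z)).
Proof.
have Ij j : integrableC nu (fun z => U z * expi (omega (x + hdir (j%:R * eps)) z)).
  exact: iC_omega.
transitivity (\sum_(j < size p) c%:C * integralC nu
   (fun z => p`_j * (U z * expi (omega (x + hdir (j%:R * eps)) z)))).
  by apply: eq_bigr => j _; rewrite intZ // selfdual; ring.
rewrite -mulr_sumr -int_sum; last by move=> j; exact: iCZ.
congr (_ * _); apply: int_eq => z; rewrite /pmul horner_coef !mulr_suml.
by apply: eq_bigr => j _; rewrite omegaDl expiD eX; ring.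
Qed.

Lemma int_ptrans p z : c%:C * integralC nu (fun x => ptrans p x * expi (omega z x)) = pmul p z.
Proof.
pose Uj j (x : Cn R n) := U (x + hdir (j%:R * eps)).
have IUj j : integrableC nu (Uj j) by exact: (mp_iC (mpres_shiftCn _) IU).
have Ij j : integrableC nu (fun x => Uj j x * expi (omega z x)) by exact: iC_omega.
have ij j : c%:C * integralC nu (fun x => Uj j x * expi (omega z x)) = e z ^+ j * U z.
  rewrite [U z]selfdual mulrCA; congr (_ * _).
  rewrite [in RHS](mp_int (mpres_shiftCn (hdir (j%:R * eps))) (iC_mC (iC_omega z IU))).
  rewrite -intZ; last exact: (mp_iC (mpres_shiftCn _) (iC_omega z IU)).
  apply: int_eq => x; rewrite omegaDr expiD eX [omega z (hdir _)]omegaC.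
  have e1 : expi (omega (hdir (j%:R * eps)) z) * expi (- omega (hdir (j%:R * eps)) z) = 1 :> R[i].
    by rewrite -expiD subrr expi0.
  rewrite -[LHS]mul1r -e1 /Uj; ring.
rewrite (_ : (fun x => _) = fun x => \sum_(j < size p) p`_j * (Uj j x * expi (omega z x))); last first.
  by apply/funext => x; rewrite mulr_suml; apply: eq_bigr => j _; rewrite mulrA.
rewrite int_sum; last by move=> j; exact: iCZ.
rewrite mulr_sumr /pmul horner_coef mulr_suml; apply: eq_bigr => j _.
by rewrite intZ // mulrCA ij mulrA.
Qed.

Definition pform (p q : {poly R[i]}) : R[i] :=
  integralC nu (fun z => pmul p z * (pmul q z)^*%R).

Let iC_pform p q : integrableC nu (fun z => pmul p z * (pmul q z)^*%R).
Proof.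
have [M bM] := pmul_bounded q.
apply: (@iCM _ _ _ _ _ _ M (iC_pmul p)); first by apply: mC_conj; exact: iC_mC (iC_pmul q).
by move=> z; rewrite n1_conj.
Qed.

Let integrable_sqn_pmul p : nu.-integrable setT (fun z => (sqn (pmul p z))%:E).
Proof.
have [i1 _] := iC_pform p p.
move: i1; congr (integrable _ _ _); apply/funext => z; by rewrite mul_conj.
Qed.

Lemma pform_sqn p : pform p p = (\int[nu]_z sqn (pmul p z))%:C.
Proof. by rewrite -int_real; apply: int_eq => z; rewrite mul_conj. Qed.

Lemma pform_lin (a : R[i]) p q r : pform (a *: p + q) r = a * pform p r + pform q r.
Proof.
rewrite /pform -intZ // -intD //; last exact: iCZ.
by apply: int_eq => z; rewrite /pmul hornerD hornerZ; ring.
Qed.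

Lemma pform_herm p q : pform q p = (pform p q)^*%R.
Proof.
rewrite /pform -int_conj //; apply: int_eq => z.
by rewrite conjM conjKC mulrC.
Qed.

(** Plancherel for the pair [ptrans p], [pmul p]: each is the transform of the
    other, by self-duality, and both are integrable. *)
Lemma isometry p : nu.-integrable setT (fun x => (sqn (ptrans p x))%:E) /\
  \int[nu]_x sqn (ptrans p x) = \int[nu]_z sqn (pmul p z).
Proof.
have Ip := iC_ptrans p; have Iv := iC_pmul p.
have Icp := iC_conj Ip.
pose H (w : Cn R n * Cn R n) := (pmul p w.1 * (ptrans p w.2)^*%R) * expi (omega w.2 w.1).
have IH : integrableC (nu \x nu)%E H.
  apply: (iCM (iC_tensor Iv Icp) _ (fun _ => n1_expi _)); apply: mC_expi.
  exact: (measurableT_comp measurable_omega2 (@measurable_swap _ _ _ _)).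
have sq x : (sqn (ptrans p x))%:C = c%:C * integralC nu (fun z => H (z, x)).
  rewrite -mul_conj {1}ptransE -mulrA -intZr; last exact: iC_omega.
  by congr (_ * _); apply: int_eq => z; rewrite /H /=; ring.
have sqi z : c%:C * integralC nu (fun x => H (z, x)) = (sqn (pmul p z))%:C.
  rewrite -mul_conj -[X in _ * X^*%R](int_ptrans p z).
  rewrite conjM conj_realC mulrCA; congr (_ * _).
  rewrite -int_conj; last exact: iC_omega.
  rewrite -intZ; last exact: iC_conj (iC_omega z Ip).
  by apply: int_eq => x; rewrite /H /= conjM -expiN omegaC mulrA.
have I2 := iCZ c%:C (iC_int2 IH).
have Isq : integrableC nu (fun x => (sqn (ptrans p x))%:C).
  by apply: iC_eq I2 => y; rewrite sq.
split; first by have [] := Isq.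
apply: complexI; rewrite -!int_real.
transitivity (integralC nu (fun x => c%:C * integralC nu (fun z => H (z, x)))).
  by apply: int_eq => x; rewrite sq.
rewrite intZ; last exact: (iC_int2 IH).
rewrite -(fubiniC IH) -intZ; last exact: (iC_int1 IH).
by apply: int_eq => z; rewrite sqi.
Qed.

Let ell x p := integralC nu (fun z => pmul p z * expi (omega x z)).

(** Bessel's inequality for the orthogonal family [pmul (P k)] against the
    character [expi (omega x _)] restricted to the support [S], whose square norm
    is the measure [kap] of [S]. *)
Lemma bessel (N : nat) (P : nat -> {poly R[i]}) x :
  (forall k l, (k < N)%N -> (l < N)%N -> k <> l -> pform (P k) (P l) = 0) ->
  (forall k, (k < N)%N -> 0 < \int[nu]_z sqn (pmul (P k) z)) ->
  \sum_(k < N) sqn (ell x (P k)) / \int[nu]_z sqn (pmul (P k) z) <= kap.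
Proof.
move=> oP dP; pose d k := \int[nu]_z sqn (pmul (P k) z).
pose al k := (ell x (P k))^*%R / (d k)%:C.
(* the orthogonal projection of the conjugate character onto the family *)
pose Q := \sum_(k < N) al k *: P k.
pose Sig := \sum_(k < N) sqn (ell x (P k)) / d k.
have dC0 (k : 'I_N) : (d k)%:C != 0.
  by apply/eqP => /complexI/eqP; rewrite gt_eqF // dP.
have sqE (k : 'I_N) : (sqn (ell x (P k)) / d k)%:C = ell x (P k) * (ell x (P k))^*%R / (d k)%:C.
  by rewrite mul_conj -fmorphV -rmorphM.
have ellQ : ell x Q = Sig%:C.
  rewrite /ell (_ : (fun z => _) = fun z => \sum_(k < N) al k * (pmul (P k) z * expi (omega x z))); last first.
    apply/funext => z; rewrite /Q /pmul horner_sum !mulr_suml; apply: eq_bigr => k _.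
    by rewrite hornerZ -!mulrA.
  rewrite int_sum; last by move=> k; apply: iCZ; exact: iC_omega (iC_pmul _).
  rewrite /Sig rmorph_sum /=; apply: eq_bigr => k _.
  rewrite intZ; last exact: iC_omega (iC_pmul _).
  by rewrite sqE /al -/(ell x (P k)); ring.
have linQ r : pform Q r = \sum_(k < N) al k * pform (P k) r.
  rewrite /pform (_ : (fun z => _) = fun z => \sum_(k < N) al k * (pmul (P k) z * (pmul r z)^*%R)); last first.
    apply/funext => z; rewrite {1}/Q {1}/pmul horner_sum !mulr_suml; apply: eq_bigr => k _.
    by rewrite hornerZ -!mulrA.
  rewrite int_sum; last by move=> k; exact: iCZ.
  by apply: eq_bigr => k _; rewrite intZ.
have normQ : \int[nu]_z sqn (pmul Q z) = Sig.
  apply: complexI; rewrite -pform_sqn linQ /Sig rmorph_sum /=; apply: eq_bigr => k _.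
  rewrite pform_herm linQ (bigD1 k) //= big1 ?addr0; last first.
    move=> l lk; rewrite oP ?mulr0 // => e'; move: lk; rewrite -val_eqE /= e' eqxx //.
  rewrite pform_sqn -/(d k) conjM conj_realC.
  have -> : (al k)^*%R = ell x (P k) / (d k)%:C.
    by rewrite /al -fmorphV conjM conjKC conj_realC.
  by rewrite sqE /al; field; exact: dC0.
have IS : nu.-integrable setT (fun z => (\1_S z : R)%:E) by exact: integrable_indic_fin.
pose T z : R := complex.Re (pmul Q z * expi (omega x z)).
have [IT _] := iC_omega x (iC_pmul Q).
have pos z : 0 <= \1_S z + sqn (pmul Q z) - 2 * T z.
  have [Sz|Sz] := pselect (S z); last first.
    have U0 : U z = 0 by apply: contrapT.
    by rewrite /T /pmul U0 mulr0 mul0r /= indicE memNset // /sqn /= expr0n /= mulr0 !addr0 subr0.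
  rewrite indicE mem_set // /T; case: (pmul Q z) => u v /=.
  have := cos2Dsin2 (omega x z); rewrite /sqn /=.
  set C := cos _; set D := sin _ => h.
  have := sqr_ge0 (u - C); have := sqr_ge0 (v + D); rewrite !sqrrD sqrrN; lra.
have : 0 <= \int[nu]_z (\1_S z + sqn (pmul Q z) - 2 * T z) by apply: Rintegral_ge0 => z _; exact: pos.
rewrite RintegralB //; last 2 first.
- exact: (integrableD measurableT IS (integrable_sqn_pmul Q)).
- exact: (integrableZl measurableT 2 IT).
rewrite RintegralD //; last exact: integrable_sqn_pmul.
rewrite (RintegralZl 2 measurableT IT) normQ.
have -> : \int[nu]_z \1_S z = kap.
  by rewrite /Rintegral integral_indic // setIT.
have -> : \int[nu]_z T z = Sig.
  by have := congr1 (@complex.Re R) ellQ.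
rewrite -/Sig; lra.
Qed.


Lemma ptrans_eq0 (p : {poly R[i]}) N x : (size p <= N)%N ->
  (forall j, (j < N)%N -> U (x + hdir (j%:R * eps)) = 0) -> ptrans p x = 0.
Proof.
move=> pN Ux; rewrite /ptrans big1 // => j _.
by rewrite Ux ?mulr0 // (leq_trans (ltn_ord j)).
Qed.

Hypothesis U_neq0 : ~ {ae nu, forall z, U z = 0}.

Lemma pform_def p : pform p p = 0 -> p = 0.
Proof.
rewrite pform_sqn => /complexI p0; apply/eqP/negPn/negP => pn0; apply: U_neq0.
have le0 : lam * eps != 0 by rewrite mulf_neq0.
have : {ae nu, forall z, sqn (pmul p z) = 0}.
  apply: Rint_eq0 p0 => [z|]; [exact: sqn_ge0|exact: integrable_sqn_pmul].
have := ae_poly_phase_neq0 i0 (c := - (lam * eps)) (p := p).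
rewrite oppr_eq0 => /(_ le0 pn0).
apply: filterS2 => z pz /sqn_eq0/eqP; rewrite mulf_eq0 => /orP[/eqP //|/eqP //].
Qed.

(** An orthonormal family of [N] functions [pmul (P k)] has [N] as the sum of its
    square norms, and by [isometry] so has the family of the [ptrans (P k)]. But
    at each point the sum of squares of the latter is bounded by Bessel's
    inequality, and it vanishes off [N] translates of the support, which together
    exceed [S] by measure at most 1. *)
Lemma energy_bound N :
  \sum_(j < N) fine (nu (Sh (j%:R * eps) `\` S)) <= 1 ->
  N%:R <= c ^+ 2 * kap * (kap + 1).
Proof.
move=> small.
have [P [sP oP]] := gram_schmidt pform_lin pform_herm pform_def N.
pose d k := \int[nu]_z sqn (pmul (P k) z).
have dP k : (k < N)%N -> 0 < d k.
  move=> kN; rewrite lt_neqAle Rintegral_ge0 ?andbT; last by move=> z _; exact: sqn_ge0.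
  apply/eqP => d0; have : P k = 0 by apply: pform_def; rewrite pform_sqn -/(d k) -d0.
  by move=> Pk; have := sP k kN; rewrite Pk size_poly0.
have kap0 : 0 <= kap by apply: fine_ge0; exact: measure_ge0.
pose h (k : 'I_N) x := (d k)^-1 * sqn (ptrans (P k) x).
have Ih k : nu.-integrable setT (fun x => (h k x)%:E).
  exact: (integrableZl measurableT (d k)^-1 (isometry (P k)).1).
have [Is inth] := Rint_sum (index_enum 'I_N) Ih.
have hN : \int[nu]_x (\sum_(k < N) h k x) = N%:R.
  rewrite inth (eq_bigr (fun=> 1)) => [|k _]; first by rewrite sumr_const card_ord.
  rewrite (RintegralZl _ measurableT (isometry (P k)).1) (isometry (P k)).2.
  by rewrite mulVf // gt_eqF // dP.
pose b (j : 'I_N) x : R := \1_(Sh (j%:R * eps) `\` S) x.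
have mb (j : 'I_N) : measurable (Sh (j%:R * eps) `\` S) by exact: measurableD.
have boo (j : 'I_N) : (nu (Sh (j%:R * eps) `\` S) < +oo)%E.
  apply: le_lt_trans Uoo; rewrite -(nuSh (j%:R * eps)).
  by apply: le_measure; rewrite ?inE //; exact: subDsetl.
have Ib j : nu.-integrable setT (fun x => (b j x)%:E).
  exact: integrable_indic_fin (mb j) (boo j).
have [Isb intb] := Rint_sum (index_enum 'I_N) Ib.
have IS : nu.-integrable setT (fun z => (\1_S z : R)%:E) by exact: integrable_indic_fin.
have ID := integrableD measurableT IS Isb.
have pt x : \sum_(k < N) h k x <= c ^+ 2 * kap * (\1_S x + \sum_(j < N) b j x).
  have b0 j : 0 <= b j x by rewrite /b indicE.
  have ck0 : 0 <= c ^+ 2 * kap by rewrite mulr_ge0 ?sqr_ge0.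
  have hE k : h k x = c ^+ 2 * (sqn (ell x (P k)) / d k).
    rewrite /h ptransE -/(ell x (P k)) sqnM.
    have -> : sqn c%:C = c ^+ 2 by rewrite /sqn /= expr0n addr0.
    by ring.
  have hle : \sum_(k < N) h k x <= c ^+ 2 * kap.
    rewrite (eq_bigr _ (fun k _ => hE k)) -mulr_sumr; apply: ler_wpM2l; first exact: sqr_ge0.
    exact: bessel.
  have [Sx|Sx] := pselect (S x).
    apply: le_trans hle _; rewrite -[leLHS]mulr1; apply: ler_wpM2l => //.
    by rewrite indicE mem_set // lerDl; apply: sumr_ge0 => j _.
  have [[j Shj]|noSh] := pselect (exists j : 'I_N, Sh (j%:R * eps) x).
    apply: le_trans hle _; rewrite -[leLHS]mulr1; apply: ler_wpM2l => //.
    rewrite (bigD1 j) //= addrCA {1}/b indicE mem_set // lerDl.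
    by rewrite addr_ge0 ?indicE //; apply: sumr_ge0 => *; exact: b0.
  rewrite big1; first by rewrite mulr_ge0 // addr_ge0 ?indicE //; apply: sumr_ge0 => *; exact: b0.
  move=> k _; rewrite /h (@ptrans_eq0 _ N) ?sP //.
    by rewrite /sqn /= expr0n /= addr0 mulr0.
  by move=> j jN; apply: contrapT => Uj; apply: noSh; exists (Ordinal jN).
rewrite -hN; apply: le_trans (le_Rintegral measurableT Is _ (fun x _ => pt x)) _.
  exact: (integrableZl measurableT (c ^+ 2 * kap) ID).
rewrite (RintegralZl _ measurableT ID) RintegralD // intb.
have -> : \int[nu]_x \1_S x = kap by rewrite /Rintegral integral_indic // setIT.
apply: ler_wpM2l; first by rewrite mulr_ge0 ?sqr_ge0.
rewrite lerD2l; apply: le_trans small; apply: ler_sum => j _.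
by rewrite /b /Rintegral integral_indic // setIT.
Qed.

End step.

(** An uncertainty principle of Benedicks type. If [U] is not zero, the bound of
    [energy_bound] holds for all [N], since the step of the translations can be
    chosen after [N]; this is absurd. *)
Theorem benedicks w : U w = 0.
Proof.
have [U0|U_neq0] := pselect {ae nu, forall z, U z = 0}.
  rewrite selfdual (_ : integralC _ _ = 0) ?mulr0 // -[RHS](@int0 _ _ _ nu).
  apply: int_ae; [exact: iC_mC (iC_omega w IU)|exact: mC_cst|].
  by apply: filterS U0 => z ->; rewrite mul0r.
exfalso; pose M := c ^+ 2 * kap * (kap + 1).
pose N := (Num.truncn M).+1.
have MN : M < N%:R by exact: truncnS_gt.
suff [eps eps0 small] : exists2 eps : R, eps != 0 &
    \sum_(j < N) fine (nu (Sh (j%:R * eps) `\` S)) <= 1.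
  by have := energy_bound eps0 U_neq0 small; rewrite leNgt -/M MN.
have t0 (j : 'I_N) : (fun k => j%:R * k.+1%:R^-1 : R) @ \oo --> (0 : R).
  rewrite -(mulr0 j%:R); apply: cvgM; first exact: cvg_cst.
  exact: cvg_harmonic.
have : (fun k => \sum_(j < N) fine (nu (Sh (j%:R * k.+1%:R^-1) `\` S))) @ \oo --> (0 : R).
  elim: (index_enum 'I_N) => [|j s IH].
    by under eq_fun do rewrite big_nil; exact: cvg_cst.
  under eq_fun do rewrite big_cons.
  by have := cvgD (shift_support_small (t0 j)) IH; rewrite addr0; exact.
move=> /cvgr_lt/(_ 1 ltr01)[k _ /(_ k (leqnn k)) hk].
by exists k.+1%:R^-1; [rewrite invr_neq0|exact: ltW].
Qed.

End benedicks.

(** * Vanishing of the function *)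

Section vanishing.
Context {R : realType} {n : nat}.
Local Notation mu := (lebesgue_rV R n).
Local Notation nu := (lebesgue_Cn R n).
Local Notation leb := (@lebesgue_measure R).

Lemma finite_support (G : Cn R n -> R[i]) (A : set (Cn R n)) :
  measurableC G -> measurable A -> (nu A < +oo)%E ->
  {ae nu, forall z, ~ A z -> G z = 0} -> (nu [set z | G z <> 0%R] < +oo)%E.
Proof.
move=> mG mA Aoo [N [mN N0 GN]].
have mS : measurable [set z | G z <> 0] by exact: measurable_neq0.
apply: (@le_lt_trans _ _ (nu (A `|` N))).
  apply: le_measure; rewrite ?inE //; first exact: measurableU.
  move=> z Gz; have [Az|Az] := pselect (A z); [by left|right].
  by apply: GN => /(_ Az).
apply: le_lt_trans (measureU2 nu mA mN) _.
by rewrite [X in (_ + X)%E]N0 adde0.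
Qed.

(** The ambiguity function at [z] is a square root of the value at 0 of a self-dual
    function, whose support is in a translate of that of the ambiguity function. *)
Theorem rank_one_central_ft (n_ge1 : (1 <= n)%N) (B : set (Cn R n))
  (f : heisenberg R n -> R[i]) (lam : R) :
  integrableC (haar R n) f -> supported_on f (B `*` [set: R]) ->
  finite_lebesgue_measure nu B -> lam != 0 -> rank_one (fourier f lam) ->
  {ae nu, forall z, central_ft f lam z = 0}.
Proof.
move=> If fB [A [N [mA N0 BAN Aoo]]] lam0 /(rank_one_pft If)[a [b [L2a L2b pftF]]].
have IF := iC_central_ft lam If.
have FA := ae_ambig lam0 L2a L2b IF pftF.
pose G := ambig lam a b.
have mG : measurableC G := mC_ambig lam L2a L2b.
have Goo : (nu [set z | G z <> 0%R] < +oo)%E.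
  apply: (finite_support mG mA Aoo).
  have N0' : {ae nu, forall z, ~ N z}.
    by case: N0 => M [mM M0 NM]; exists M; split => // z /= /contrapT; exact: NM.
  apply: filterS3 FA N0' (central_ft_supp lam If fB) => z FAz Nz FB Az.
  by rewrite /G -FAz FB // BAN => -[].
suff G0 z : G z = 0 by apply: filterS FA => z ->; exact: G0.
pose U := sym_ambig lam a b z.
have IU : integrableC nu U := iC_sym_ambig lam0 L2a L2b IF pftF z.
have Uoo : (nu [set w | U w <> 0%R] < +oo)%E.
  apply: (@le_lt_trans _ _ (nu ((fun w => z + w) @^-1` [set w | G w <> 0%R]))).
    apply: le_measure; rewrite ?inE.
    - exact: measurable_neq0 (iC_mC IU).
    - rewrite -[X in measurable X]setTI.
      exact: ((mpres_shiftl z).1 measurableT _ (measurable_neq0 mG)).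
    - by move=> w /= Uw Gw; apply: Uw; rewrite /U /sym_ambig -/G Gw mul0r.
  by rewrite (mpres_shiftl z).2 //; exact: measurable_neq0.
have selfdual w : U w = (@cst_inv R n lam)%:C * integralC nu (fun z => U z * expi (omega lam w z)).
  case: w => tau sigma; exact: (sym_ambig_self_dual lam0 L2a L2b IF pftF z tau sigma).
have := benedicks (Ordinal n_ge1) lam0 (cst_inv_gt0 lam0) IU selfdual Uoo 0.
rewrite /U /sym_ambig addr0 subr0 => /eqP.
by rewrite mulf_eq0 orbb => /eqP.
Qed.

(** The hypothesis gives a null set for every [lam]; measurability in [(z, lam)]
    turns it into one valid for almost every [z] and almost all [lam]. *)
Lemma central_ft_injective (f : heisenberg R n -> R[i]) :
  integrableC (haar R n) f ->
  (forall lam, lam != 0 -> {ae nu, forall z, central_ft f lam z = 0}) ->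
  {ae haar R n, forall p, f p = 0}.
Proof.
move=> If F0.
have If' : integrableC (nu \x leb)%E f by exact: (mp_iC (mpres_haar n) If).
have mf := iC_mC If.
have mH : measurableC (fun p : Cn R n * R => central_ft f p.2 p.1).
  apply: (@mC_int1 _ _ _ _ _ leb (fun p : (Cn R n * R) * R => f (p.1.1, p.2) * expi (p.1.2 * p.2))).
  apply: mCM.
    apply: (mC_comp mf); apply: measurable_fun_pair; last exact: measurable_snd.
    exact: (measurableT_comp measurable_fst measurable_fst).
  apply: mC_expi; apply: measurable_funM; last exact: measurable_snd.
  exact: (measurableT_comp measurable_snd measurable_fst).
have F0ae : {ae (nu \x leb)%E, forall p : Cn R n * R, central_ft f p.2 p.1 = 0}.
  apply: ae_prod2; first exact: (measurable_neq0 mH).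
  have l0 : {ae leb, forall lam : R, lam != 0}.
    exists [set 0]; split => //; first exact: lebesgue_measure_set1.
    by move=> x /= /negP; rewrite negbK => /eqP.
  apply: (@filterS _ _ (ae_filter_ringOfSetsType leb) _ _ _ l0) => lam; exact: F0.
have f0 : {ae (nu \x leb)%E, forall p, f p = 0}.
  apply: ae_prod1; first exact: (measurable_neq0 mf).
  apply: filterS2 (ae_sections1 F0ae) (ae_iC1 If') => z z0 Iz.
  exact: fourier_line_unique Iz z0.
have back : mpres (haar R n) (nu \x leb)%E id by split.
exact: (mp_ae back f0).
Qed.

End vanishing.

Theorem theorem1p1 (R : realType) (n : nat) (n_ge1 : (1 <= n)%N)
    (B : set (Cn R n)) (f : heisenberg R n -> R[i])
    (f_L1 : integrableC (haar R n) f)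
    (f_supp : supported_on f (B `*` [set: R])) :
  (compact B ->
   (forall lam : R, lam != 0 -> finite_rank (fourier f lam)) ->
   {ae haar R n, forall p, f p = 0}) /\
  (finite_lebesgue_measure (lebesgue_Cn R n) B ->
   (forall lam : R, lam != 0 -> rank_one (fourier f lam)) ->
   {ae haar R n, forall p, f p = 0}).
Proof.
split=> [cB fr|finB r1]; apply: (central_ft_injective f_L1) => lam lam0.
  exact: (finite_rank_central_ft n_ge1 f_L1 f_supp cB lam0 (fr lam lam0)).
exact: (rank_one_central_ft n_ge1 f_L1 f_supp finB lam0 (r1 lam lam0)).
Qed.
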